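(* Let $\mathcal X,\mathcal Y$ be real infinite-dimensional separable Hilbert spaces, $\gamma=\mathcal N(0,C_{\mathcal X})$ a centered nondegenerate Gaussian measure on $\mathcal X$ with Cameron--Martin space $\mathcal E$. Let $F\in H^1_\gamma$ and let $(v_i)_{i=1}^\infty$ be an orthonormal basis of $\mathcal E$ for which $(C_{\mathcal X}^{-1}v_i)_{i=1}^\infty$ are well-defined in $\mathcal X$. For $r\in\mathbb N$ let $V_r=(v_i)_{i=1}^r$ and $Q_r=V_rV_r^\dagger=\sum_{i=1}^rv_i\otimes C_{\mathcal X}^{-1}v_i$. Then $$\mathbb E_\gamma\big[\|F-\mathbb E_\gamma[F\,|\,\sigma(V_r^\dagger)]\|_{\mathcal Y}^2\big]\le\mathbb E_\gamma\big[\|D_{\mathcal E}F(I-Q_r)\|^2_{\mathrm{HS}(\mathcal E,\mathcal Y)}\big].$$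
   Context: Setting. $C_{\mathcal X}$ is trace class and injective. $\mathcal E=\mathrm{Range}(C_{\mathcal X}^{1/2})$ with $\langle w_1,w_2\rangle_{\mathcal E}=\langle C_{\mathcal X}^{-1/2}w_1,C_{\mathcal X}^{-1/2}w_2\rangle_{\mathcal X}$. ''$C_{\mathcal X}^{-1}v$ well-defined in $\mathcal X$'' means $v\in\mathrm{Range}(C_{\mathcal X})$. $\mathrm{HS}$ denotes Hilbert--Schmidt operators/norm. Sobolev space. $\mathcal{FC}^\infty$ is the set of $F(x)=\sum_{i=1}^{M}\phi_i(\langle w_1,x\rangle_{\mathcal X},\dots,\langle w_n,x\rangle_{\mathcal X})y_i$ with $w_j\in\mathcal X$, $y_i\in\mathcal Y$, $\phi_i\in C_b^\infty(\mathbb R^n)$ (bounded together with all derivatives); $D_{\mathcal E}F(x)=DF(x)|_{\mathcal E}$; $H^1_\gamma$ is the completion of $\mathcal{FC}^\infty$ under $\|F\|^2_{H^1_\gamma}=\mathbb E_\gamma\|F\|_{\mathcal Y}^2+\mathbb E_\gamma\|D_{\mathcal E}F\|^2_{\mathrm{HS}(\mathcal E,\mathcal Y)}$, with $D_{\mathcal E}$ extended by continuity. Encoder and conditional expectation. $V_r\xi=\sum_{i=1}^r\xi_iv_i$, $V_r^\dagger x=(\langle C_{\mathcal X}^{-1}v_1,x\rangle_{\mathcal X},\dots,\langle C_{\mathcal X}^{-1}v_r,x\rangle_{\mathcal X})\in\mathbb R^r$, so $Q_rx=\sum_{i\le r}\langle C_{\mathcal X}^{-1}v_i,x\rangle_{\mathcal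 X}v_i$. $\sigma(V_r^\dagger)$ is the sigma-algebra on $\mathcal X$ generated by $V_r^\dagger$; the conditional expectation has the representative $\mathbb E_\gamma[F|\sigma(V_r^\dagger)](x)=\mathbb E_{z\sim\gamma}[F(Q_rx+(I-Q_r)z)]$. *)

(* Defs.v *)
From HB Require Import structures.
From mathcomp Require Import all_boot all_order all_algebra.
From mathcomp Require Import all_classical all_reals all_analysis.

Set Implicit Arguments.
Unset Strict Implicit.
Unset Printing Implicit Defensive.

Import Order.TTheory GRing.Theory Num.Theory.
Import numFieldNormedType.Exports.

Local Open Scope classical_set_scope.
Local Open Scope ring_scope.

HB.mixin Record NormedModule_isHilbert (R : realType) V
    of CompleteNormedModule R V := {
  dot : V -> V -> R ;
  dotC : forall u v, dot u v = dot v u ;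
  dotDl : forall u v w, dot (u + v) w = dot u w + dot v w ;
  dotZl : forall (a : R) u v, dot (a *: u) v = a * dot u v ;
  dotxx : forall u, dot u u = `|u| ^+ 2 }.

#[short(type="hilbertType")]
HB.structure Definition Hilbert (R : realType) :=
  {V of CompleteNormedModule R V & NormedModule_isHilbert R V}.

Definition separable (T : topologicalType) :=
  exists2 D : set T, countable D & dense D.

Definition infinite_dim (R : realType) (V : lmodType R) :=
  forall n (e : 'I_n -> V), exists x : V,
  forall a : 'I_n -> R, x <> \sum_(i < n) a i *: e i.

Notation borel T := (g_sigma_algebraType (@open T)).

Section Operators.
Context {R : realType} {X : hilbertType R}.

(* The subspace A of X carries its own inner product ip, which need not be the
   restriction of dot; convergence of the expansions is in the norm of ip. *)
Definition orthonormal_basis (A : set X) (ip : X -> X -> R) (e : nat -> X) :=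
  [/\ forall i, A (e i),
      forall i j, ip (e i) (e j) = (i == j)%:R &
      forall w, A w ->
        (fun n => let d := w - \sum_(i < n) ip (e i) w *: e i in ip d d)
          @ \oo --> (0 : R)].

Definition positive_operator (T : X -> X) :=
  [/\ linear T, continuous T,
      forall u v, dot (T u) v = dot u (T v) &
      forall u, 0 <= dot (T u) u].

(* For a positive operator the trace does not depend on the basis. *)
Definition trace_class (T : X -> X) :=
  exists2 e : nat -> X, orthonormal_basis setT dot e &
    (\sum_(0 <= i <oo) (dot (T (e i)) (e i))%:E < +oo)%E.

Definition covariance_operator (C : X -> X) :=
  positive_operator C /\ trace_class C.

Definition sqrt_operator (C : X -> X) : X -> X :=
  xget (fun=> 0) [set S | positive_operator S /\ S \o S = C].

(* Only meant for injective T and w in the range of T. *)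
Definition inv_operator (T : X -> X) (w : X) : X :=
  xget 0 [set u | T u = w].

(* With a zero variance, normal_prob is not the Dirac mass, hence the case
   distinction. *)
Definition centered_gaussian (C : X -> X) (gamma : probability (borel X) R) :=
  covariance_operator C /\
  forall (u : X) (B : set R), measurable B ->
    gamma (dot u @^-1` B) =
      if dot (C u) u == 0 then \d_(0 : R) B
      else normal_prob 0 (Num.sqrt (dot (C u) u)) B.

Definition cameron_martin (C : X -> X) : set X := range (sqrt_operator C).

Definition cm_dot (C : X -> X) (w1 w2 : X) : R :=
  dot (inv_operator (sqrt_operator C) w1) (inv_operator (sqrt_operator C) w2).

Definition cm_norm (C : X -> X) (w : X) : R := Num.sqrt (cm_dot C w w).

End Operators.

(* Operators from the Cameron-Martin space E to Y are represented by functions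
   on X, of which only the values on E matter. *)
Section HilbertSchmidt.
Context {R : realType} {X Y : hilbertType R} (C : X -> X).

Definition cm_basis : nat -> X :=
  xget (fun=> 0) [set e | orthonormal_basis (cameron_martin C) (cm_dot C) e].

Definition hs_norm2 (T : X -> Y) : \bar R :=
  (\sum_(0 <= i <oo) (`|T (cm_basis i)| ^+ 2)%:E)%E.

Definition cm_linear (T : X -> Y) :=
  forall (a : R) u v, cameron_martin C u -> cameron_martin C v ->
    T (a *: u + v) = a *: T u + T v.

Definition cm_bounded (T : X -> Y) :=
  exists M : R, forall u, cameron_martin C u -> `|T u| <= M * cm_norm C u.

Definition hilbert_schmidt (T : X -> Y) :=
  [/\ cm_linear T, cm_bounded T & (hs_norm2 T < +oo)%E].

Definition hs_open (O : set (X -> Y)) :=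
  forall T, hilbert_schmidt T -> O T -> exists2 e : R, 0 < e &
  forall T', hilbert_schmidt T' ->
    (hs_norm2 (fun h => (T' h - T h)%R) < (e ^+ 2)%:E)%E -> O T'.

Definition hs_measurable (G : X -> X -> Y) :=
  (forall x, hilbert_schmidt (G x)) /\
  (forall O, hs_open O -> measurable (G @^-1` O : set (borel X))).

End HilbertSchmidt.

Section Sobolev.
Context {R : realType} {X Y : hilbertType R}.

Definition iter_partial n (s : seq 'I_n) (f : 'rV[R]_n -> R) : 'rV[R]_n -> R :=
  foldr (fun j (g : 'rV[R]_n -> R) x => 'D_(delta_mx 0 j) g x) f s.

Definition Cb_infty n (f : 'rV[R]_n -> R) :=
  forall s : seq 'I_n,
  [/\ continuous (iter_partial s f),
      forall x j, derivable (iter_partial s f) x (delta_mx 0 j) &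
      exists M : R, forall x, `|iter_partial s f x| <= M].

Definition smooth_cylindrical (F : X -> Y) :=
  exists M n (w : 'I_n -> X) (y : 'I_M -> Y) (phi : 'I_M -> 'rV[R]_n -> R),
    (forall i, Cb_infty (phi i)) /\
    forall x, F x = \sum_(i < M) phi i (\row_j dot (w j) x) *: y i.

(* F belongs to H^1_gamma and DF = D_E F. The completion of the smooth
   cylindrical functions is realized as the closure of {(F, D_E F)} in
   L^2(gamma; Y) x L^2(gamma; HS(E, Y)), so that DF is the extension of D_E by
   continuity; 'd (Fn n) x is read on E only. *)
Definition gaussian_H1 (C : X -> X) (gamma : probability (borel X) R)
    (F : X -> Y) (DF : X -> X -> Y) :=
  [/\ measurable_fun [set: borel X] (F : borel X -> borel Y),
      hs_measurable C DF &
      exists Fn : nat -> X -> Y,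
      [/\ forall n, smooth_cylindrical (Fn n),
          (fun n => \int[gamma]_x (`|Fn n x - F x| ^+ 2)%:E)%E
            @ \oo --> (0 : \bar R)%E &
          (fun n => \int[gamma]_x
             hs_norm2 C (fun h => ('d (Fn n) x h - DF x h)%R))%E
            @ \oo --> (0 : \bar R)%E]].

(* Equality of the Bochner integrals over A is tested against every vector y of
   Y. *)
Definition is_condexp (gamma : probability (borel X) R) (G : set (set X))
    (F g : X -> Y) :=
  [/\ forall B : set (borel Y), measurable B -> G (g @^-1` B),
      (\int[gamma]_x (`|g x|)%:E < +oo)%E &
      forall A, G A -> forall y : Y,
        (\int[gamma]_(x in A) (dot (g x) y)%:E
         = \int[gamma]_(x in A) (dot (F x) y)%:E)%E].

End Sobolev.

Section Encoder.
Context {R : realType} {X : hilbertType R} (C : X -> X) (v : nat -> X).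
Variable r : nat.

Definition decoder (xi : 'rV[R]_r) : X := \sum_(i < r) xi ord0 i *: v i.

Definition encoder (x : X) : 'rV[R]_r :=
  \row_(i < r) dot (inv_operator C (v i)) x.

Definition encoder_proj (x : X) : X := decoder (encoder x).

Definition sigma_encoder : set (set X) :=
  g_sigma_algebra_preimage (encoder : borel X -> borel 'rV[R]_r).

End Encoder.

(* Main.v *)
(* By the minimality of the conditional expectation, EF may be replaced by any
   bounded function of the encoder. F is approximated in the Sobolev norm by
   trigonometric polynomials G = sum_k a_k cos (<u_k, x> + t_k), for which the
   conditional expectation H is explicit. Both E |G - H|^2 and the sum over
   i >= r of E |DG v_i|^2 are then quadratic forms in the a_k, whose kernels are
   functions of the covariance kernel p + t of the u_k, split along the encoder.
   The inequality reduces to the positive semidefiniteness of the kernels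
   t sinh (p + t) - cosh (p + t) + cosh p and
   t cosh (p + t) - sinh (p + t) + sinh p, which holds because their power series
   in p and t have nonnegative coefficients (Schur product theorem). *)

Require Import Defs.
From HB Require Import structures.
From mathcomp Require Import all_boot all_order all_algebra.
From mathcomp Require Import all_classical all_reals all_analysis.
From mathcomp Require Import measurable_realfun ring lra.

Set Implicit Arguments.
Unset Strict Implicit.
Unset Printing Implicit Defensive.
Import Order.TTheory GRing.Theory Num.Theory.
Import numFieldNormedType.Exports.
Local Open Scope classical_set_scope.
Local Open Scope ring_scope.

(** [centered_gaussian] prescribes the laws of single functionals only, and [gamma] is never
    decomposed as a product. This is what makes cosines convenient: a product of two of them is a
    sum of cosines of single functionals, so second moments reduce to one-dimensional characteristic
    functions. The two kernels come from the tangent inequality f p >= f (p + t) - t f' (p + t) for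
    convex f, with f = cosh and f = sinh on nonnegative reals; for kernels, nonnegative Taylor
    coefficients take the place of convexity. The constant 1 in the inequality leaves no room for
    loss, whereas passing from trigonometric polynomials to F costs triangle inequalities for
    squares. Hence the weights 1 + a and 1 + 1 / a, with an approximation error of order a^2 and
    then a tending to 0. The Sobolev approximation must control values and gradients at once.
    Bernstein polynomials in sin (s / L), with L growing, do both: they are trigonometric
    polynomials in s, and the derivative of a Bernstein polynomial is again one, built on the
    differences of its coefficients. *)

Section Dot.
Context {R : realType} {V : hilbertType R}.
Implicit Types (u v w : V) (a : R).

Lemma dotDr u v w : dot u (v + w) = dot u v + dot u w.
Proof. by rewrite dotC dotDl !(dotC u). Qed.
Lemma dotZr a u v : dot u (a *: v) = a * dot u v.
Proof. by rewrite dotC dotZl dotC. Qed.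
Lemma dot0l u : dot 0 u = 0.
Proof. by rewrite -(scale0r u) dotZl mul0r. Qed.
Lemma dot0r u : dot u 0 = 0.
Proof. by rewrite dotC dot0l. Qed.
Lemma dotNl u v : dot (- u) v = - dot u v.
Proof. by rewrite -scaleN1r dotZl mulN1r. Qed.
Lemma dotNr u v : dot u (- v) = - dot u v.
Proof. by rewrite dotC dotNl dotC. Qed.
Lemma dotBl u v w : dot (u - v) w = dot u w - dot v w.
Proof. by rewrite dotDl dotNl. Qed.
Lemma dotBr u v w : dot u (v - w) = dot u v - dot u w.
Proof. by rewrite dotDr dotNr. Qed.
Lemma dot_suml I (r : seq I) (P : pred I) (f : I -> V) v :
  dot (\sum_(i <- r | P i) f i) v = \sum_(i <- r | P i) dot (f i) v.
Proof. by elim/big_rec2: _ => [|i x y _ <-]; rewrite ?dot0l ?dotDl. Qed.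
Lemma dot_sumr I (r : seq I) (P : pred I) (f : I -> V) v :
  dot v (\sum_(i <- r | P i) f i) = \sum_(i <- r | P i) dot v (f i).
Proof. by elim/big_rec2: _ => [|i x y _ <-]; rewrite ?dot0r ?dotDr. Qed.

Lemma normB_sqr u v : `|u - v| ^+ 2 = `|u| ^+ 2 - 2 * dot u v + `|v| ^+ 2.
Proof. by rewrite -!dotxx dotBl !dotBr (dotC v u); ring. Qed.
Lemma normD_sqr u v : `|u + v| ^+ 2 = `|u| ^+ 2 + 2 * dot u v + `|v| ^+ 2.
Proof. by rewrite -!dotxx dotDl !dotDr (dotC v u); ring. Qed.

Lemma dot_young u v : 2 * dot u v <= `|u| ^+ 2 + `|v| ^+ 2.
Proof. by have := sqr_ge0 `|u - v|; rewrite normB_sqr; lra. Qed.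

Lemma CauchySchwarz u v : `|dot u v| <= `|u| * `|v|.
Proof.
have key (x y : V) : dot x y <= `|x| * `|y|.
  have [->|x0] := eqVneq x 0; first by rewrite dot0l normr0 mul0r.
  have [->|y0] := eqVneq y 0; first by rewrite dot0r normr0 mulr0.
  have nx : 0 < `|x| by rewrite normr_gt0.
  have ny : 0 < `|y| by rewrite normr_gt0.
  have := dot_young (`|x|^-1 *: x) (`|y|^-1 *: y).
  rewrite dotZl dotZr -!dotxx !dotZl !dotZr !dotxx.
  have -> : `|x|^-1 * (`|x|^-1 * `|x| ^+ 2) = 1 by field; rewrite normr_eq0.
  have -> : `|y|^-1 * (`|y|^-1 * `|y| ^+ 2) = 1 by field; rewrite normr_eq0.
  move=> h; have : `|x|^-1 * (`|y|^-1 * dot x y) <= 1 by lra.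
  by rewrite mulrA -invfM mulrC ler_pdivrMr ?mul1r// mulr_gt0.
rewrite ler_norml key andbT lerNl -dotNl -(normrN u); exact: key.
Qed.

Lemma dot_continuous u : continuous (dot u : V -> R).
Proof.
move=> x; apply/cvgrPdist_lt => e e0.
have u0 : 0 < `|u| + 1 by rewrite ltr_wpDl.
near=> y; rewrite -dotBr (le_lt_trans (CauchySchwarz _ _))//.
rewrite (@le_lt_trans _ _ ((`|u| + 1) * `|x - y|))//.
  by rewrite ler_wpM2r// lerDl.
rewrite -ltr_pdivlMl// mulrC.
near: y; apply: cvgr_dist_lt; last by rewrite divr_gt0.
exact: cvg_id.
Unshelve. all: by end_near. Qed.

(** Young's inequality for sqrt d u and v / sqrt d. A small d keeps the first coefficient close to
    1, which a sharp constant requires. *)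
Lemma le_norm_mulD (d : R) u v : 0 < d ->
  `|u + v| ^+ 2 <= (1 + d) * `|u| ^+ 2 + (1 + d^-1) * `|v| ^+ 2.
Proof.
move=> d0; rewrite normD_sqr.
have s0 : 0 < Num.sqrt d by rewrite sqrtr_gt0.
have := dot_young (Num.sqrt d *: u) ((Num.sqrt d)^-1 *: v).
rewrite dotZl dotZr [_ * (_^-1 * _)]mulrA divff ?gt_eqF// mul1r.
rewrite !normrZ !exprMn !ger0_norm ?invr_ge0 ?(ltW s0)// exprVn sqr_sqrtr ?(ltW d0)//.
by lra.
Qed.

End Dot.

(** * The characteristic function of a normal law *)

Section NormalCosine.
Context {R : realType} (s : R).
Hypothesis s0 : 0 < s.
Local Notation mu := (@lebesgue_measure R).
Local Notation g := (normal_fun 0 s).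

Lemma is_derive_normal_fun (x : R) :
  is_derive x 1 g (- (x / s ^+ 2) * g x).
Proof.
have -> : g = fun y => expR (- (s ^+ 2 *+ 2)^-1 * y ^+ 2).
  by apply/funext => y; rewrite /normal_fun subr0; congr expR; rewrite mulNr mulNr mulrC.
apply: is_derive_eq.
rewrite -![_ *: _]/(_ * _); field; exact: lt0r_neq0.
Qed.

Lemma continuous_normal_fun : continuous g.
Proof.
move=> x; apply/differentiable_continuous; rewrite -derivable1_diffP.
by have [] := is_derive_normal_fun x.
Qed.

Lemma is_derive_scale_arg (f df : R -> R) (a x : R) :
  (forall y : R, is_derive y (1 : R) f (df y)) ->
  is_derive x (1 : R) (fun y => f (a * y)) (a * df (a * x)).
Proof.
move=> hf; have h : is_derive x 1 (fun y : R => a * y) a.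
  by apply: is_derive_eq; rewrite -![_ *: _]/(_ * _) mulr1.
have := @is_derive1_comp _ f (fun y => a * y) x _ _ (hf _) h.
by rewrite mulrC.
Qed.

(** The Gaussian cosine integral is truncated to a segment, where integration by parts and
    differentiation under the integral sign apply directly; a tends to infinity only at the end. *)
Let psi (a l : R) := \int[mu]_(t in `[- a, a]) (cos (l * t) * g t).

Let continuous_integrable (f : R -> R) a b : continuous f ->
  mu.-integrable `[a, b] (EFin \o f).
Proof.
move=> cf; apply: continuous_compact_integrable; first exact: segment_compact.
exact: continuous_subspaceT.
Qed.

Let cos_scale_continuous (l : R) : continuous (fun t : R => cos (l * t)).
Proof.
move=> x; apply: continuous_comp; last exact: continuous_cos.
by apply: cvgMl_tmp; exact: cvg_id.
Qed.

Let sin_scale_continuous (l : R) : continuous (fun t : R => sin (l * t)).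
Proof.
move=> x; apply: continuous_comp; last exact: continuous_sin.
by apply: cvgMl_tmp; exact: cvg_id.
Qed.

(** The second factor is the derivative of g. Up to the factor s^2, the integrand is the
    l-derivative of that of [psi], so this yields the equation psi' = - s^2 l psi up to a boundary
    term. *)
Lemma cos_ibp a l : 0 < a ->
  \int[mu]_(t in `[- a, a]) (sin (l * t) * (- (t / s ^+ 2) * g t)) =
  2 * sin (l * a) * g a - l * psi a l.
Proof.
move=> a0.
have gE : g (- a) = g a by rewrite /normal_fun !subr0 sqrrN.
have df1 (x : R) : is_derive x 1 (fun t => sin (l * t)) (l * cos (l * x)).
  exact: is_derive_scale_arg.
rewrite (@Rintegration_by_parts R (fun t => sin (l * t)) g
  (fun t => l * cos (l * t)) (fun t => - (t / s ^+ 2) * g t)) ?gE.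
- have -> : sin (l * - a) = - sin (l * a) by rewrite mulrN sinN.
  under eq_Rintegral do rewrite -mulrA.
  rewrite RintegralZl//; first by rewrite -/(psi a l); ring.
  apply: (@continuous_integrable (fun t => cos (l * t) * g t)).
  move=> x; apply: cvgM; first exact: cos_scale_continuous.
  exact: continuous_normal_fun.
- by lra.
- apply: continuous_subspaceT => x; apply: cvgM; first exact: cvg_cst.
  exact: cos_scale_continuous.
- split.
  + by move=> x _; have [] := df1 x.
  + by apply: cvg_at_right_filter; exact: sin_scale_continuous.
  + by apply: cvg_at_left_filter; exact: sin_scale_continuous.
- by move=> x _; rewrite derive1E; have [] := df1 x.
- apply: continuous_subspaceT => x; apply: cvgM; last exact: continuous_normal_fun.
  by apply: cvgN; apply: cvgM; [exact: cvg_id|exact: cvg_cst].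
- split.
  + by move=> x _; have [] := is_derive_normal_fun x.
  + by apply: cvg_at_right_filter; exact: continuous_normal_fun.
  + by apply: cvg_at_left_filter; exact: continuous_normal_fun.
- by move=> x _; rewrite derive1E; have [] := is_derive_normal_fun x.
Qed.

Lemma is_derive_psi (a l : R) : 0 < a ->
  is_derive l (1 : R) (psi a) (s ^+ 2 * (2 * sin (l * a) * g a - l * psi a l)).
Proof.
move=> a0.
pose f (x t : R) := cos (x * t) * g t.
have df (x t : R) : is_derive x 1 (f ^~ t) (- (t * sin (x * t)) * g t).
  have h : is_derive x 1 (fun y => cos (t * y)) (t * - sin (t * x)).
    exact: is_derive_scale_arg.
  have -> : f ^~ t = fun y => g t * cos (t * y).
    by apply/funext => y; rewrite /f mulrC (mulrC y).
  apply: is_derive_eq.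
  by rewrite -![_ *: _]/(_ * _) mulrN (mulrC x); ring.
have d1f x t : partial1of2 f x t = - (t * sin (x * t)) * g t.
  by rewrite partial1of2E; have [] := df x t.
have cf (x : R) : continuous (f x).
  move=> t; apply: cvgM; first exact: cos_scale_continuous.
  exact: continuous_normal_fun.
(* The constant a dominates the l-derivative on the segment, because |t| <= a while the sine and g
   are at most 1 in absolute value. *)
have key := @cvg_differentiation_under_integral R _ _ mu f `[- a, a] (measurable_itv _)
  l (l - 1) (l + 1) _ _ _ (fun=> a) _ _ _.
have {}key : h^-1 *: (psi a (h + l) - psi a l) @[h --> 0^'] -->
    \int[mu]_(y in `[- a, a]) partial1of2 f l y.
  apply: key.
  - by rewrite /= in_itv/=; apply/andP; split; lra.
  - by move=> x _; exact: continuous_integrable.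
  - by move=> x t _ _; have [] := df x t.
  - by move=> _; exact: ltW.
  - by apply: continuous_integrable => ?; exact: cvg_cst.
  - move=> x t _; rewrite /= in_itv/= => ta.
    rewrite d1f normrM normrN normrM.
    have ta' : `|t| <= a by rewrite ler_norml.
    have s1 : `|sin (x * t)| <= 1 by rewrite ler_norml sin_geN1 sin_le1.
    have g1 : `|g t| <= 1.
      rewrite ger0_norm ?normal_fun_ge0// /normal_fun -expR0 ler_expR.
      by rewrite mulNr oppr_le0 divr_ge0// ?sqr_ge0// mulrn_wge0// sqr_ge0.
    rewrite -[leRHS]mulr1 -[leRHS in _ <= leRHS]mulr1.
    by apply: ler_pM => //; rewrite ?mulr_ge0//; apply: ler_pM.
have dpsi : derivable (psi a) l 1.
  apply/cvg_ex; eexists; under eq_fun do rewrite scaler1; exact: key.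
apply: DeriveDef => //.
rewrite -derive1E /derive1 (cvg_lim _ key)// -(cos_ibp l a0) -RintegralZl//.
  apply: eq_Rintegral => t _; by rewrite d1f; field; exact: lt0r_neq0.
apply: (@continuous_integrable (fun t => sin (l * t) * (- (t / s ^+ 2) * g t))).
move=> x; apply: cvgM; first exact: sin_scale_continuous.
apply: cvgM; last exact: continuous_normal_fun.
by apply: cvgN; apply: cvgM; [exact: cvg_id|exact: cvg_cst].
Qed.

(* The product exp (s^2 l^2 / 2) psi a l has a derivative in l that is a boundary
   term, of size g a. *)
Lemma psi_bound a : 0 < a ->
  `|expR (s ^+ 2 / 2) * psi a 1 - psi a 0| <= 2 * s ^+ 2 * expR (s ^+ 2 / 2) * g a.
Proof.
move=> a0.
pose h l := expR (s ^+ 2 / 2 * l ^+ 2) * psi a l.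
pose dh l := expR (s ^+ 2 / 2 * l ^+ 2) * (s ^+ 2 * (2 * sin (l * a) * g a)).
have der (x : R) : is_derive x 1 h (dh x).
  have := is_derive_psi x a0 => hd.
  rewrite /h/dh; apply: is_derive_eq.
  rewrite -![_ *: _]/(_ * _); by field.
have hc : {within `[0, 1], continuous h}.
  apply: continuous_subspaceT => x.
  by apply/differentiable_continuous; rewrite -derivable1_diffP; have [] := der x.
have [c c01] := @MVT _ h dh 0 1 ltr01 (fun x _ => der x) hc.
have -> : h 1 = expR (s ^+ 2 / 2) * psi a 1 by rewrite /h expr1n mulr1.
have -> : h 0 = psi a 0 by rewrite /h expr0n/= mulr0 expR0 mul1r.
move=> ->; rewrite subr0 mulr1 /dh.
move: c01; rewrite in_itv/= => /andP[c0 c1].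
have e1 : expR (s ^+ 2 / 2 * c ^+ 2) <= expR (s ^+ 2 / 2).
  rewrite ler_expR -[leRHS]mulr1 ler_wpM2l// ?divr_ge0 ?sqr_ge0//.
  by rewrite expr_le1// ltW.
have s1 : `|sin (c * a)| <= 1 by rewrite ler_norml sin_geN1 sin_le1.
rewrite !normrM (ger0_norm (expR_ge0 _)) (ger0_norm (normal_fun_ge0 _ _ _)).
rewrite (ger0_norm (ltW s0)) (ger0_norm (ler0n _ 2)) -expr2.
have -> : 2 * s ^+ 2 * expR (s ^+ 2 / 2) * g a = expR (s ^+ 2 / 2) * (s ^+ 2 * (2 * 1 * g a)) by ring.
have sg := sqr_ge0 s; have gg := normal_fun_ge0 0 s a.
apply: ler_pM => //; rewrite ?expR_ge0// ?(mulr_ge0, ltW s0)//.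
by rewrite ler_wpM2l// ler_wpM2r// ler_wpM2l.
Qed.

Let cvg_psi (l : R) : (fun n : nat => psi n%:R l) @ \oo -->
  \int[mu]_t (cos (l * t) * g t).
Proof.
have ig : mu.-integrable setT (EFin \o g).
  have := integrable_normal_pdf 0 s => /(integrableZl measurableT (normal_peak s)^-1).
  apply: eq_integrable => // x _ /=.
  rewrite normal_pdfE ?gt_eqF//= -EFinM mulrA mulVf ?mul1r//.
  by rewrite gt_eqF// normal_peak_gt0// gt_eqF.
have mf : measurable_fun setT (fun t => cos (l * t) * g t).
  apply: measurable_funM; last exact: measurable_normal_fun.
  apply: measurableT_comp; last exact: measurable_funM.
  by apply: continuous_measurable_fun; exact: continuous_cos.
pose fn (n : nat) := (EFin \o (fun t => cos (l * t) * g t)) \_ `[- n%:R, n%:R].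
have [] := @dominated_convergence _ _ R mu setT measurableT fn
  (fun t => (cos (l * t) * g t)%:E) (EFin \o g).
- move=> n; apply/measurable_restrict => //; rewrite setTI.
  by apply/measurable_EFinP; exact: measurable_funS mf.
- exact/measurable_EFinP.
- apply: aeW => t _; apply: cvg_near_cst; near=> n.
  rewrite /fn patchE ifT// inE/= in_itv/=.
  rewrite -ler_norml; near: n; exact: nbhs_infty_ger.
- exact: ig.
- apply: aeW => t n _; rewrite /fn patchE; case: ifPn => _ /=; last first.
    by rewrite normr0 lee_fin normal_fun_ge0.
  rewrite lee_fin normrM (ger0_norm (normal_fun_ge0 _ _ _)) ler_piMl ?normal_fun_ge0//.
  exact: cos_max.
move=> intf _ cvgf; rewrite /psi /Rintegral.
apply: fine_cvg; rewrite fineK; last exact: integrable_fin_num.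
apply: cvg_trans cvgf; apply: near_eq_cvg; near=> n.
by rewrite [RHS]integral_mkcond.
Unshelve. all: by end_near. Qed.

Lemma cvg_normal_fun : (fun n : nat => g n%:R) @ \oo --> 0.
Proof.
have c : 0 < s ^+ 2 *+ 2 by rewrite pmulrn_lgt0// exprn_gt0.
apply/cvgrPdist_lt => e e0; near=> n.
rewrite sub0r normrN ger0_norm ?normal_fun_ge0// /normal_fun subr0.
have n1 : 1 <= n%:R :> R by near: n; exact: nbhs_infty_ger.
rewrite mulNr expRN invf_plt ?posrE ?expR_gt0//.
(* The linear lower bound of exp suffices: for n >= 1 the exponent is at least n / (2 s^2), which
   exceeds 1 / e eventually. *)
have h := expR_ge1Dx (n%:R ^+ 2 / (s ^+ 2 *+ 2)).
rewrite (lt_le_trans _ h)// (@lt_le_trans _ _ (n%:R / (s ^+ 2 *+ 2)))//.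
  rewrite ltr_pdivlMr//; near: n; exact: nbhs_infty_gtr.
rewrite ler_wpDl// ler_pM2r ?invr_gt0// expr2 ler_peMl//.
Unshelve. all: by end_near. Qed.

(** The truncated difference exp (s^2 / 2) psi n 1 - psi n 0 converges to the difference of the full
    integrals, and to 0 by [psi_bound] since g n tends to 0. *)
Lemma integral_cos_normal_fun :
  \int[mu]_t (cos t * g t) = expR (- (s ^+ 2 / 2)) * \int[mu]_t g t.
Proof.
set A := LHS; set B := \int[mu]_t g t.
suff : expR (s ^+ 2 / 2) * A = B.
  by move=> <-; rewrite mulrA -expRD addNr expR0 mul1r.
have cA := @cvg_psi 1; have cB := @cvg_psi 0.
have EA : \int[mu]_t (cos (1 * t) * g t) = A.
  by apply: eq_Rintegral => t _; rewrite mul1r.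
have EB : \int[mu]_t (cos (0 * t) * g t) = B.
  by apply: eq_Rintegral => t _; rewrite mul0r cos0 mul1r.
rewrite EA in cA; rewrite EB in cB.
have cD : (fun n : nat => expR (s ^+ 2 / 2) * psi n%:R 1 - psi n%:R 0) @ \oo -->
    expR (s ^+ 2 / 2) * A - B.
  by apply: cvgB => //; apply: cvgM => //; exact: cvg_cst.
have c0 : (fun n : nat => expR (s ^+ 2 / 2) * psi n%:R 1 - psi n%:R 0) @ \oo --> 0.
  apply/cvgr0Pnorm_le => e e0; near=> n.
  have n0 : 0 < n%:R :> R by near: n; exact: nbhs_infty_gtr.
  rewrite (le_trans (psi_bound n0))//; near: n.
  have : (fun n : nat => 2 * s ^+ 2 * expR (s ^+ 2 / 2) * g n%:R) @ \oo --> 0.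
    rewrite -[X in _ --> X](mulr0 (2 * s ^+ 2 * expR (s ^+ 2 / 2))).
    by apply: cvgM; [exact: cvg_cst|exact: cvg_normal_fun].
  move/cvgr0Pnorm_le => /(_ e e0); apply: filterS => n; exact/le_trans/ler_norm.
by apply/eqP; rewrite -subr_eq0; apply/eqP; exact: (cvg_unique _ cD c0).
Unshelve. all: by end_near. Qed.

End NormalCosine.

(** * Integration against a density *)

Section Density.
Import HBNNSimple.

(** Monotone convergence along simple functions reduces the claim to indicators, where it is the
    hypothesis on nu. *)
Lemma integral_density d (T : measurableType d) (R : realType)
    (mu nu : {measure set T -> \bar R}) (p : T -> R) (f : T -> \bar R) :
  (forall x, 0 <= p x) -> measurable_fun setT p ->
  (forall A, measurable A -> nu A = \int[mu]_(x in A) (p x)%:E)%E ->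
  measurable_fun setT f -> (forall x, 0 <= f x)%E ->
  (\int[nu]_x f x = \int[mu]_x (f x * (p x)%:E))%E.
Proof.
move=> p0 mp nuE mf f0.
pose h := nnsfun_approx measurableT mf.
have ch (x : T) : (h n x)%:E @[n --> \oo] --> f x by exact: cvg_nnsfun_approx.
have mph n : measurable_fun setT (fun x => ((h n x)%:E * (p x)%:E)%E).
  by apply: emeasurable_funM; apply/measurable_EFinP.
have -> : (\int[nu]_x f x = lim (\int[nu]_x (h n x)%:E @[n --> \oo]))%E.
  rewrite -monotone_convergence//=.
  - by apply: eq_integral => x _; apply/esym/cvg_lim => //; exact: ch.
  - by move=> n; exact/measurable_EFinP.
  - by move=> n x _; rewrite lee_fin.
  - by move=> x _ a b ab; rewrite lee_fin; exact/lefP/nd_nnsfun_approx.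
have -> : (\int[mu]_x (f x * (p x)%:E) = lim (\int[mu]_x ((h n x)%:E * (p x)%:E) @[n --> \oo]))%E.
  rewrite -monotone_convergence//=.
  - apply: eq_integral => x _; apply/esym/cvg_lim => //.
    by apply: cvgeZr => //; exact: ch.
  - by move=> n x _; rewrite mule_ge0 ?lee_fin.
  - by move=> x _ a b ab; rewrite lee_wpmul2r ?lee_fin//; exact/lefP/nd_nnsfun_approx.
apply: congr_lim; apply/funext => n.
under eq_integral do rewrite fimfunE -fsumEFin//.
rewrite ge0_integral_fsum//; last 2 first.
- by move=> r; apply/measurable_EFinP; exact: measurable_funM.
- by move=> y x _; exact: nnfun_muleindic_ge0.
under [RHS]eq_integral.
  move=> x _; rewrite fimfunE -fsumEFin//.
  rewrite ge0_mule_fsuml; last by move=> y; exact: nnfun_muleindic_ge0.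
  over.
rewrite ge0_integral_fsum//; last 2 first.
- move=> r; apply: emeasurable_funM; last exact/measurable_EFinP.
  by apply/measurable_EFinP; exact: measurable_funM.
- by move=> y x _; rewrite mule_ge0 ?nnfun_muleindic_ge0 ?lee_fin.
apply: eq_fsbigr => r rhn.
under eq_integral do rewrite EFinM.
rewrite integralZl_indic_nnsfun//.
under [RHS]eq_integral do rewrite EFinM -muleA.
have r0 : 0 <= r by move: rhn; rewrite inE => -[x _ <-].
rewrite ge0_integralZl//; last 2 first.
- by apply: emeasurable_funM; apply/measurable_EFinP.
- by move=> x _; rewrite mule_ge0 ?lee_fin.
congr (_ * _)%E; rewrite integral_indic// setIT nuE// integral_mkcond.
by apply: eq_integral => x _; rewrite epatch_indic/= muleC.
Qed.

End Density.

Lemma integral_cos_normal_prob (R : realType) (s : R) : 0 < s ->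
  (\int[normal_prob 0 s]_x (cos x)%:E = (expR (- (s ^+ 2 / 2)))%:E)%E.
Proof.
move=> s0; have sn0 : s != 0 by rewrite gt_eqF.
pose N : {measure set (measurableTypeR R) -> \bar R} := normal_prob 0 s.
have mcos : measurable_fun setT (@cos R).
  by apply: continuous_measurable_fun; exact: continuous_cos.
have icos : N.-integrable setT (EFin \o @cos R).
  apply: measurable_bounded_integrable => //=.
    by rewrite probability_setT ltry.
  by exists 1; split => // M M1 x _ /=; rewrite (le_trans (cos_max _))// ltW.
have i1 : N.-integrable setT (EFin \o @cst R R 1).
  exact: finite_measure_integrable_cst.
have ipdf := integrable_normal_pdf 0 s.
have ipc : lebesgue_measure.-integrable setT (EFin \o (fun x => cos x * normal_pdf 0 s x)).
  have := @le_integrable _ _ R lebesgue_measure setT measurableT.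
  move=> /(_ (EFin \o (fun x => cos x * normal_pdf 0 s x)) _ _ _ ipdf); apply.
    by apply/measurable_EFinP; apply: measurable_funM => //; exact: measurable_normal_pdf.
  move=> x _; rewrite /= lee_fin normrM ler_piMl// cos_max//.
(* [integral_density] is about nonnegative integrands, hence cos + 1; the constant is subtracted
   afterwards. *)
have : (\int[N]_x (cos x + 1)%:E =
    \int[lebesgue_measure]_x ((cos x + 1)%:E * (normal_pdf 0 s x)%:E))%E.
  apply: integral_density => //.
  - exact: normal_pdf_ge0.
  - exact: measurable_normal_pdf.
  - by apply/measurable_EFinP; apply: measurable_funD.
under eq_integral do rewrite EFinD.
rewrite integralD//= integral_cst// mul1e.
under [in RHS]eq_integral do rewrite -EFinM mulrDl mul1r EFinD.
rewrite integralD//= integral_normal_pdf.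
have -> : N setT = 1%E by exact: probability_setT.
move/(congr1 (fun z => z - 1)%E); rewrite !addeK// => ->.
rewrite -[LHS]fineK; last exact: integrable_fin_num.
congr EFin.
have := integral_cos_normal_fun s0 => /(congr1 (fun z => normal_peak s * z)).
have gE x : normal_peak s * normal_fun 0 s x = normal_pdf 0 s x.
  by rewrite normal_pdfE.
have pk : normal_peak s != 0 by rewrite gt_eqF// normal_peak_gt0.
have fE : normal_fun 0 s = fun x => (normal_peak s)^-1 * normal_pdf 0 s x.
  by apply/funext => x; rewrite -gE mulrA mulVf// mul1r.
rewrite mulrCA; have -> : normal_peak s * \int[lebesgue_measure]_t normal_fun 0 s t = 1.
  rewrite fE RintegralZl//= mulrA mulfV// mul1r /Rintegral.
  by under eq_integral do [rewrite /=]; rewrite integral_normal_pdf.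
rewrite mulr1 => <-; rewrite -/(Rintegral _ _ _).
under [in RHS]eq_Rintegral do rewrite fE mulrCA.
by rewrite RintegralZl//= mulrA mulfV// mul1r.
Qed.

(** * Positive semidefinite kernels *)

Section PositiveDefinite.
Context {R : realType} {Y : hilbertType R} {T : Type}.
Implicit Types (K G : T -> T -> R) (s : seq T) (a : T -> Y).

(** Tested against vectors of [Y], as the coefficients of the trigonometric polynomials are vectors;
    no decomposition into coordinates is then called for. *)
Definition psd K := forall s a,
  0 <= \sum_(k <- s) \sum_(l <- s) K k l * dot (a k) (a l).

Lemma psdD K G : psd K -> psd G -> psd (fun k l => K k l + G k l).
Proof.
move=> hK hG s a; have := addr_ge0 (hK s a) (hG s a).
rewrite -big_split/=; under eq_bigr do rewrite -big_split/=.
by under eq_bigr do under eq_bigr do rewrite -mulrDl.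
Qed.

Lemma psdZ (c : R) K : 0 <= c -> psd K -> psd (fun k l => c * K k l).
Proof.
move=> c0 hK s a; have := mulr_ge0 c0 (hK s a).
rewrite mulr_sumr; under eq_bigr do rewrite mulr_sumr.
by under eq_bigr do under eq_bigr do rewrite mulrA.
Qed.

Lemma psd0 : psd (fun _ _ => 0).
Proof. by move=> s a; rewrite !big1// => k _; rewrite big1// => l _; rewrite mul0r. Qed.

Lemma psd_sum I (r : seq I) (P : pred I) (K : I -> T -> T -> R) :
  (forall i, P i -> psd (K i)) -> psd (fun k l => \sum_(i <- r | P i) K i k l).
Proof.
move=> hK; elim: r => [|i r IH].
  by under eq_fun do under eq_fun do rewrite big_nil; exact: psd0.
under eq_fun do under eq_fun do rewrite big_cons.
by case Pi: (P i) => //; apply: psdD => //; exact: hK.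
Qed.

Lemma psd1 : psd (fun _ _ => 1).
Proof.
move=> s a; have := sqr_ge0 `|\sum_(k <- s) a k|.
rewrite -dotxx dot_suml; under eq_bigr do rewrite dot_sumr.
by under [X in _ -> 0 <= X]eq_bigr do under eq_bigr do rewrite mul1r.
Qed.

Lemma psd_rank1M (f : T -> R) K : psd K -> psd (fun k l => f k * f l * K k l).
Proof.
move=> hK s a; have := hK s (fun k => f k *: a k).
congr (0 <= _); apply: eq_bigr => k _; apply: eq_bigr => l _.
by rewrite dotZl dotZr; ring.
Qed.

Lemma psd_lim (Kn : nat -> T -> T -> R) K : (forall n, psd (Kn n)) ->
  (forall k l, Kn n k l @[n --> \oo] --> K k l) -> psd K.
Proof.
move=> hK cK s a.
have : \sum_(k <- s) \sum_(l <- s) Kn n k l * dot (a k) (a l) @[n --> \oo] -->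
    \sum_(k <- s) \sum_(l <- s) K k l * dot (a k) (a l).
  apply: cvg_big => [|k _]; first exact: add_continuous.
  apply: cvg_big => [|l _]; first exact: add_continuous.
  by apply: cvgM; [exact: cK|exact: cvg_cst].
move=> h; rewrite -(cvg_lim _ h)//; apply: limr_ge; first by apply/cvg_ex; eexists; exact: h.
by apply: nearW => n; exact: hK.
Qed.

(** Schur's product theorem for a limit of sums of rank-one kernels: multiplying by a rank-one
    kernel merely rescales the coefficients, and sums and pointwise limits preserve positivity. The
    start m of the sum serves the tail of a series. *)
Lemma psd_gramM (f : nat -> T -> R) G m :
  (forall k l, \sum_(m <= i < n) f i k * f i l @[n --> \oo] --> G k l) ->
  forall K, psd K -> psd (fun k l => G k l * K k l).
Proof.
move=> cG K hK.
apply: (@psd_lim (fun n k l => (\sum_(m <= i < n) f i k * f i l) * K k l)).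
  move=> n; under eq_fun do under eq_fun do rewrite mulr_suml.
  by apply: psd_sum => i _; exact: psd_rank1M.
by move=> k l; apply: cvgM => //; exact: cvg_cst.
Qed.

Section Taylor.
(** What is assumed of p and t is that multiplication by them preserves positive semidefiniteness,
    which is the form in which [psd_gramM] delivers it. *)
Variables p t : T -> T -> R.
Hypothesis psd_pM : forall K, psd K -> psd (fun k l => p k l * K k l).
Hypothesis psd_tM : forall K, psd K -> psd (fun k l => t k l * K k l).
Local Notation m := (fun k l => p k l + t k l).

Let psd_mX n : psd (fun k l => m k l ^+ n).
Proof.
elim: n => [|n IH]; first by under eq_fun do under eq_fun do rewrite expr0; exact: psd1.
under eq_fun do under eq_fun do rewrite exprS mulrDl.
by apply: psdD; [exact: psd_pM|exact: psd_tM].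
Qed.

(* The binomial expansion of this kernel in powers of p and t has the
   nonnegative coefficients (j - 1) * 'C(n, j). *)
Lemma psd_taylor n :
  psd (fun k l => n%:R * t k l * m k l ^+ n.-1 + p k l ^+ n - m k l ^+ n).
Proof.
elim: n => [|n IH].
  under eq_fun do under eq_fun do rewrite !expr0 mul0r mul0r add0r subrr.
  exact: psd0.
(* A recursion in n replaces the binomial expansion: apart from the factor n, it only multiplies
   positive semidefinite kernels by p and t. *)
have -> : (fun k l => n.+1%:R * t k l * m k l ^+ n.+1.-1 + p k l ^+ n.+1 - m k l ^+ n.+1)
  = (fun k l => p k l * (n%:R * t k l * m k l ^+ n.-1 + p k l ^+ n - m k l ^+ n) +
       n%:R * (t k l * (t k l * m k l ^+ n.-1))).
  apply/funext => k; apply/funext => l; case: n IH => [|n] _ /=; first by rewrite !expr0 !expr1; ring.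
  by rewrite !exprS; ring.
by apply: psdD; [exact: psd_pM|apply: psdZ => //; do 2 apply: psd_tM].
Qed.

Let S n (x : R) : R := \sum_(0 <= i < n) x ^+ i / i`!%:R.

Let cvg_S (x : R) : S n x @[n --> \oo] --> expR x.
Proof. by have := @is_cvg_series_exp_coeff R x; rewrite /expR /series /exp_coeff. Qed.

(** Differentiating the truncated exponential series term by term loses one order, hence [S n] next
    to [S n.+1] in the next proof. *)
Let S_shift n (x y : R) :
  \sum_(0 <= i < n.+1) i%:R * y * x ^+ i.-1 / i`!%:R = y * S n x.
Proof.
rewrite /S big_nat_recl//= !mul0r add0r mulr_sumr; apply: eq_bigr => i _.
rewrite factS natrM; field.
by rewrite nat1r !pnatr_eq0 -lt0n fact_gt0.
Qed.

(** For b = false, c is cosh and c' is sinh; for b = true they are exchanged, so that c' is the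
    derivative of c in both cases. The series of c has the coefficients w i / i!, where w is 1 on
    the indices of one parity and 0 on the others, so the kernel is a nonnegative combination of
    those of [psd_taylor]. *)
Lemma psd_exp_sign (b : bool) : let c x := (expR x + (-1) ^+ b * expR (- x)) / 2 in
  let c' x := (expR x - (-1) ^+ b * expR (- x)) / 2 in
  psd (fun k l => t k l * c' (m k l) - c (m k l) + c (p k l)).
Proof.
move=> c c'.
pose w i : R := (1 + (-1) ^+ b * (-1) ^+ i) / 2.
have w0 i : 0 <= w i.
  by rewrite /w -exprD -signr_odd; case: (odd _); rewrite ?expr0 ?expr1; lra.
apply: (@psd_lim (fun n k l => \sum_(0 <= i < n.+1) w i / i`!%:R *
   (i%:R * t k l * m k l ^+ i.-1 + p k l ^+ i - m k l ^+ i))).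
  move=> n; apply: psd_sum => i _; apply: psdZ; last exact: psd_taylor.
  by rewrite divr_ge0.
move=> k l; set M := m k l; set P := p k l; set A := t k l.
rewrite [X in X @ _](_ : _ = (fun n =>
   A * ((S n M - (-1) ^+ b * S n (- M)) / 2)
   - (S n.+1 M + (-1) ^+ b * S n.+1 (- M)) / 2
   + (S n.+1 P + (-1) ^+ b * S n.+1 (- P)) / 2)); last first.
  apply/funext => n.
  have -> : A * ((S n M - (-1) ^+ b * S n (- M)) / 2) =
     (A * S n M + (-1) ^+ b * ((- A) * S n (- M))) / 2 by ring.
  rewrite -(S_shift n M A) -(S_shift n (- M) (- A)) /S !mulr_sumr -!big_split/= !mulr_suml -sumrB -big_split/=.
  apply: eq_bigr => i _; rewrite /w.
  have -> : i%:R * - A * (- M) ^+ i.-1 = (-1) ^+ i * (i%:R * A * M ^+ i.-1).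
    case: i => [|i]; first by rewrite !mul0r mulr0.
    by rewrite succnK (exprNn M i) exprS; ring.
  by rewrite (exprNn M i) (exprNn P i) -/A -/M -/P; ring.
have cS x : S n.+1 x @[n --> \oo] --> expR x by have := @cvg_S x; rewrite -cvg_shiftS.
have cE (f : nat -> R -> R) x : (forall y, f n y @[n --> \oo] --> expR y) ->
    (f n x + (-1) ^+ b * f n (- x)) / 2 @[n --> \oo] --> c x.
  move=> hf; apply: cvgM; last exact: cvg_cst.
  by apply: cvgD => //; apply: cvgM; [exact: cvg_cst|exact: hf].
apply: cvgD; last exact: (cE (fun n => S n.+1)).
apply: cvgB; last exact: (cE (fun n => S n.+1)).
apply: cvgM; first exact: cvg_cst.
apply: cvgM; last exact: cvg_cst.
by apply: cvgB; [exact: cvg_S|apply: cvgM; [exact: cvg_cst|exact: cvg_S]].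
Qed.

End Taylor.
End PositiveDefinite.

(** * Borel measurability of continuous maps *)

Section BorelContinuous.
Context {R : realType}.

Lemma continuous_borel_measurable (T : ptopologicalType) (f : T -> R) :
  continuous f -> measurable_fun [set: borel T] (f : borel T -> R).
Proof.
move=> /continuousP cf.
apply: (measurability _ (RGenOpens.measurableE R)).
move=> _ [_ [a [b ->] <-]]; rewrite setTI.
by apply: sub_sigma_algebra; exact/cf/interval_open.
Qed.

Lemma continuous_borel_measurable_fun (T U : ptopologicalType) (f : T -> U) :
  continuous f -> measurable_fun [set: borel T] (f : borel T -> borel U).
Proof.
move=> /continuousP cf; apply: (@measurability _ _ (borel T) (borel U) setT f (@open U)) => //.
move=> _ [B oB <-]; rewrite setTI.
by apply: sub_sigma_algebra; exact: cf.
Qed.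

End BorelContinuous.

(** * Trigonometric polynomials *)

Section TrigPoly.
Context {R : realType} {X Y : hilbertType R}.
Local Notation term := (Y * X * R)%type.
Implicit Types (s : seq term) (x h : X).

(* The term (a, u, t) stands for x |-> cos (<u, x> + t) a. *)
Definition trig_poly s x : Y :=
  \sum_(k <- s) cos (dot k.1.2 x + k.2) *: k.1.1.

Definition trig_diff s x h : Y :=
  \sum_(k <- s) (- sin (dot k.1.2 x + k.2) * dot k.1.2 h) *: k.1.1.

(** A phase shift by pi / 2 turns - sin into cos, so a directional derivative is again a
    trigonometric polynomial and obeys the same integral formula. *)
Definition trig_diff_terms s h : seq term :=
  [seq (dot k.1.2 h *: k.1.1, k.1.2, k.2 + pi / 2) | k <- s].

Lemma trig_diffE s x h : trig_diff s x h = trig_poly (trig_diff_terms s h) x.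
Proof.
rewrite /trig_diff /trig_poly big_map; apply: eq_bigr => k _ /=.
by rewrite scalerA addrA cosDpihalf.
Qed.

Lemma cos_dot_continuous (u : X) (t : R) : continuous (fun x => cos (dot u x + t)).
Proof.
move=> x; apply: (@continuous_comp _ _ _ (fun x => dot u x + t) cos).
  by apply: cvgD; [exact: dot_continuous|exact: cvg_cst].
exact: continuous_cos.
Qed.

Lemma trig_poly_continuous s : continuous (trig_poly s).
Proof.
move=> x; rewrite /trig_poly.
apply: cvg_big => [|k _]; first exact: add_continuous.
by apply: cvgZr_tmp; exact: cos_dot_continuous.
Qed.

Lemma trig_poly_bounded s : exists M, forall x, `|trig_poly s x| <= M.
Proof.
exists (\sum_(k <- s) `|k.1.1|) => x; rewrite (le_trans (ler_norm_sum _ _ _))//.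
by apply: ler_sum => k _; rewrite normrZ ler_piMl// cos_max.
Qed.

End TrigPoly.

(** * Gaussian integrals of trigonometric polynomials *)

Section GaussianTrig.
Context {R : realType} {X Y : hilbertType R} (C : X -> X)
  (gamma : probability (borel X) R).
Hypothesis gaussian_gamma : centered_gaussian C gamma.
Local Notation q u w := (dot (C u) w).

Lemma gaussian_measurable (u : X) : measurable_fun [set: borel X] (dot u : borel X -> measurableTypeR R).
Proof. by apply: continuous_borel_measurable; exact: dot_continuous. Qed.

Lemma gaussian_integrable_cos (u : X) (t : R) :
  gamma.-integrable setT (fun x => (cos (dot u x + t))%:E).
Proof.
apply: measurable_bounded_integrable => //.
- by rewrite -ge0_fin_numE//; exact: fin_num_measure.
- by apply: (@continuous_borel_measurable _ X); exact: cos_dot_continuous.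
- by exists 1; split => // M M1 x _ /=; rewrite (le_trans (cos_max _))// ltW.
Qed.

Lemma gaussian_integral_cos (u : X) :
  (\int[gamma]_x (cos (dot u x))%:E = (expR (- (q u u / 2)))%:E)%E.
Proof.
have [[[_ _ _ C0] _] law] := gaussian_gamma.
pose f := (fun y : measurableTypeR R => (cos y)%:E).
have mf : measurable_fun [set: measurableTypeR R] f.
  apply/measurable_EFinP; apply: continuous_measurable_fun; exact: continuous_cos.
have if_ : gamma.-integrable (dot u @^-1` setT) (f \o (dot u : borel X -> measurableTypeR R)).
  have := gaussian_integrable_cos u 0; rewrite preimage_setT.
  by apply: eq_integrable => // x _; rewrite /f/= addr0.
have := integral_pushforward (gaussian_measurable u) mf if_ measurableT.
rewrite preimage_setT => <-.
have [q0|qn0] := eqVneq (q u u) 0; have := law u.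
  rewrite q0 eqxx => lawu; rewrite mul0r oppr0 expR0.
  rewrite (eq_measure_integral (\d_(0 : measurableTypeR R))); last 2 first.
  - exact: gaussian_measurable.
  - by move=> m A mA _; exact: lawu.
  by rewrite integral_dirac// diracT mul1e /f cos0.
rewrite (negbTE qn0) => lawu; have qgt0 : 0 < q u u by rewrite lt_neqAle eq_sym qn0 C0.
transitivity (\int[normal_prob 0 (Num.sqrt (q u u))]_y f y)%E.
  pose N : {measure set (measurableTypeR R) -> \bar R} := normal_prob 0 (Num.sqrt (q u u)).
  apply: (@eq_measure_integral _ (measurableTypeR R) R setT N); first exact: gaussian_measurable.
  by move=> m A mA _; exact: lawu.
by rewrite integral_cos_normal_prob ?sqrtr_gt0// sqr_sqrtr// ltW.
Qed.

(* The law of <u, x> is symmetric since <u, x> and <-u, x> have the same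
   variance. *)
Lemma gaussian_integral_sin (u : X) :
  (\int[gamma]_x (sin (dot u x))%:E = 0)%E.
Proof.
have [[[linC _ _ _] _] law] := gaussian_gamma.
have msin : measurable_fun [set: measurableTypeR R] (EFin \o @sin R).
  apply/measurable_EFinP; apply: continuous_measurable_fun; exact: continuous_sin.
have isin w : gamma.-integrable setT (fun x : borel X => (sin (dot w x))%:E).
  have := gaussian_integrable_cos w (- (pi / 2)).
  by apply: eq_integrable => // x _; rewrite cosBpihalf.
have isin' w : gamma.-integrable (dot w @^-1` setT)
    ((EFin \o @sin R) \o (dot w : borel X -> measurableTypeR R)).
  by rewrite preimage_setT; exact: isin.
have e : (\int[gamma]_x (sin (dot u x))%:E = \int[gamma]_x (sin (dot (- u) x))%:E)%E.
  have := integral_pushforward (gaussian_measurable u) msin (isin' u) measurableT.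
  have := integral_pushforward (gaussian_measurable (- u)) msin (isin' (- u)) measurableT.
  rewrite !preimage_setT /= => <- <-.
  apply: eq_measure_integral; try exact: gaussian_measurable.
  move=> m m' A mA _; rewrite /= /pushforward.
  have CN : C (- u) = - C u.
    by have := linC (-1) u 0; rewrite scaleN1r addr0 => ->; rewrite scaleN1r; have := linC (-1) 0 0; rewrite scaleN1r addr0 oppr0 scaleN1r => ->; rewrite addNr addr0.
  apply: etrans; first exact: (law u A mA).
  apply/esym/(etrans (law (- u) A mA)).
  by rewrite CN dotNl dotNr opprK.
have : (\int[gamma]_x (sin (dot (- u) x))%:E = - \int[gamma]_x (sin (dot u x))%:E)%E.
  under eq_integral do rewrite dotNl sinN EFinN.
  by rewrite integralN//=; exact: integrable_add_def.
rewrite -e -(fineK (integrable_fin_num measurableT (isin u))) => -[] h.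
by congr EFin; lra.
Qed.

(** The mixed second moment of two cosine terms: the cosines of the phases multiply the cosh of the
    covariance of <u, x> and <w, x>, the sines its sinh. *)
Definition cos_cov (u : X) (t : R) (w : X) (t' : R) : R :=
  expR (- (q u u / 2)) * expR (- (q w w / 2)) *
  (cos t * cos t' * ((expR (q u w) + expR (- q u w)) / 2) +
   sin t * sin t' * ((expR (q u w) - expR (- q u w)) / 2)).

(** The product-to-sum formula leaves the single functionals u - w and u + w, whose laws are known;
    the polarized variances then regroup into cosh and sinh. *)
Lemma gaussian_integral_cosM (u w : X) (t t' : R) :
  (\int[gamma]_x (cos (dot u x + t) * cos (dot w x + t'))%:E
   = (cos_cov u t w t')%:E)%E.
Proof.
have [[[linC _ symC _] _] _] := gaussian_gamma.
have CD a b : C (a + b) = C a + C b by have := linC 1 a b; rewrite !scale1r.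
have CN a : C (- a) = - C a.
  have C0 : C 0 = 0 by apply: (@addrI _ (C 0)); rewrite -CD !addr0.
  by apply: (@addrI _ (C a)); rewrite -CD !subrr.
have qC : q w u = q u w by rewrite symC dotC.
have qN : q (u - w) (u - w) = q u u + q w w - 2 * q u w.
  by rewrite CD CN !dotDl !dotDr !dotNl !dotNr qC; ring.
have qP : q (u + w) (u + w) = q u u + q w w + 2 * q u w.
  by rewrite CD !dotDl !dotDr qC; ring.
have icos v s : gamma.-integrable setT (fun x : borel X => (s * cos (dot v x))%:E).
  have := gaussian_integrable_cos v 0 => /(integrableZl measurableT s).
  by apply: eq_integrable => // x _; rewrite addr0 EFinM.
have isin v s : gamma.-integrable setT (fun x : borel X => (s * sin (dot v x))%:E).
  have := gaussian_integrable_cos v (- (pi / 2)) => /(integrableZl measurableT s).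
  by apply: eq_integrable => // x _; rewrite cosBpihalf EFinM.
have int1 v s : (\int[gamma]_x (cos (dot v x + s))%:E = (cos s * expR (- (q v v / 2)))%:E)%E.
  under eq_integral.
    move=> x _; have -> : cos (dot v x + s) = cos s * cos (dot v x) + (- sin s) * sin (dot v x).
      by rewrite cosD; ring.
    rewrite EFinD; over.
  rewrite integralD//=.
  under eq_integral do rewrite EFinM.
  rewrite integralZl//=; last by have := icos v 1; under eq_fun do rewrite mul1r.
  under [X in (_ + X)%E]eq_integral do rewrite EFinM.
  rewrite integralZl//=; last by have := isin v 1; under eq_fun do rewrite mul1r.
  by rewrite gaussian_integral_cos gaussian_integral_sin mule0 adde0 EFinM.
have ic v s : gamma.-integrable setT (fun x : borel X => (2^-1 * cos (dot v x + s))%:E).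
  by have := gaussian_integrable_cos v s => /(integrableZl measurableT 2^-1).
under eq_integral.
  move=> x _; have -> : cos (dot u x + t) * cos (dot w x + t') =
      2^-1 * cos (dot (u - w) x + (t - t')) + 2^-1 * cos (dot (u + w) x + (t + t')).
    have -> : dot (u - w) x + (t - t') = (dot u x + t) - (dot w x + t').
      by rewrite dotBl; ring.
    have -> : dot (u + w) x + (t + t') = (dot u x + t) + (dot w x + t').
      by rewrite dotDl; ring.
    by rewrite (cosB (dot u x + t)) (cosD (dot u x + t) (dot w x + t')); field.
  rewrite EFinD; over.
rewrite integralD//=.
under eq_integral do rewrite EFinM.
rewrite integralZl//=; last exact: gaussian_integrable_cos.
under [X in (_ + X)%E]eq_integral do rewrite EFinM.
rewrite integralZl//=; last exact: gaussian_integrable_cos.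
rewrite !int1 -!EFinM -EFinD; congr EFin.
rewrite qN qP cosB cosD /cos_cov.
have -> : - ((q u u + q w w - 2 * q u w) / 2) = - (q u u / 2) - q w w / 2 + q u w by field.
have -> : - ((q u u + q w w + 2 * q u w) / 2) = - (q u u / 2) - q w w / 2 - q u w by field.
by rewrite !expRD; field.
Qed.

Lemma gaussian_integral_trig (s : seq (Y * X * R)) :
  (\int[gamma]_x (`|trig_poly s x| ^+ 2)%:E =
   (\sum_(k <- s) \sum_(l <- s)
     cos_cov k.1.2 k.2 l.1.2 l.2 * dot k.1.1 l.1.1)%:E)%E.
Proof.
have icc u w t t' c : gamma.-integrable setT
    (fun x : borel X => ((cos (dot u x + t) * cos (dot w x + t'))%:E * c%:E)%E).
  pose h := (fun x : borel X => cos (dot u x + t) * cos (dot w x + t')).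
  have ih : gamma.-integrable setT (EFin \o h).
    apply: measurable_bounded_integrable => //.
    - by rewrite -ge0_fin_numE//; exact: fin_num_measure.
    - by apply: measurable_funM; apply: (@continuous_borel_measurable _ X); exact: cos_dot_continuous.
    - exists 1; split => // M M1 x _ /=; rewrite (le_trans _ (ltW M1))// normrM.
      by rewrite mulr_ile1// cos_max.
  by have := integrableZr measurableT c ih; apply: eq_integrable.
transitivity (\int[gamma]_x (\sum_(k <- s) \sum_(l <- s)
    (cos (dot k.1.2 x + k.2) * cos (dot l.1.2 x + l.2))%:E * (dot k.1.1 l.1.1)%:E))%E.
  apply: eq_integral => x _; rewrite -dotxx dot_suml -sumEFin; apply: eq_bigr => k _.
  rewrite dot_sumr -sumEFin; apply: eq_bigr => l _.
  by rewrite dotZl dotZr -EFinM mulrA.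
rewrite integral_sum//; last by move=> k; apply: integrable_sum => // l _.
rewrite -sumEFin; apply: eq_bigr => k _.
rewrite integral_sum// -sumEFin; apply: eq_bigr => l _.
rewrite integralZr//; first by rewrite gaussian_integral_cosM.
have := icc k.1.2 l.1.2 k.2 l.2 1; by under eq_fun do rewrite mule1.
Qed.

End GaussianTrig.

(** * The Cameron-Martin space *)

Section CameronMartin.
Context {R : realType} {X : hilbertType R} (C : X -> X).
Local Notation S := (sqrt_operator C).

(* Without a square root the Cameron-Martin space would be {0}, where the two
   first vectors of a basis would both vanish. *)
Lemma sqrt_operatorP (e : nat -> X) :
  orthonormal_basis (cameron_martin C) (cm_dot C) e ->
  positive_operator S /\ S \o S = C.
Proof.
move=> [Ee ee _]; rewrite /sqrt_operator; case: xgetP => [T _ []//|noS].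
have S0 x : S x = 0 by rewrite /sqrt_operator; case: xgetP => [T _ /(noS T)|].
have e0 i : e i = 0 by have [y _ <-] := Ee i; exact: S0.
have := ee 0%N 1%N; have := ee 0%N 0%N; rewrite !e0 => -> /= /eqP.
by rewrite oner_eq0.
Qed.

Lemma inv_operatorK (T : X -> X) : injective T -> cancel T (inv_operator T).
Proof.
move=> injT a; rewrite /inv_operator; case: xgetP => [b _ /injT //|/(_ a)].
by case.
Qed.

Lemma range_inv_operatorK (T : X -> X) w : range T w -> T (inv_operator T w) = w.
Proof.
move=> [a _ <-]; rewrite /inv_operator; case: xgetP => [b _ //|/(_ a)].
by case.
Qed.

Lemma parseval_dot (g : nat -> X) a b : orthonormal_basis setT dot g ->
  \sum_(0 <= i < n) dot (g i) a * dot (g i) b @[n --> \oo] --> dot a b.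
Proof.
move=> [_ gg cg].
apply/cvgrPdist_lt => e e0.
have b0 : 0 < `|b| + 1 by rewrite ltr_wpDl.
have /cvgr0Pnorm_lt := cg a I => /(_ ((e / (`|b| + 1)) ^+ 2)).
rewrite exprn_gt0 ?divr_gt0// => /(_ isT); apply: filterS => n.
set d := (X in `|dot X X| < _) => hd.
rewrite big_mkord.
have -> : dot a b - \sum_(i < n) dot (g i) a * dot (g i) b = dot d b.
  by rewrite dotBl dot_suml; congr (_ - _); apply: eq_bigr => i _; rewrite dotZl.
rewrite (le_lt_trans (CauchySchwarz _ _))//.
have hd' : `|d| < e / (`|b| + 1).
  move: hd; rewrite dotxx ger0_norm ?sqr_ge0//.
  by rewrite ltr_pXn2r ?nnegrE// divr_ge0// ltW.
rewrite (@le_lt_trans _ _ (`|d| * (`|b| + 1)))//; first by rewrite ler_wpM2l// lerDl.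
by rewrite -ltr_pdivlMr.
Qed.

Section Basis.
Variable e : nat -> X.
Hypotheses (injC : injective C)
  (onb_e : orthonormal_basis (cameron_martin C) (cm_dot C) e).

Lemma sqrt_operator_inj : injective S.
Proof.
have [_ SS] := sqrt_operatorP onb_e.
by move=> a b /(congr1 S) Sab; apply: injC; rewrite -!(congr1 (fun f => f _) SS).
Qed.

Lemma cm_dotE a b : cm_dot C (S a) (S b) = dot a b.
Proof. by rewrite /cm_dot !inv_operatorK//; exact: sqrt_operator_inj. Qed.

Lemma dot_sqrt_operator a b : dot (S a) b = dot a (S b).
Proof. by have [[_ _ + _] _] := sqrt_operatorP onb_e; exact. Qed.

Lemma sqrt_operatorK a : S (S a) = C a.
Proof. by have [_ /(congr1 (fun f => f a))] := sqrt_operatorP onb_e. Qed.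

Lemma dot_covariance u w : dot (C u) w = dot (S u) (S w).
Proof. by rewrite -sqrt_operatorK dot_sqrt_operator. Qed.

Lemma cm_basisK i : S (inv_operator S (e i)) = e i.
Proof. by apply: range_inv_operatorK; have [+ _ _] := onb_e; exact. Qed.

Lemma sqrt_operatorD a b : S (a + b) = S a + S b.
Proof. by have [[lS _ _ _] _] := sqrt_operatorP onb_e; have := lS 1 a b; rewrite !scale1r. Qed.

Lemma sqrt_operatorZ (c : R) a : S (c *: a) = c *: S a.
Proof.
have [[lS _ _ _] _] := sqrt_operatorP onb_e.
have S0 : S 0 = 0 by apply: (@addrI _ (S 0)); rewrite -sqrt_operatorD !addr0.
by have := lS c a 0; rewrite addr0 S0 addr0.
Qed.

Lemma sqrt_operatorB a b : S (a - b) = S a - S b.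
Proof. by rewrite -scaleN1r sqrt_operatorD sqrt_operatorZ scaleN1r. Qed.

Lemma sqrt_operator0 : S 0 = 0.
Proof. by have := sqrt_operatorZ 0 0; rewrite !scale0r. Qed.

Lemma sqrt_operator_sum n (f : 'I_n -> X) : S (\sum_(i < n) f i) = \sum_(i < n) S (f i).
Proof. by apply: (big_morph _ sqrt_operatorD sqrt_operator0). Qed.

(** S is an isometry of X onto the Cameron-Martin space. *)
Lemma onb_pullback : orthonormal_basis setT dot (inv_operator S \o e).
Proof.
have [_ ee ce] := onb_e; split => //.
move=> a _; have := ce (S a) (ex_intro2 _ _ a I erefl); apply: cvg_trans; apply: near_eq_cvg.
apply: nearW => n.
set d := (X in _ = dot X X).
have -> : S a - \sum_(i < n) cm_dot C (e i) (S a) *: e i = S d.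
  rewrite /d sqrt_operatorB sqrt_operator_sum.
  congr (_ - _); apply: eq_bigr => i _; rewrite sqrt_operatorZ /= cm_basisK.
  by rewrite -{1}(cm_basisK i) cm_dotE.
by rewrite /= cm_dotE.
Qed.

(** Parseval for S u and S w in the basis S^-1 e_i, because <e_i, u> = <S^-1 e_i, S u>. *)
Lemma covariance_sum u w :
  \sum_(0 <= i < n) dot (e i) u * dot (e i) w @[n --> \oo] --> dot (C u) w.
Proof.
rewrite dot_covariance; have := @parseval_dot _ (S u) (S w) onb_pullback.
apply: cvg_trans; apply: near_eq_cvg; apply: nearW => n; apply: eq_bigr => i _ /=.
by rewrite -!dot_sqrt_operator cm_basisK.
Qed.

Hypothesis range_e : forall i, range C (e i).

Lemma inv_covarianceK i : C (inv_operator C (e i)) = e i.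
Proof. exact: range_inv_operatorK. Qed.

(** For h = S b the left side is <S C^-1 e_i, b>, and S C^-1 e_i = S^-1 e_i by injectivity of S. So
    the encoder computes Cameron-Martin coordinates. *)
Lemma dot_inv_covariance i h : cameron_martin C h ->
  dot (inv_operator C (e i)) h = cm_dot C (e i) h.
Proof.
move=> [b _ <-]; rewrite -dot_sqrt_operator -(cm_basisK i) cm_dotE; congr (dot _ b).
apply: sqrt_operator_inj; rewrite cm_basisK.
by rewrite sqrt_operatorK inv_covarianceK.
Qed.

Lemma dot_inv_covariance_basis i j : dot (inv_operator C (e i)) (e j) = (i == j)%:R.
Proof. by rewrite dot_inv_covariance; have [Ee ee _] := onb_e. Qed.

End Basis.
End CameronMartin.

(** * The inequality for trigonometric polynomials *)

Section TrigPoincare.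
Context {R : realType} {X Y : hilbertType R} (C : X -> X)
  (gamma : probability (borel X) R) (v : nat -> X).
Hypotheses (gaussian_gamma : centered_gaussian C gamma) (injC : injective C)
  (onb_v : orthonormal_basis (cameron_martin C) (cm_dot C) v)
  (range_v : forall i, range C (v i)).
Variable r : nat.
Local Notation q u w := (dot (C u) w).
Implicit Types (u w : X) (s : seq (Y * X * R)).

(* The adjoint of encoder_proj, so that <head_part u, x> is a function of the
   encoder. *)
Definition head_part u := \sum_(0 <= i < r) dot (v i) u *: inv_operator C (v i).
(** The kernel p of the final comparison, the covariance carried by the encoder; [tail_cov] is the
    kernel t, carried by the remaining basis vectors. *)
Definition head_cov u w := \sum_(0 <= i < r) dot (v i) u * dot (v i) w.
Definition tail_cov u w := q u w - head_cov u w.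

(* The conditional expectation of trig_poly s given the encoder: the component of
   u that is independent of the encoder is integrated out. *)
Definition trig_head_terms s :=
  [seq (expR (- (tail_cov k.1.2 k.1.2 / 2)) *: k.1.1, head_part k.1.2, k.2) | k <- s].

Lemma head_part_cov u w : q (head_part u) w = head_cov u w.
Proof.
have [[[_ _ symC _] _] _] := gaussian_gamma.
rewrite symC /head_part dot_suml; apply: eq_bigr => i _.
by rewrite dotZl -symC inv_covarianceK.
Qed.

Lemma head_cov_head u w : head_cov u (head_part w) = head_cov u w.
Proof.
apply: eq_big_nat => i /andP[_ ir]; congr (_ * _).
rewrite /head_part dot_sumr (bigD1_seq i) ?iota_uniq ?mem_index_iota//=.
rewrite dotZr (dotC (v i) (inv_operator _ _)) (dot_inv_covariance_basis injC onb_v range_v) eqxx mulr1.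
rewrite big1 ?addr0// => j ji.
by rewrite dotZr (dotC (v i) (inv_operator _ _)) (dot_inv_covariance_basis injC onb_v range_v) (negbTE ji) mulr0.
Qed.

Lemma tail_cov_cvg u w :
  \sum_(r <= i < n) dot (v i) u * dot (v i) w @[n --> \oo] --> tail_cov u w.
Proof.
have h := @covariance_sum _ _ _ _ injC onb_v u w.
have : \sum_(0 <= i < n) dot (v i) u * dot (v i) w - head_cov u w @[n --> \oo]
   --> tail_cov u w by apply: cvgB => //; exact: cvg_cst.
apply: cvg_trans; apply: near_eq_cvg; near=> n.
rewrite (@big_cat_nat _ _ _ r)//=; last by near: n; exact: nbhs_infty_ge.
by rewrite /head_cov addrAC subrr add0r.
Unshelve. all: by end_near. Qed.

Let ch (x : R) := (expR x + expR (- x)) / 2.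
Let sh (x : R) := (expR x - expR (- x)) / 2.
Let wt u := expR (- (q u u / 2)).

Let cos_covE u t w t' : cos_cov C u t w t' =
  wt u * wt w * (cos t * cos t' * ch (q u w) + sin t * sin t' * sh (q u w)).
Proof. by []. Qed.

(** The factor put on the coefficients by [trig_head_terms] restores the full weight of u, so all
    the kernels below share the weights wt u and wt w. *)
Let wt_head u : expR (- (tail_cov u u / 2)) * wt (head_part u) = wt u.
Proof.
rewrite /wt head_part_cov head_cov_head -expRD /tail_cov; congr expR; by field.
Qed.

Let gap s := \sum_(k <- s) \sum_(l <- s)
  (wt k.1.2 * wt l.1.2 *
    (cos k.2 * cos l.2 * (ch (q k.1.2 l.1.2) - ch (head_cov k.1.2 l.1.2)) +
     sin k.2 * sin l.2 * (sh (q k.1.2 l.1.2) - sh (head_cov k.1.2 l.1.2)))) *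
  dot k.1.1 l.1.1.

(** Pythagoras: the cross terms of G and H have the same kernel as the square of H, so only the
    difference of the kernels of G and H remains. Appending the negated terms of H makes G - H a
    single trigonometric polynomial. *)
Let integral_gap s :
  (\int[gamma]_x (`|trig_poly s x - trig_poly (trig_head_terms s) x| ^+ 2)%:E
   = (gap s)%:E)%E.
Proof.
pose h := [seq (- k.1.1, k.1.2, k.2) | k <- trig_head_terms s].
transitivity (\int[gamma]_x (`|trig_poly (s ++ h) x| ^+ 2)%:E)%E.
  apply: eq_integral => x _; congr (`|_| ^+ 2)%:E.
  rewrite /trig_poly big_cat; congr (_ + _).
  by rewrite [RHS]big_map -sumrN; apply: eq_bigr => k _; rewrite scalerN.
rewrite (gaussian_integral_trig gaussian_gamma); congr EFin.
rewrite big_cat /= /h /trig_head_terms -map_comp big_map -big_split/=.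
apply: eq_bigr => k _; rewrite !big_cat/= !big_map -!big_split/=.
apply: eq_bigr => l _.
rewrite !cos_covE/= !head_part_cov !head_cov_head.
have -> : q k.1.2 (head_part l.1.2) = head_cov k.1.2 l.1.2.
  have [[[_ _ symC _] _] _] := gaussian_gamma.
  rewrite symC dotC head_part_cov.
  by rewrite /head_cov; apply: eq_bigr => i _; rewrite mulrC.
rewrite !dotNl !dotNr !dotZl !dotZr.
rewrite -(wt_head k.1.2) -(wt_head l.1.2).
by ring.
Qed.

(** The phase shift exchanges cosines and sines of the phases. So [sh] now goes with the cosines and
    [ch] with the sines: each is the derivative of its counterpart in [gap]. *)
Let integral_trig_diff s i :
  (\int[gamma]_x (`|trig_diff s x (v i)| ^+ 2)%:E
   = (\sum_(k <- s) \sum_(l <- s) (dot (v i) k.1.2 * dot (v i) l.1.2) *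
      (wt k.1.2 * wt l.1.2 *
      (cos k.2 * cos l.2 * sh (q k.1.2 l.1.2) +
       sin k.2 * sin l.2 * ch (q k.1.2 l.1.2)) * dot k.1.1 l.1.1))%:E)%E.
Proof.
under eq_integral do rewrite trig_diffE.
rewrite (gaussian_integral_trig gaussian_gamma) /trig_diff_terms; congr EFin.
rewrite big_map; apply: eq_bigr => k _; rewrite big_map; apply: eq_bigr => l _ /=.
rewrite cos_covE !cosDpihalf !sinDpihalf dotZl dotZr !(dotC (v i)).
by ring.
Qed.

Lemma trig_poincare s :
  (\int[gamma]_x (`|trig_poly s x - trig_poly (trig_head_terms s) x| ^+ 2)%:E
   <= \sum_(r <= i <oo) \int[gamma]_x (`|trig_diff s x (v i)| ^+ 2)%:E)%E.
Proof.
pose K (k l : Y * X * R) := wt k.1.2 * wt l.1.2 *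
      (cos k.2 * cos l.2 * sh (q k.1.2 l.1.2) +
       sin k.2 * sin l.2 * ch (q k.1.2 l.1.2)) * dot k.1.1 l.1.1.
pose E := \sum_(k <- s) \sum_(l <- s) tail_cov k.1.2 l.1.2 * K k l.
have cE : (fun n => \sum_(r <= i < n) \int[gamma]_x (`|trig_diff s x (v i)| ^+ 2)%:E)%E
    @ \oo --> E%:E.
  under eq_fun do under eq_bigr do rewrite integral_trig_diff.
  under eq_fun do rewrite sumEFin.
  apply: cvg_EFin; first exact: nearW.
  have : \sum_(k <- s) \sum_(l <- s)
      (\sum_(r <= i < n) (dot (v i) k.1.2 * dot (v i) l.1.2)) * K k l @[n --> \oo] --> E.
    apply: cvg_big => [|k _]; first exact: add_continuous.
    apply: cvg_big => [|l _]; first exact: add_continuous.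
    by apply: cvgM; [exact: tail_cov_cvg|exact: cvg_cst].
  apply: cvg_trans; apply: near_eq_cvg; apply: nearW => n /=.
  rewrite [RHS]exchange_big/=; apply: eq_bigr => k _.
  by rewrite [RHS]exchange_big/=; apply: eq_bigr => l _; rewrite mulr_suml.
rewrite (cvg_lim _ cE)// integral_gap lee_fin -subr_ge0.
pose p k l : R := head_cov (k : Y * X * R).1.2 (l : Y * X * R).1.2.
pose t k l : R := tail_cov (k : Y * X * R).1.2 (l : Y * X * R).1.2.
(* The finite sum p becomes an eventually constant series, by zero terms from the index r on, to fit
   [psd_gramM]. *)
have pM K' : @psd R Y _ K' -> psd (Y := Y) (fun k l => p k l * K' k l).
  apply: (@psd_gramM _ _ _ (fun i k => if (i < r)%N then dot (v i) k.1.2 else 0) _ 0%N) => k l.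
  apply: cvg_near_cst; near=> n.
  rewrite (@big_cat_nat _ _ _ r)//=; last by near: n; exact: nbhs_infty_ge.
  rewrite [X in _ + X]big1_seq ?addr0; last first.
    by move=> i; rewrite mem_index_iota => /andP[_ /andP[ri _]]; rewrite ltnNge ri mul0r.
  by apply: eq_big_nat => i /andP[_ ->].
have tM K' : @psd R Y _ K' -> psd (Y := Y) (fun k l => t k l * K' k l).
  by apply: (@psd_gramM _ _ _ (fun i k => dot (v i) k.1.2) _ r) => k l; exact: tail_cov_cvg.
(* The weights and phases form rank-one factors; the cosines of the phases go with the cosh
   inequality ([false]), the sines with the sinh one ([true]). *)
have A1 := psd_rank1M (fun k : Y * X * R => wt k.1.2 * cos k.2) (psd_exp_sign pM tM false).
have A2 := psd_rank1M (fun k : Y * X * R => wt k.1.2 * sin k.2) (psd_exp_sign pM tM true).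
have := psdD A1 A2 s (fun k => k.1.1).
rewrite /E /gap -sumrB; congr (0 <= _); apply: eq_bigr => k _.
rewrite -sumrB; apply: eq_bigr => l _.
rewrite expr0 expr1 /t /p /K.
have -> : head_cov k.1.2 l.1.2 + tail_cov k.1.2 l.1.2 = q k.1.2 l.1.2.
  by rewrite /tail_cov addrC subrK.
by rewrite /ch /sh; ring.
Unshelve. all: by end_near. Qed.

End TrigPoincare.

(** * Bernstein approximation *)

Section Bernstein.
Context {R : realType}.
Implicit Types (x s : R) (K : nat) (g : nat -> R).

(* Value at x of the Bernstein polynomial of degree K with coefficients g, by
   de Casteljau's recursion. *)
Fixpoint bern x K g : R :=
  if K is K'.+1 then (1 - x) * bern x K' g + x * bern x K' (g \o succn)
  else g 0%N.

Lemma bernD x K g g' : bern x K (fun k => g k + g' k) = bern x K g + bern x K g'.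
Proof.
elim: K g g' => //= K IH g g'.
by rewrite IH (IH (g \o succn) (g' \o succn)); ring.
Qed.

Lemma bernZ x K (a : R) g : bern x K (fun k => a * g k) = a * bern x K g.
Proof. by elim: K g => //= K IH g; rewrite IH (IH (g \o succn)); ring. Qed.

Lemma bern_cst x K (a : R) : bern x K (fun=> a) = a.
Proof. by elim: K => //= K IH; rewrite /comp/= IH; ring. Qed.

Lemma bernB x K g g' : bern x K (fun k => g k - g' k) = bern x K g - bern x K g'.
Proof.
rewrite -(mulN1r (bern x K g')) -bernZ -bernD; congr bern.
by apply/funext => k; rewrite mulN1r.
Qed.

(** For x in [0, 1], [bern x K g] is the expectation of g at a binomial variable with parameters K
    and x; this is its second moment about a, the squared bias plus the variance. A success in the
    first trial shifts a to a - 1. *)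
Lemma bern_moment x K (a : R) :
  bern x K (fun k => (k%:R - a) ^+ 2) = (K%:R * x - a) ^+ 2 + K%:R * x * (1 - x).
Proof.
elim: K a => [|K IH] a /=; first by ring.
rewrite IH; have -> : (fun k => (k%:R - a) ^+ 2) \o succn = fun k => (k%:R - (a - 1)) ^+ 2.
  by apply/funext => k /=; congr (_ ^+ 2); rewrite -natr1; ring.
by rewrite IH -natr1; ring.
Qed.

Section Unit.
Variable x : R.
Hypothesis x01 : 0 <= x <= 1.

Lemma ler_bern K g g' : (forall k, g k <= g' k) -> bern x K g <= bern x K g'.
Proof.
have /andP[x0 x1] := x01; elim: K g g' => /= [|K IH] g g' gg'; first exact: gg'.
by apply: lerD; apply: ler_wpM2l; rewrite ?subr_ge0//; apply: IH => k /=; exact: gg'.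
Qed.

Lemma norm_bern_le K g (M : R) : (forall k, `|g k| <= M) -> `|bern x K g| <= M.
Proof.
move=> gM; rewrite ler_norml -(bern_cst x K M) -{1}(opprK (bern _ _ (fun=> M))).
apply/andP; split; last by apply: ler_bern => k; rewrite (le_trans (ler_norm _)).
rewrite opprK bern_cst -(bern_cst x K (- M)).
by apply: ler_bern => k; have := gM k; rewrite ler_norml => /andP[].
Qed.

(** Chebyshev's argument: a node at distance at least d from s costs at most 2 M, hence at most 2 M
    (g k - s)^2 / d^2. *)
Lemma bern_tight K g (h : R -> R) (s e d M : R) : 0 < d ->
  (forall y, `|h y| <= M) -> (forall y, `|y - s| < d -> `|h y - h s| <= e) ->
  `|bern x K (h \o g) - h s| <= e + 2 * M / d ^+ 2 * bern x K (fun k => (g k - s) ^+ 2).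
Proof.
move=> d0 hM hd.
have e0 : 0 <= e by rewrite (le_trans _ (hd s _)) ?subrr ?normr0.
have M0 : 0 <= M by rewrite (le_trans _ (hM 0)).
rewrite -{1}(bern_cst x K (h s)) -bernB -bernZ -{1}(bern_cst x K e) -bernD.
have pt k : `|h (g k) - h s| <= e + 2 * M / d ^+ 2 * (g k - s) ^+ 2.
  have [lt|ge] := ltP `|g k - s| d.
    rewrite (le_trans (hd _ lt))// lerDl mulr_ge0 ?sqr_ge0// divr_ge0 ?sqr_ge0//.
    by rewrite mulr_ge0.
  rewrite ler_wpDl// (@le_trans _ _ (2 * M))//.
    by rewrite (le_trans (ler_normB _ _))// mulr2n mulrDl mul1r lerD.
  rewrite -mulrA ler_peMr ?mulr_ge0// mulrC ler_pdivlMr ?exprn_gt0// mul1r.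
  by rewrite -(real_normK (num_real (g k - s))) ler_pXn2r ?nnegrE ?(ltW d0).
rewrite ler_norml; apply/andP; split.
  rewrite -mulN1r -bernZ; apply: ler_bern => k; rewrite mulN1r.
  by have := pt k; rewrite ler_norml => /andP[].
by apply: ler_bern => k; exact: le_trans (ler_norm _) (pt k).
Qed.

End Unit.

(** The nodes g are left free, subject to a vanishing second moment about s, because the derivative
    will be evaluated at unspecified points given by the mean value theorem. *)
Lemma bern_cvg (x : nat -> R) (K : nat -> nat) (g : nat -> nat -> R) (h : R -> R) s :
  (forall n, 0 <= x n <= 1) -> {for s, continuous h} ->
  (exists M, forall y, `|h y| <= M) ->
  bern (x n) (K n) (fun k => (g n k - s) ^+ 2) @[n --> \oo] --> 0 ->
  bern (x n) (K n) (h \o g n) @[n --> \oo] --> h s.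
Proof.
move=> x01 ch [M hM] c0; apply/cvgrPdist_le => e e0.
have e2 : 0 < e / 2 by rewrite divr_gt0.
have [d /= d0 hd] : exists2 d, 0 < d & forall y, `|y - s| < d -> `|h y - h s| <= e / 2.
  move/cvgrPdist_le : ch => /(_ _ e2) [d /= d0 hd]; exists d => // y yd.
  by rewrite distrC hd//= distrC.
pose B := 2 * M / d ^+ 2.
have : B * bern (x n) (K n) (fun k => (g n k - s) ^+ 2) @[n --> \oo] --> 0.
  by rewrite -[X in _ --> X](mulr0 B); apply: cvgM => //; exact: cvg_cst.
move/cvgrPdist_le => /(_ _ e2); apply: filterS => n; rewrite sub0r normrN => hn.
rewrite distrC (le_trans (bern_tight (x01 n) _ _ d0 hM hd))//.
rewrite [leRHS](splitr e) lerD2l (le_trans _ hn)//; exact: ler_norm.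
Qed.

(** Two uses of the mean value theorem. The quadratic order is enough: for y = s / L, the error
    times L is at most s^2 / L. *)
Lemma sin_sub_le (y : R) : `|sin y - y| <= y ^+ 2.
Proof.
have mvt (f df : R -> R) z : (forall t : R, is_derive t (1 : R) f (df t)) ->
    exists2 c, `|c| <= `|z| & f z - f 0 = df c * z.
  move=> hf; have cf : continuous f.
    by move=> t; apply/differentiable_continuous; rewrite -derivable1_diffP; have [] := hf t.
  have [z0|z0|<-] := ltgtP 0 z.
  - have [c] := MVT z0 (fun t _ => hf t) (continuous_subspaceT cf).
    rewrite in_itv/= subr0 => /andP[c0 cz] E; exists c => //.
    by rewrite !ger0_norm ltW.
  - have [c] := MVT z0 (fun t _ => hf t) (continuous_subspaceT cf).
    rewrite in_itv/= sub0r => /andP[zc c0] E; exists c.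
      by rewrite !ltr0_norm// lerN2 ltW.
    by rewrite -opprB E; ring.
  - by exists 0 => //; rewrite subrr mulr0.
have [c cy] : exists2 c, `|c| <= `|y| & (sin y - y) - (sin 0 - 0) = (cos c - 1) * y.
  by apply: (mvt (fun t => sin t - t) (fun t => cos t - 1)) => t.
rewrite sin0 !subr0 => ->.
have [d _] : exists2 d, `|d| <= `|c| & cos c - cos 0 = - sin d * c.
  by apply: (mvt cos (fun t => - sin t)) => t.
rewrite cos0 => ->; rewrite !normrM normrN -(real_normK (num_real y)) expr2.
rewrite ler_wpM2r// (le_trans _ cy)// ler_piMl// sin_max//.
Qed.

(* The sine keeps the argument in the range of the nodes, and makes the
   approximation a trigonometric polynomial in s. *)
Definition bern_scale (n : nat) : R := n.+1%:R.
(** The degree D has to outgrow L^2, where L is the scale, since the variance of the node is of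
    order L^2 / D. With the cube it is of order 1 / L. *)
Definition bern_degree (n : nat) : nat := (n.+1 ^ 3)%N.
Definition bern_node (n k : nat) : R :=
  bern_scale n * (2 * k%:R / (bern_degree n)%:R - 1).
(** With this success probability the mean node is L sin (s / L), which tends to s. *)
Definition bern_arg (n : nat) (s : R) : R := (1 + sin (s / bern_scale n)) / 2.
Definition bern_arg_diff (n : nat) (s : R) : R :=
  cos (s / bern_scale n) / (2 * bern_scale n).

Lemma bern_arg01 n s : 0 <= bern_arg n s <= 1.
Proof.
have h1 := sin_geN1 (s / bern_scale n); have h2 := sin_le1 (s / bern_scale n).
by rewrite /bern_arg; apply/andP; split; lra.
Qed.

Lemma bern_scale_gt0 n : 0 < bern_scale n.
Proof. by rewrite /bern_scale. Qed.

Lemma bern_degreeE n : (bern_degree n)%:R = bern_scale n ^+ 3.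
Proof. by rewrite /bern_degree natrX. Qed.

(** The degree may drop by one and the nodes may move by one spacing 2 L / D, as happens for the
    derivative. The bias L sin (s / L) - s is at most s^2 / L, and the variance at most 4 / L. *)
Lemma bern_node_moment n s (g : nat -> R) K :
  (K = bern_degree n \/ K = (bern_degree n).-1) ->
  (forall k, `|g k - bern_node n k| <= 2 * bern_scale n / (bern_degree n)%:R) ->
  bern (bern_arg n s) K (fun k => (g k - s) ^+ 2)
    <= (4 * s ^+ 4 + 40) / bern_scale n.
Proof.
move=> hK hg; set L := bern_scale n; set D := (bern_degree n)%:R : R.
set x := bern_arg n s.
have L1 : 1 <= L by rewrite /L /bern_scale ler1n.
have L0 : 0 < L by exact: bern_scale_gt0.
have DE : D = L ^+ 3 by rewrite /D bern_degreeE.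
have D0 : 0 < D by rewrite DE exprn_gt0.
have /andP[x0 x1] : 0 <= x <= 1 by exact: bern_arg01.
(* The real index at which the node would be s. *)
pose a := (s / L + 1) * D / 2.
have nodeE k : bern_node n k - s = 2 * L / D * (k%:R - a).
  rewrite /bern_node -/L -/D /a; field.
  by rewrite !gt_eqF.
have step k : (g k - s) ^+ 2 <= 2 * (2 * L / D) ^+ 2 * (k%:R - a) ^+ 2 + 2 * (2 * L / D) ^+ 2.
  have -> : g k - s = (g k - bern_node n k) + 2 * L / D * (k%:R - a) by rewrite -nodeE; ring.
  have := hg k; rewrite -/L -/D; set u := g k - _; set w := 2 * L / D => uw.
  have u2 : u ^+ 2 <= w ^+ 2.
    rewrite -(real_normK (num_real u)) ler_pXn2r// nnegrE//.
    by rewrite (le_trans _ uw).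
  have := sqr_ge0 (u - w * (k%:R - a)); nra.
rewrite (le_trans (ler_bern (bern_arg01 n s) _ step))//.
rewrite bernD bern_cst bernZ bern_moment -/x.
have sx : 2 * L * x - L - s = L * sin (s / L) - s.
  by rewrite /x /bern_arg -/L; field.
have S : (L * sin (s / L) - s) ^+ 2 <= s ^+ 4 / L.
  have h : `|L * sin (s / L) - s| <= s ^+ 2 / L.
    have -> : L * sin (s / L) - s = L * (sin (s / L) - s / L) by field; rewrite gt_eqF.
    rewrite normrM (gtr0_norm L0) (le_trans (ler_wpM2l (ltW L0) (sin_sub_le _)))//.
    by rewrite le_eqVlt; apply/orP; left; apply/eqP; field; rewrite gt_eqF.
  rewrite -(real_normK (num_real _)) (@le_trans _ _ ((s ^+ 2 / L) ^+ 2))//.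
    by rewrite ler_pXn2r ?nnegrE// divr_ge0 ?sqr_ge0// ltW.
  rewrite exprMn -exprM ler_wpM2l ?exprn_even_ge0// exprVn lef_pV2 ?posrE ?exprn_gt0//.
  by rewrite expr2 ler_peMl// ltW.
have [e e01 KE] : exists2 e : R, 0 <= e <= 1 & K%:R = D - e.
  case: hK => ->; first by exists 0; rewrite ?subr0// lexx ler01.
  by exists 1; rewrite ?lexx ?ler01// /D /bern_degree -subn1 natrB// expn_gt0.
have /andP[e0 e1] := e01.
rewrite KE.
set W := 2 * L / D.
have WE : W = 2 / L ^+ 2 by rewrite /W DE; field; rewrite gt_eqF.
have -> : 2 * W ^+ 2 * (((D - e) * x - a) ^+ 2 + (D - e) * x * (1 - x)) =
   2 * ((L * sin (s / L) - s) - e * W * x) ^+ 2 + 2 * W ^+ 2 * ((D - e) * x * (1 - x)).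
  have -> : (D - e) * x - a = ((2 * L * x - L - s) / W - e * x).
    by rewrite /W /a; field; rewrite !gt_eqF.
  by rewrite -sx; field; rewrite /W; rewrite !gt_eqF// !divr_gt0 ?mulr_gt0//.
have iL : 0 < L^-1 by rewrite invr_gt0.
have iL1 : L^-1 <= 1 by rewrite invf_le1.
have W2 : W ^+ 2 <= 4 / L.
  have -> : W ^+ 2 = 4 * (L^-1 * L^-1 ^+ 3) by rewrite WE; field; rewrite gt_eqF.
  by rewrite ler_pM2l// -[leRHS]mulr1 ler_pM2l// exprn_ile1// ltW.
have WD : W ^+ 2 * D = 4 / L by rewrite /W DE; field; rewrite gt_eqF.
have q1 : ((L * sin (s / L) - s) - e * W * x) ^+ 2 <= 2 * (s ^+ 4 / L) + 2 * (4 / L).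
  have h : (e * W * x) ^+ 2 <= W ^+ 2.
    have -> : (e * W * x) ^+ 2 = (e ^+ 2 * x ^+ 2) * W ^+ 2 by ring.
    by rewrite ler_piMl ?sqr_ge0// mulr_ile1 ?sqr_ge0 ?exprn_ile1.
  set u := L * sin (s / L) - s in S *; set w := e * W * x in h *.
  have -> : (u - w) ^+ 2 = 2 * u ^+ 2 + 2 * w ^+ 2 - (u + w) ^+ 2 by ring.
  have := sqr_ge0 (u + w); move: S h W2.
  move: (s ^+ 4 / L) (4 / L) (W ^+ 2) (u ^+ 2) (w ^+ 2) ((u + w) ^+ 2) => a1 a2 a3 a4 a5 a6.
  by lra.
have q2 : W ^+ 2 * ((D - e) * x * (1 - x)) <= 4 / L.
  rewrite -WD; apply: ler_wpM2l; first exact: sqr_ge0.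
  have x2 : 0 <= x * (1 - x) by rewrite mulr_ge0 ?subr_ge0.
  have x3 : x * (1 - x) <= 1 by nra.
  have : e * (x * (1 - x)) >= 0 by rewrite mulr_ge0.
  have : D * (x * (1 - x)) <= D * 1 by rewrite ler_pM2l.
  by nra.
(* Of the 40, 16 pays for the lost degree, 8 for the variance and 8 for the displaced nodes; the
   last 8 is slack. *)
have -> : (4 * s ^+ 4 + 40) / L = 2 * (2 * (s ^+ 4 / L) + 2 * (4 / L)) + 2 * (4 / L) + 2 * (4 / L) + 8 / L.
  by field; rewrite gt_eqF.
have : 0 < 8 / L by rewrite divr_gt0.
rewrite -[2 * W ^+ 2 * _]mulrA; move: q1 q2 W2.
move: (W ^+ 2) (8 / L) (4 / L) (s ^+ 4 / L) (W ^+ 2 * (_ * (1 - x))) ((_ - _ - _) ^+ 2) => a1 a2 a3 a4 a5 a6.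
by lra.
Qed.

Lemma bern_node_cvg s (h : R -> R) (K : nat -> nat) (g : nat -> nat -> R) :
  continuous h -> (exists M, forall y, `|h y| <= M) ->
  (forall n, K n = bern_degree n \/ K n = (bern_degree n).-1) ->
  (forall n k, `|g n k - bern_node n k| <= 2 * bern_scale n / (bern_degree n)%:R) ->
  bern (bern_arg n s) (K n) (h \o g n) @[n --> \oo] --> h s.
Proof.
move=> ch hM hK hg; apply: bern_cvg => //; [by move=> n; exact: bern_arg01|exact: ch|].
have c0 : (4 * s ^+ 4 + 40) * (bern_scale n)^-1 @[n --> \oo] --> 0.
  rewrite -[X in _ --> X](mulr0 (4 * s ^+ 4 + 40)).
  by apply: cvgM; [exact: cvg_cst|exact: cvg_harmonic].
apply: (squeeze_cvgr _ (@cvg_cst _ _ _ _ _) c0); apply: nearW => n; apply/andP; split.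
  rewrite -(bern_cst (bern_arg n s) (K n) 0); apply: ler_bern; first exact: bern_arg01.
  by move=> k; exact: sqr_ge0.
exact: bern_node_moment.
Qed.

Lemma bern_approx s (h : R -> R) :
  continuous h -> (exists M, forall y, `|h y| <= M) ->
  bern (bern_arg n s) (bern_degree n) (h \o bern_node n) @[n --> \oo] --> h s.
Proof.
move=> ch hM; apply: bern_node_cvg => //; first by move=> n; left.
move=> n k; rewrite subrr normr0 divr_ge0// mulr_ge0// ltW//; exact: bern_scale_gt0.
Qed.

(** The s-derivative of the Bernstein approximation of h, by the chain rule and the formula for the
    derivative of a Bernstein polynomial. *)
Definition bern_approx_diff (n : nat) s (h : R -> R) :=
  bern_arg_diff n s * (bern_degree n)%:R *
    bern (bern_arg n s) (bern_degree n).-1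
      (fun k => h (bern_node n k.+1) - h (bern_node n k)).

(** By the mean value theorem, the difference of h between adjacent nodes is the spacing 2 L / D
    times dh at a point in between. The spacing cancels the degree and the 2 L of [bern_arg_diff],
    and the points do not depend on s. *)
Lemma bern_approx_diffE n (h dh : R -> R) :
  (forall y : R, is_derive y (1 : R) h (dh y)) ->
  exists2 g : nat -> R,
  (forall k, `|g k - bern_node n k| <= 2 * bern_scale n / (bern_degree n)%:R) &
  forall s, bern_approx_diff n s h =
    cos (s / bern_scale n) * bern (bern_arg n s) (bern_degree n).-1 (dh \o g).
Proof.
move=> hd; set L := bern_scale n; set D := (bern_degree n)%:R : R.
have L0 : 0 < L by exact: bern_scale_gt0.
have D0 : 0 < D by rewrite /D bern_degreeE exprn_gt0.
have W0 : 0 < 2 * L / D by rewrite divr_gt0// mulr_gt0.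
have ch : continuous h.
  by move=> t; apply/differentiable_continuous; rewrite -derivable1_diffP; have [] := hd t.
have nodeS k : bern_node n k.+1 - bern_node n k = 2 * L / D.
  by rewrite /bern_node -/L -/D -natr1; field; rewrite gt_eqF.
have pt k : exists c, `|c - bern_node n k| <= 2 * L / D /\
    h (bern_node n k.+1) - h (bern_node n k) = dh c * (2 * L / D).
  have lt : bern_node n k < bern_node n k.+1 by rewrite -subr_gt0 nodeS.
  have [c] := MVT lt (fun t _ => hd t) (continuous_subspaceT ch).
  rewrite in_itv/= nodeS => /andP[c1 c2] E; exists c; split => //.
  rewrite ger0_norm ?subr_ge0 ?(ltW c1)// -(nodeS k) lerD2r ltW//.
have /choice [g hg] := pt; exists g => [k|s]; first by have [] := hg k.
rewrite /bern_approx_diff /bern_arg_diff -/L -/D.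
have -> : (fun k => h (bern_node n k.+1) - h (bern_node n k)) =
    (fun k => (2 * L / D) * (dh \o g) k).
  by apply/funext => k; have [_ ->] := hg k; rewrite mulrC.
by rewrite bernZ; field; rewrite !gt_eqF.
Qed.

Lemma bern_approx_diff_cvg s (h dh : R -> R) :
  (forall y : R, is_derive y (1 : R) h (dh y)) ->
  continuous dh -> (exists M, forall y, `|dh y| <= M) ->
  bern_approx_diff n s h @[n --> \oo] --> dh s.
Proof.
move=> hd cdh hM.
have /choice [g hg] n : exists g : nat -> R,
  (forall k, `|g k - bern_node n k| <= 2 * bern_scale n / (bern_degree n)%:R) /\
  forall s, bern_approx_diff n s h =
    cos (s / bern_scale n) * bern (bern_arg n s) (bern_degree n).-1 (dh \o g).
  by have [g] := bern_approx_diffE n hd; exists g.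
under eq_fun do rewrite (hg _).2.
suff : cos (s / bern_scale n) *
     bern (bern_arg n s) (bern_degree n).-1 (dh \o g n) @[n --> \oo] --> 1 * dh s.
  by rewrite mul1r.
apply: cvgM; last first.
  apply: bern_node_cvg => //; first by move=> n; right.
  by move=> n; exact: (hg n).1.
rewrite -(@cos0 R); apply: continuous_cvg; first exact: continuous_cos.
rewrite -[X in _ --> X](mulr0 s); apply: cvgM; [exact: cvg_cst|exact: cvg_harmonic].
Qed.

Lemma bern_approx_diff_le n s (h dh : R -> R) (M : R) :
  (forall y : R, is_derive y (1 : R) h (dh y)) ->
  (forall y, `|dh y| <= M) -> `|bern_approx_diff n s h| <= M.
Proof.
move=> hd hM; have [g _ ->] := bern_approx_diffE n hd.
rewrite normrM (le_trans (ler_piMl _ (cos_max _)))//.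
by apply: norm_bern_le => [|k]; [exact: bern_arg01|exact: hM].
Qed.

End Bernstein.

Section ContinuousReal.
Context {R : realType} {T : topologicalType}.
Implicit Types f g : T -> R.

Lemma continuous_add f g : continuous f -> continuous g -> continuous (fun x => f x + g x).
Proof. by move=> cf cg x; exact: (continuousD (cf x) (cg x)). Qed.

Lemma continuous_mul f g : continuous f -> continuous g -> continuous (fun x => f x * g x).
Proof. by move=> cf cg x; exact: (continuousM (cf x) (cg x)). Qed.

Lemma continuous_opp f : continuous f -> continuous (fun x => - f x).
Proof. by move=> cf x; exact: (continuousN (cf x)). Qed.

Lemma continuous_sub f g : continuous f -> continuous g -> continuous (fun x => f x - g x).
Proof. by move=> cf cg; apply: continuous_add => //; exact: continuous_opp. Qed.

Lemma continuous_sqr f : continuous f -> continuous (fun x => f x ^+ 2).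
Proof. by move=> cf; under eq_fun do rewrite expr2; exact: continuous_mul. Qed.

Lemma continuous_compose {U : topologicalType} (h : U -> T) f :
  continuous h -> continuous f -> continuous (fun x => f (h x)).
Proof. by move=> ch cf x; exact: (continuous_comp (ch x) (cf (h x))). Qed.

End ContinuousReal.

Lemma sum_continuous (R : realType) (T : topologicalType) (I : Type) (r : seq I)
    (F : I -> T -> R) :
  (forall i, continuous (F i)) -> continuous (fun x => \sum_(i <- r) F i x).
Proof.
move=> cF; elim: r => [|i r IH].
  by under eq_fun do rewrite big_nil; exact: cst_continuous.
under eq_fun do rewrite big_cons.
by apply: continuous_add; [exact: cF|exact: IH].
Qed.

(** * Approximation of smooth cylindrical functions *)

Section TrigPairs.
Context {R : realType} {n : nat}.
Local Notation E := 'rV[R]_n.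
Implicit Types (f g : E -> R) (c : 'I_n -> E -> R) (y : E).

Definition phase (b : E) y : R := \sum_(j < n) b 0 j * y 0 j.

(* c is the gradient of the trigonometric polynomial f. *)
Definition trig_pair f c := exists s : seq (R * E * R),
  f = (fun y => \sum_(k <- s) k.1.1 * cos (phase k.1.2 y + k.2)) /\
  c = (fun j y => \sum_(k <- s) - (k.1.1 * k.1.2 0 j * sin (phase k.1.2 y + k.2))).

Lemma phaseD a b y : phase (a + b) y = phase a y + phase b y.
Proof. by rewrite -big_split/=; apply: eq_bigr => j _; rewrite mxE mulrDl. Qed.

Lemma phaseB a b y : phase (a - b) y = phase a y - phase b y.
Proof. by rewrite -sumrB/=; apply: eq_bigr => j _; rewrite !mxE mulrBl. Qed.

Lemma phase0 y : phase 0 y = 0.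
Proof. by rewrite /phase big1// => j _; rewrite mxE mul0r. Qed.

Lemma phaseZ_delta (a : R) j y : phase (a *: delta_mx 0 j) y = a * y 0 j.
Proof.
rewrite /phase (bigD1 j)//= big1 ?addr0; first by rewrite !mxE !eqxx mulr1.
by move=> i /negbTE ij; rewrite !mxE eqxx ij mulr0 mul0r.
Qed.

Lemma trig_pair_cst (a : R) : trig_pair (fun=> a) (fun _ _ => 0).
Proof.
exists [:: (a, 0, 0)]; split; first by apply/funext => y; rewrite big_seq1 /= phase0 addr0 cos0 mulr1.
by apply/funext => j; apply/funext => y; rewrite big_seq1 /= mxE mulr0 mul0r oppr0.
Qed.

Lemma trig_pairD f c f' c' : trig_pair f c -> trig_pair f' c' ->
  trig_pair (fun y => f y + f' y) (fun j y => c j y + c' j y).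
Proof.
move=> [s [-> ->]] [s' [-> ->]]; exists (s ++ s'); split.
  by apply/funext => y; rewrite big_cat.
by apply/funext => j; apply/funext => y; rewrite big_cat.
Qed.

(** Product-to-sum formulas; the gradient obeys the Leibniz rule, so trigonometric pairs form an
    algebra that contains the polynomials in sines of the coordinates. *)
Lemma trig_pairM f c f' c' : trig_pair f c -> trig_pair f' c' ->
  trig_pair (fun y => f y * f' y) (fun j y => c j y * f' y + f y * c' j y).
Proof.
move=> [s [-> ->]] [s' [-> ->]].
exists ([seq (k.1.1 * l.1.1 / 2, k.1.2 - l.1.2, k.2 - l.2) | k <- s, l <- s'] ++
        [seq (k.1.1 * l.1.1 / 2, k.1.2 + l.1.2, k.2 + l.2) | k <- s, l <- s']).
have phB (k l : R * E * R) y : phase (k.1.2 - l.1.2) y + (k.2 - l.2) =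
    (phase k.1.2 y + k.2) - (phase l.1.2 y + l.2) by rewrite phaseB; ring.
have phD (k l : R * E * R) y : phase (k.1.2 + l.1.2) y + (k.2 + l.2) =
    (phase k.1.2 y + k.2) + (phase l.1.2 y + l.2) by rewrite phaseD; ring.
split.
  apply/funext => y; rewrite big_cat/= !big_allpairs_dep -big_split mulr_suml/=.
  apply: eq_bigr => k _; rewrite mulr_sumr -big_split/=; apply: eq_bigr => l _.
  rewrite phB phD; move: (phase k.1.2 y + k.2) (phase l.1.2 y + l.2) => A B.
  by rewrite cosB cosD; field.
apply/funext => j; apply/funext => y.
rewrite big_cat/= !big_allpairs_dep -big_split !mulr_suml -big_split/=.
apply: eq_bigr => k _; rewrite !mulr_sumr -!big_split/=; apply: eq_bigr => l _.
rewrite phB phD; move: (phase k.1.2 y + k.2) (phase l.1.2 y + l.2) => A B.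
by rewrite sinB sinD !mxE; field.
Qed.

Lemma trig_pair_bern_arg N (j : 'I_n) :
  trig_pair (fun y => bern_arg N (y 0 j))
            (fun i y => (i == j)%:R * bern_arg_diff N (y 0 j)).
Proof.
have L0 : bern_scale N != 0 :> R by rewrite gt_eqF// bern_scale_gt0.
exists [:: (1 / 2, 0, 0); (1 / 2, (bern_scale N)^-1 *: delta_mx 0 j, - (pi / 2))]; split.
  apply/funext => y; rewrite !big_cons big_nil /= phase0 phaseZ_delta cosBpihalf.
  by rewrite addr0 cos0 /bern_arg (mulrC (y 0 j)); field.
apply/funext => i; apply/funext => y; rewrite !big_cons big_nil /= phaseZ_delta sinBpihalf.
rewrite !mxE eqxx /= /bern_arg_diff (mulrC (y 0 j)) eq_sym.
by case: (j == i) => /=; field.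
Qed.

Lemma phase_continuous b : continuous (phase b).
Proof.
apply: sum_continuous => j.
by apply: continuous_mul; [exact: cst_continuous|exact: coord_continuous].
Qed.

Lemma trig_pair_bounded f c : trig_pair f c ->
  exists M, (forall y, `|f y| <= M) /\ forall j y, `|c j y| <= M.
Proof.
move=> [s [-> ->]].
exists (\sum_(k <- s) (`|k.1.1| + \sum_(j < n) `|k.1.1 * k.1.2 0 j|)).
have h0 (k : R * E * R) : 0 <= \sum_(j < n) `|k.1.1 * k.1.2 0 j| :> R by apply: sumr_ge0.
split=> [y|j y]; rewrite (le_trans (ler_norm_sum _ _ _))//; apply: ler_sum => k _.
  rewrite normrM (le_trans (ler_piMr _ (cos_max _)))// lerDl; exact: h0.
rewrite normrN normrM (le_trans (ler_piMr _ (sin_max _)))//.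
by rewrite ler_wpDl// (bigD1 j)//= lerDl sumr_ge0.
Qed.

Lemma trig_pair_continuous f c : trig_pair f c ->
  continuous f /\ forall j, continuous (c j).
Proof.
move=> [s [-> ->]].
have cp (k : R * E * R) : continuous (fun y => phase k.1.2 y + k.2).
  by apply: continuous_add; [exact: phase_continuous|exact: cst_continuous].
split=> [|j]; apply: sum_continuous => k.
  apply: continuous_mul; first exact: cst_continuous.
  exact: continuous_compose (@continuous_cos R).
apply: continuous_opp; apply: continuous_mul; first exact: cst_continuous.
exact: continuous_compose (@continuous_sin R).
Qed.

End TrigPairs.

Lemma row_continuous (R : realType) (T : topologicalType) n (f : 'I_n -> T -> R) :
  (forall j, continuous (f j)) -> continuous (fun x => \row_(j < n) f j x).
Proof.
move=> cf x A [P Pn PA]; rewrite nbhs_filterE; apply: (filterS (P := [set t | forall i j, P i j ((\row_j f j t) i j)])) => [t Pt|]; first exact: PA.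
apply: filter_forall => i; apply: filter_forall => j.
have Pj : nbhs (f j x) (P i j) by have := Pn i j; rewrite mxE.
apply: (filterS (P := f j @^-1` P i j)) => [y|]; first by rewrite mxE.
exact: (cf j x _ Pj).
Qed.

(** * Square integrals of scalar functions *)

Section SquareIntegral.
Context d {T : measurableType d} {R : realType} (P : probability T R).
Implicit Types f g : T -> R.

Definition sqint f : \bar R := (\int[P]_x (f x ^+ 2)%:E)%E.

Lemma le_sqint f g : measurable_fun [set: T] f -> measurable_fun [set: T] g ->
  (forall x, `|f x| <= `|g x|) -> (sqint f <= sqint g)%E.
Proof.
move=> mf mg fg; apply: ge0_le_integral => //.
- by move=> x _; rewrite lee_fin sqr_ge0.
- by apply/measurable_EFinP; exact: measurable_funX.
- by apply/measurable_EFinP; exact: measurable_funX.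
- move=> x _; rewrite lee_fin -(real_normK (num_real (f x))) -(real_normK (num_real (g x))).
  by rewrite ler_pXn2r ?nnegrE.
Qed.

Lemma sqintZ (a : R) f : measurable_fun [set: T] f ->
  sqint (fun x => a * f x) = ((a ^+ 2)%:E * sqint f)%E.
Proof.
move=> mf; rewrite /sqint -ge0_integralZl//.
- by apply: eq_integral => x _; rewrite exprMn EFinM.
- by apply/measurable_EFinP; exact: measurable_funX.
- by move=> x _; rewrite lee_fin sqr_ge0.
- by rewrite lee_fin sqr_ge0.
Qed.

Lemma sqintD f g : measurable_fun [set: T] f -> measurable_fun [set: T] g ->
  (sqint (fun x => f x + g x)%R <= 2%:E * sqint f + 2%:E * sqint g)%E.
Proof.
move=> mf mg.
have mX (h : T -> R) : measurable_fun [set: T] h -> measurable_fun [set: T] (fun x => (h x ^+ 2)%:E).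
  by move=> mh; apply/measurable_EFinP; exact: measurable_funX.
rewrite /sqint -!ge0_integralZl//; try by [exact: mX|move=> x _; rewrite lee_fin sqr_ge0|rewrite lee_fin].
rewrite -ge0_integralD//.
- apply: ge0_le_integral => //.
  + by move=> x _; rewrite lee_fin sqr_ge0.
  + by apply: mX; exact: measurable_funD.
  + by apply: emeasurable_funD; apply: emeasurable_funM => //; exact: mX.
  + move=> x _; rewrite -!EFinM -EFinD lee_fin.
    by have := sqr_ge0 (f x - g x); rewrite sqrrB sqrrD; lra.
- by move=> x _; rewrite mule_ge0 ?lee_fin// sqr_ge0.
- by apply: emeasurable_funM => //; exact: mX.
- by move=> x _; rewrite mule_ge0 ?lee_fin// sqr_ge0.
- by apply: emeasurable_funM => //; exact: mX.
Qed.

Lemma sqint_mul_le (M : R) f g : measurable_fun [set: T] f -> measurable_fun [set: T] g ->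
  (forall x, `|f x| <= M) -> (sqint (fun x => f x * g x)%R <= (M ^+ 2)%:E * sqint g)%E.
Proof.
move=> mf mg fM; rewrite -sqintZ//; apply: le_sqint.
- exact: measurable_funM.
- exact: measurable_funM.
- move=> x; rewrite !normrM ler_wpM2r// (le_trans (fM x))// ler_norm//.
Qed.

Lemma sqint_cvg0 (f : nat -> T -> R) (M : R) :
  (forall n, measurable_fun [set: T] (f n)) -> (forall n x, `|f n x| <= M) ->
  (forall x, f n x @[n --> \oo] --> 0) -> sqint (f n) @[n --> \oo] --> 0%E.
Proof.
move=> mf fM f0.
have [] := @dominated_convergence _ T R P setT measurableT
  (fun n x => (f n x ^+ 2)%:E) (cst 0%E) (cst (M ^+ 2)%:E).
- by move=> n; apply/measurable_EFinP; exact: measurable_funX.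
- exact: measurable_cst.
- apply: aeW => x _ /=; apply: cvg_EFin; first exact: nearW.
  have hh : f n x * f n x @[n --> \oo] --> (0 * 0 : R) by apply: cvgM; exact: f0.
  rewrite mulr0 in hh; apply: cvg_trans hh; apply: near_eq_cvg; apply: nearW => n /=; exact/esym/expr2.
- by apply: finite_measure_integrable_cst.
- apply: aeW => x n _ /=; rewrite lee_fin ger0_norm ?sqr_ge0//.
  rewrite -(real_normK (num_real (f n x))) ler_pXn2r ?nnegrE//.
  by rewrite (le_trans _ (fM n x)).
by move=> _ _; rewrite integral0.
Qed.

End SquareIntegral.

Lemma cvge0_near_le (R : realType) (u : nat -> \bar R) (e : R) : 0 < e ->
  u N @[N --> \oo] --> 0%E -> \forall N \near \oo, (u N <= e%:E)%E.
Proof.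
move=> e0 u0; have e0' : (0 < e%:E)%E by rewrite lte_fin.
apply: (filterS (P := [set N | (u N < e%:E)%E])) => [N /ltW//|].
exact: (u0 _ (open_ereal_lt' e0')).
Qed.

Arguments sqint {d T R} P f%_ring_scope.

Section Density.
Context {R : realType} {X : hilbertType R} (gamma : probability (borel X) R)
  (n : nat) (w : 'I_n -> X).
Local Notation E := 'rV[R]_n.
Implicit Types (f : E -> R) (c : 'I_n -> E -> R) (y : E).

Definition dots (x : X) : E := \row_(j < n) dot (w j) x.

Lemma dots_continuous : continuous dots.
Proof. by apply: row_continuous => j; exact: dot_continuous. Qed.

Lemma dots_measurable f : continuous f ->
  measurable_fun [set: borel X] (f \o dots : borel X -> R).
Proof.
by move=> cf; apply: continuous_borel_measurable; exact: continuous_compose dots_continuous cf.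
Qed.

(** Joint approximation of a function and its intended gradient, in square mean under the law of
    [dots]. As the gradient is part of the data, those of the intermediate functions follow from the
    algebra of pairs. *)
Definition trig_approx f c :=
  [/\ continuous f, forall j, continuous (c j) &
   forall e : R, 0 < e -> exists f' c', [/\ trig_pair f' c',
     (sqint gamma (fun x => f (dots x) - f' (dots x))%R <= e%:E)%E &
     forall j, (sqint gamma (fun x => c j (dots x) - c' j (dots x))%R <= e%:E)%E]].

Lemma trig_approx_pair f c : trig_pair f c -> trig_approx f c.
Proof.
move=> fc; have [cf cc] := trig_pair_continuous fc; split => // e e0.
exists f, c; split => // [|j]; rewrite /sqint.
  by under eq_integral do rewrite subrr expr0n/=; rewrite integral0 lee_fin ltW.
by under eq_integral do rewrite subrr expr0n/=; rewrite integral0 lee_fin ltW.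
Qed.

Lemma trig_approx_eq f c f' c' : f =1 f' -> (forall j, c j =1 c' j) ->
  trig_approx f c -> trig_approx f' c'.
Proof.
move=> /funext <- cc'; suff -> : c' = c by [].
by apply/funext => j; apply/funext => y; rewrite cc'.
Qed.

Let msub f f' : continuous f -> continuous f' ->
  measurable_fun [set: borel X] (fun x : borel X => f (dots x) - f' (dots x)).
Proof. by move=> cf cf'; exact: (dots_measurable (continuous_sub cf cf')). Qed.

Lemma trig_approxD f c f' c' : trig_approx f c -> trig_approx f' c' ->
  trig_approx (fun y => f y + f' y) (fun j y => c j y + c' j y).
Proof.
move=> [cf cc af] [cf' cc' af']; split.
- exact: continuous_add.
- by move=> j; exact: continuous_add.
move=> e e0; have e4 : 0 < e / 4 by rewrite divr_gt0.
have [g [dg [gg g1 g2]]] := af _ e4; have [g' [dg' [gg' g1' g2']]] := af' _ e4.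
have [cg cdg] := trig_pair_continuous gg; have [cg' cdg'] := trig_pair_continuous gg'.
have key (a b a' b' : E -> R) : continuous a -> continuous b -> continuous a' -> continuous b' ->
    (sqint gamma (fun x => a (dots x) - b (dots x))%R <= (e / 4)%:E)%E ->
    (sqint gamma (fun x => a' (dots x) - b' (dots x))%R <= (e / 4)%:E)%E ->
    (sqint gamma (fun x => (a (dots x) + a' (dots x)) - (b (dots x) + b' (dots x)))%R <= e%:E)%E.
  move=> ca cb ca' cb' h h'.
  under [X in (sqint gamma X <= _)%E]eq_fun do rewrite opprD addrACA.
  rewrite (le_trans (sqintD _ (msub ca cb) (msub ca' cb')))//.
  have -> : e%:E = (2%:E * (e / 4)%:E + 2%:E * (e / 4)%:E)%E.
    by rewrite -!EFinM -EFinD; congr EFin; field.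
  by apply: leeD; rewrite lee_pmul2l.
exists (fun y => g y + g' y), (fun j y => dg j y + dg' j y); split.
- exact: trig_pairD.
- exact: key.
- by move=> j; exact: key.
Qed.

(** One factor is a trigonometric pair: it is bounded together with its gradient, and its product
    with an approximant is again a pair. *)
Lemma trig_approxM t dt f c : trig_pair t dt -> trig_approx f c ->
  trig_approx (fun y => t y * f y) (fun j y => dt j y * f y + t y * c j y).
Proof.
move=> tt [cf cc af]; have [ct cdt] := trig_pair_continuous tt.
have [M [tM dtM]] := trig_pair_bounded tt.
have M0 : 0 <= M by rewrite (le_trans _ (tM 0)).
split.
- exact: continuous_mul.
- by move=> j; apply: continuous_add; exact: continuous_mul.
(* Two terms of the gradient, each with a factor 2 from [sqintD] and M^2 from the bound, cost 4 M^2
   e'; the + 1 covers M = 0. *)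
move=> e e0; pose e' := e / (4 * (M ^+ 2 + 1)).
have M1 : 0 < M ^+ 2 + 1 by rewrite ltr_wpDl ?sqr_ge0.
have e'0 : 0 < e' by rewrite divr_gt0// mulr_gt0.
have Me : 2 * (M ^+ 2 * e') + 2 * (M ^+ 2 * e') <= e.
  have -> : 2 * (M ^+ 2 * e') + 2 * (M ^+ 2 * e') = e * (M ^+ 2 / (M ^+ 2 + 1)).
    by rewrite /e'; field; rewrite gt_eqF.
  by rewrite ler_piMr ?(ltW e0)// ler_pdivrMr// mul1r lerDl.
have [g [dg [gg g1 g2]]] := af _ e'0.
have [cg cdg] := trig_pair_continuous gg.
have key (u a b : E -> R) : continuous u -> continuous a -> continuous b ->
    (forall y, `|u y| <= M) ->
    (sqint gamma (fun x => a (dots x) - b (dots x))%R <= e'%:E)%E ->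
    (sqint gamma (fun x => u (dots x) * (a (dots x) - b (dots x)))%R <= (M ^+ 2 * e')%:E)%E.
  move=> cu ca cb uM h.
  rewrite (le_trans (sqint_mul_le gamma (dots_measurable cu) (msub ca cb) (fun x => uM _)))//.
  by rewrite (EFinM (M ^+ 2) e'); apply: lee_wpmul2l => //; rewrite lee_fin sqr_ge0.
exists (fun y => t y * g y), (fun j y => dt j y * g y + t y * dg j y); split.
- exact: trig_pairM.
- under [X in (sqint gamma X <= _)%E]eq_fun do rewrite -mulrBr.
  rewrite (le_trans (key _ _ _ ct cf cg tM g1))// lee_fin (le_trans _ Me)//.
  have : 0 <= M ^+ 2 * e' by rewrite mulr_ge0 ?sqr_ge0 ?ltW.
  by lra.
- move=> j.
  under [X in (sqint gamma X <= _)%E]eq_fun do rewrite opprD addrACA -!mulrBr.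
  have mm (u a b : E -> R) : continuous u -> continuous a -> continuous b ->
     measurable_fun [set: borel X] (fun x : borel X => u (dots x) * (a (dots x) - b (dots x))).
    by move=> cu ca cb; exact: (dots_measurable (continuous_mul cu (continuous_sub ca cb))).
  rewrite (le_trans (sqintD _ (mm _ _ _ (cdt j) cf cg) (mm _ _ _ ct (cc j) (cdg j))))//.
  rewrite (@le_trans _ _ (2 * (M ^+ 2 * e') + 2 * (M ^+ 2 * e'))%:E)//.
  have -> : (2 * (M ^+ 2 * e') + 2 * (M ^+ 2 * e'))%:E =
      (2%:E * (M ^+ 2 * e')%:E + 2%:E * (M ^+ 2 * e')%:E)%E by rewrite -!EFinM -EFinD.
  by apply: leeD; rewrite lee_pmul2l//; apply: key.
Qed.

(** Dominated convergence with a constant bound, integrable for a probability. This is why the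
    Bernstein approximants are bounded uniformly in N. *)
Lemma trig_approx_lim (fn : nat -> E -> R) (cn : nat -> 'I_n -> E -> R) f c (M : R) :
  continuous f -> (forall j, continuous (c j)) ->
  (forall N, trig_approx (fn N) (cn N)) ->
  (forall N y, `|fn N y| <= M) -> (forall N j y, `|cn N j y| <= M) ->
  (forall y, fn N y @[N --> \oo] --> f y) ->
  (forall j y, cn N j y @[N --> \oo] --> c j y) ->
  trig_approx f c.
Proof.
move=> cf cc an fM cM fcvg ccvg; split => // e e0.
have e4 : 0 < e / 4 by rewrite divr_gt0.
have lim_le (u : nat -> E -> R) (v : E -> R) : (forall N y, `|u N y| <= M) ->
    (forall y, u N y @[N --> \oo] --> v y) -> forall y, `|v y| <= M.
  move=> uM uv y; have h : `|u N y| @[N --> \oo] --> `|v y| by apply: cvg_norm; exact: uv.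
  rewrite -(cvg_lim _ h)//; apply: limr_le; first by apply/cvg_ex; eexists; exact: h.
  by apply: nearW => N; exact: uM.
have key (u : nat -> E -> R) (v : E -> R) : (forall N, continuous (u N)) -> continuous v ->
    (forall N y, `|u N y| <= M) -> (forall y, u N y @[N --> \oo] --> v y) ->
    \forall N \near \oo, (sqint gamma (fun x => v (dots x) - u N (dots x))%R <= (e / 4)%:E)%E.
  move=> cu cv uM uv; have vM := lim_le _ _ uM uv.
  have h : sqint gamma (fun x => v (dots x) - u N (dots x)) @[N --> \oo] --> 0%E.
    apply: (@sqint_cvg0 _ _ _ _ _ (M + M)).
    - by move=> N; exact: msub.
    - by move=> N x; rewrite (le_trans (ler_normB _ _))// lerD.
    - move=> x; rewrite -(subrr (v (dots x))); apply: cvgB => //; exact: cvg_cst.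
  exact: cvge0_near_le.
have cfn N : continuous (fn N) by have [] := an N.
have ccn N j : continuous (cn N j) by have [_ + _] := an N; exact.
have nc : \forall N \near \oo, forall j,
    (sqint gamma (fun x => c j (dots x) - cn N j (dots x))%R <= (e / 4)%:E)%E.
  apply: filter_forall => j.
  exact: (key (fun N => cn N j) (c j) (fun N => ccn N j) (cc j) (fun N => cM N j) (ccvg j)).
near \oo => N.
have hf : (sqint gamma (fun x => f (dots x) - fn N (dots x))%R <= (e / 4)%:E)%E.
  by near: N; exact: key.
have hc : forall j, (sqint gamma (fun x => c j (dots x) - cn N j (dots x))%R <= (e / 4)%:E)%E.
  by near: N; exact: nc.
have [_ _ /(_ _ e4) [g [dg [gg g1 g2]]]] := an N.
have [cg cdg] := trig_pair_continuous gg.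
have tri (u v z : E -> R) : continuous u -> continuous v -> continuous z ->
    (sqint gamma (fun x => u (dots x) - v (dots x))%R <= (e / 4)%:E)%E ->
    (sqint gamma (fun x => v (dots x) - z (dots x))%R <= (e / 4)%:E)%E ->
    (sqint gamma (fun x => u (dots x) - z (dots x))%R <= e%:E)%E.
  move=> cu cv cz h h'.
  have -> : (fun x => u (dots x) - z (dots x)) =
    (fun x => (u (dots x) - v (dots x)) + (v (dots x) - z (dots x))).
    by apply/funext => x; ring.
  rewrite (le_trans (sqintD _ (msub cu cv) (msub cv cz)))//.
  have -> : e%:E = (2%:E * (e / 4)%:E + 2%:E * (e / 4)%:E)%E.
    by rewrite -!EFinM -EFinD; congr EFin; field.
  by apply: leeD; rewrite lee_pmul2l.
exists g, dg; split => // [|j]; first exact: (tri _ (fn N)).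
exact: (tri _ (cn N j)).
Unshelve. all: by end_near. Qed.

(** A de Casteljau step multiplies by 1 - x and by x, both of them trigonometric pairs. The last
    term of the gradient comes from the dependence of x on the coordinate j0. *)
Lemma trig_approx_bern N (j0 : 'I_n) K (g : nat -> E -> R) (dg : nat -> 'I_n -> E -> R) :
  (forall k, trig_approx (g k) (dg k)) ->
  trig_approx (fun y => bern (bern_arg N (y 0 j0)) K (fun k => g k y))
    (fun j y => bern (bern_arg N (y 0 j0)) K (fun k => dg k j y) +
       (j == j0)%:R * (bern_arg_diff N (y 0 j0) * (K%:R *
          bern (bern_arg N (y 0 j0)) K.-1 (fun k => g k.+1 y - g k y)))).
Proof.
elim: K g dg => [|K IH] g dg gg.
  apply: trig_approx_eq (gg 0%N) => [//|j y] /=.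
  by rewrite mul0r !mulr0 addr0.
have h1 := IH g dg gg.
have h2 := IH (g \o succn) (dg \o succn) (fun k => gg k.+1).
have tX := @trig_pair_bern_arg R n N j0.
have tZ := trig_pairD (trig_pair_cst 1) (trig_pairM (trig_pair_cst (-1)) tX).
apply: trig_approx_eq (trig_approxD (trig_approxM tZ h1) (trig_approxM tX h2)) => [y|j y] /=.
  by rewrite mulN1r.
(* The factor K keeps the recursion valid at K = 0, where the predecessor of K is 0 as well. *)
have bernS (h : nat -> R) x : K%:R * bern x K h =
    K%:R * ((1 - x) * bern x K.-1 h + x * bern x K.-1 (h \o succn)).
  by case: K {IH h1 h2} => [|K]; rewrite ?mul0r.
set x := bern_arg N (y 0 j0); set D := fun k => g k.+1 y - g k y.
have -> : K.+1%:R * bern x K D = (bern x K (fun k => g k.+1 y) - bern x K (g^~ y)) +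
    K%:R * ((1 - x) * bern x K.-1 D + x * bern x K.-1 (D \o succn)).
  by rewrite -bernS -bernB -natr1 mulrDl mul1r addrC.
rewrite /comp/= -/D; ring.
Qed.

Definition freeze m (b y : E) : E := \row_j (if (j < m)%N then y 0 j else b 0 j).
Definition upd (b : E) (j0 : 'I_n) (t : R) : E := \row_j (if j == j0 then t else b 0 j).

Lemma freeze_continuous m b : continuous (freeze m b).
Proof.
apply: row_continuous => j; case: (j < m)%N; last exact: cst_continuous.
exact: coord_continuous.
Qed.

Lemma freezeS m (j0 : 'I_n) b y : j0 = m :> nat ->
  freeze m.+1 b y = freeze m (upd b j0 (y 0 j0)) y.
Proof.
move=> j0m; apply/rowP => j; rewrite !mxE ltnS leq_eqVlt.
have -> : (j == m :> nat) = (j == j0) by rewrite -j0m.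
case: eqVneq => [->|_] /=; last by case: ifP.
by rewrite j0m ltnn.
Qed.

Lemma freeze_upd m (j0 : 'I_n) b y t : j0 = m :> nat ->
  freeze m (upd b j0 t) y = t *: delta_mx 0 j0 + freeze m (upd b j0 0) y.
Proof.
move=> j0m; apply/rowP => j; rewrite !mxE eqxx /=.
case: ifPn => [jm|_]; last by case: eqVneq => _ /=; rewrite ?mulr0 ?mulr1 ?add0r ?addr0.
have -> : (j == j0) = false by apply/negbTE/eqP => E; move: jm; rewrite E j0m ltnn.
by rewrite mulr0 add0r.
Qed.

Variable phi : E -> R.
Local Notation dphi j := (fun y => 'D_(delta_mx 0 j) phi y).
Variable M : R.
Hypotheses (cphi : continuous phi) (phiM : forall y, `|phi y| <= M)
  (derphi : forall y (j : 'I_n), derivable phi y (delta_mx 0 j))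
  (cdphi : forall j : 'I_n, continuous (dphi j)) (dphiM : forall (j : 'I_n) y, `|dphi j y| <= M).

Lemma is_derive_line (a : E) (j : 'I_n) (t : R) :
  is_derive t (1 : R) (fun s => phi (s *: delta_mx 0 j + a))
    (dphi j (t *: delta_mx 0 j + a)).
Proof.
have key : h^-1 *: (phi ((h *: (1 : R) + t) *: delta_mx 0 j + a) - phi (t *: delta_mx 0 j + a))
    @[h --> 0^'] --> dphi j (t *: delta_mx 0 j + a).
  have cv : h^-1 *: (phi (h *: delta_mx 0 j + (t *: delta_mx 0 j + a)) -
      phi (t *: delta_mx 0 j + a)) @[h --> 0^'] --> dphi j (t *: delta_mx 0 j + a).
    exact: derphi.
  apply: cvg_trans cv; apply: near_eq_cvg; apply: nearW => h.
  by rewrite addrA -scalerDl -[h *: 1]/(h * 1) mulr1.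
apply: DeriveDef; first by apply/cvg_ex; eexists; exact: key.
exact: cvg_lim key.
Qed.

(* One more variable is released at each step, by Bernstein interpolation in that
   variable between functions where it is frozen at the nodes. *)
Lemma trig_approx_freeze m b : (m <= n)%N ->
  trig_approx (phi \o freeze m b)
    (fun j y => if (j < m)%N then dphi j (freeze m b y) else 0).
Proof.
elim: m b => [|m IH] b mn.
  apply: trig_approx_eq (trig_approx_pair (trig_pair_cst (phi b))) => [y|//].
  by rewrite /=; congr phi; apply/rowP => j; rewrite mxE.
pose j0 := Ordinal mn.
have cz m' b' (j : 'I_n) : continuous (fun y => if (j < m')%N then dphi j (freeze m' b' y) else 0).
  case: (j < m')%N; last exact: cst_continuous.
  apply: (@continuous_compose _ _ _ (freeze m' b') (fun y => dphi j y)); last exact: cdphi.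
  exact: freeze_continuous.
pose h y t := phi (freeze m (upd b j0 t) y).
pose dh (j : 'I_n) (y : E) (t : R) : R := dphi j (freeze m (upd b j0 t) y).
have clin y : continuous (fun t => freeze m (upd b j0 t) y).
  apply: row_continuous => j; case: (j < m)%N; first exact: cst_continuous.
  under eq_fun do rewrite mxE; case: (j == j0); last exact: cst_continuous.
  by move=> t; exact: cvg_id.
have hder y (t : R) : is_derive t (1 : R) (h y) (dh j0 y t).
  have := is_derive_line (freeze m (upd b j0 0) y) j0 t.
  rewrite -freeze_upd// /h /dh; congr is_derive.
  by apply/funext => s; rewrite -freeze_upd.
have ch y : continuous (h y) by exact: continuous_compose (clin y) cphi.
have cdh j y : continuous (dh j y).
  apply: (@continuous_compose R _ _ (fun t => freeze m (upd b j0 t) y) (fun z => dphi j z)).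
    exact: clin.
  exact: cdphi.
pose fn N y := bern (bern_arg N (y 0 j0)) (bern_degree N) (h y \o bern_node N).
(* The partials in the variables released before are interpolated like the function; the one in the
   new variable acts on the interpolation itself. *)
pose cn N (j : 'I_n) y := if (j < m)%N
   then bern (bern_arg N (y 0 j0)) (bern_degree N) (dh j y \o bern_node N)
   else if j == j0 then bern_approx_diff N (y 0 j0) (h y) else 0.
have M0 : 0 <= M by rewrite (le_trans _ (phiM 0)).
apply: (@trig_approx_lim fn cn _ _ M).
- exact: continuous_compose (@freeze_continuous _ _) cphi.
- by move=> j; exact: cz.
- move=> N.
  have := @trig_approx_bern N j0 (bern_degree N) _ _
     (fun k => IH (upd b j0 (bern_node N k)) (ltnW mn)).
  apply: trig_approx_eq => // j y; rewrite /cn.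
  have [jm|jm] := ltnP j m.
    have -> : (j == j0) = false by apply/negbTE/eqP => E; move: jm; rewrite E ltnn.
    by rewrite mul0r addr0.
  rewrite bern_cst add0r; case: eqVneq => _; last by rewrite mul0r.
  by rewrite mul1r /bern_approx_diff mulrA.
- by move=> N y; apply: norm_bern_le => [|k]; [exact: bern_arg01|exact: phiM].
- move=> N j y; rewrite /cn; case: ifP => _.
    by apply: norm_bern_le => [|k]; [exact: bern_arg01|exact: dphiM].
  case: eqVneq => _; last by rewrite normr0.
  by apply: (bern_approx_diff_le _ _ (hder y)) => t; exact: dphiM.
- move=> y; rewrite /= (freezeS (j0 := j0))//.
  by apply: (bern_approx (h := h y)) => //; exists M => t; exact: phiM.
- move=> j y; rewrite /cn ltnS [(j <= m)%N]leq_eqVlt (freezeS (j0 := j0))//.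
  have -> : (j == m :> nat) = (j == j0) by [].
  have [jm|jm] := ltnP j m.
    rewrite orbT; apply: (bern_approx (h := dh j y)) => //.
    by exists M => t; exact: dphiM.
  case: eqVneq => [->|_] /=; last exact: cvg_cst.
  have hM : exists M', forall t, `|dh j0 y t| <= M' by exists M => t; exact: dphiM.
  exact: (@bern_approx_diff_cvg R (y 0 j0) (h y) (dh j0 y) (hder y) (cdh j0 y) hM).
Qed.

Lemma trig_approx_smooth : trig_approx phi (fun j => dphi j).
Proof.
have freezeE y : freeze n 0 y = y by apply/rowP => i; rewrite mxE ltn_ord.
apply: trig_approx_eq (trig_approx_freeze 0 (leqnn n)) => [y|j y] /=.
  by rewrite freezeE.
by rewrite ltn_ord freezeE.
Qed.

End Density.

(** * The differential of a cylindrical function *)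

Section CylinderDifferential.
Context {R : realType}.

Lemma diff_of_estimate (V W : normedModType R) (f : V -> W) (df : {linear V -> W}) x :
  continuous df ->
  (forall e : R, 0 < e -> \forall h \near (0 : V), `|f (h + x) - f x - df h| <= e * `|h|) ->
  'd f x = df :> (V -> W).
Proof.
move=> cdf est; apply: diff_unique => //; apply/eqaddoP => e e0.
apply: filterS (est e e0) => h /=.
by rewrite -[(_ - _) h]/(f (h + x) - (f x + df h)) opprD addrA.
Qed.

(** Continuous partials give differentiability: the increment is split along a path that moves one
    coordinate at a time. On each edge the mean value theorem yields a partial at a point within d
    of a. *)
Lemma estimate_of_partials n (phi : 'rV[R]_n -> R) (a : 'rV[R]_n) (e : R) :
  (forall y (j : 'I_n), derivable phi y (delta_mx 0 j)) ->
  (forall j : 'I_n, continuous (fun y => 'D_(delta_mx 0 j) phi y)) -> 0 < e ->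
  exists2 d, 0 < d & forall v : 'rV[R]_n, (forall j, `|v 0 j| < d) ->
    `|phi (v + a) - phi a - \sum_j v 0 j * 'D_(delta_mx 0 j) phi a|
      <= e * \sum_j `|v 0 j|.
Proof.
move=> der cdphi e0.
have : \forall y \near a, forall j : 'I_n, `|'D_(delta_mx 0 j) phi a - 'D_(delta_mx 0 j) phi y| <= e.
  apply: (@filter_forall _ _ _ _ (nbhs_filter a)) => j.
  by have /cvgrPdist_le /(_ _ e0) := cdphi j a.
move=> /nbhs_ballP [d /= d0 hd]; exists d => // v vd.
pose p m : 'rV[R]_n := freeze m a (v + a).
have p0 : p 0%N = a by apply/rowP => j; rewrite mxE.
have pn : p n = v + a by apply/rowP => j; rewrite mxE ltn_ord.
have pj (j : 'I_n) t : freeze j (upd a j (t + a 0 j)) (v + a) = t *: delta_mx 0 j + p j.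
  apply/rowP => i; rewrite !mxE eqxx /=.
  case: ltnP => ij.
    have -> : (i == j) = false by apply/negbTE/eqP => E; move: ij; rewrite E ltnn.
    by rewrite mulr0 add0r.
  by case: eqVneq => [->|_] /=; rewrite ?mulr1 ?mulr0 ?add0r.
have pS (j : 'I_n) : p j.+1 = v 0 j *: delta_mx 0 j + p j.
  by rewrite /p (freezeS (j0 := j))// -pj; congr (freeze _ (upd _ _ _) _); rewrite mxE.
have step (j : 'I_n) : `|phi (p j.+1) - phi (p j) - v 0 j * 'D_(delta_mx 0 j) phi a|
    <= e * `|v 0 j|.
  have hl t := is_derive_line der (p j) j t.
  have cl : continuous (fun s : R => phi (s *: delta_mx 0 j + p j)).
    by move=> t; apply/differentiable_continuous; rewrite -derivable1_diffP; have [] := hl t.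
  have [c cv E] : exists2 c, `|c| <= `|v 0 j| &
      phi (p j.+1) - phi (p j) = 'D_(delta_mx 0 j) phi (c *: delta_mx 0 j + p j) * v 0 j.
    rewrite pS; have [z0|z0|<-] := ltgtP 0 (v 0 j).
    - have [c] := MVT z0 (fun t _ => hl t) (continuous_subspaceT cl).
      rewrite in_itv/= scale0r add0r subr0 => /andP[c0 cz] E; exists c => //.
      by rewrite !ger0_norm ltW.
    - have [c] := MVT z0 (fun t _ => hl t) (continuous_subspaceT cl).
      rewrite in_itv/= scale0r add0r sub0r => /andP[zc c0] E; exists c.
        by rewrite !ltr0_norm// lerN2 ltW.
      by rewrite -opprB E mulrN opprK.
    - by exists 0 => //; rewrite scale0r add0r subrr mulr0.
  rewrite E [v 0 j * _]mulrC -mulrBl normrM ler_wpM2r// distrC; apply: hd.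
  split => // i k; rewrite ord1 -ball_normE /ball_ /= !mxE eqxx /=.
  have ad : a 0 k - (v 0 k + a 0 k) = - v 0 k by ring.
  case: ltnP => kj.
    have -> : (k == j) = false by apply/negbTE/eqP => E'; move: kj; rewrite E' ltnn.
    by rewrite mulr0 add0r ad normrN.
  case: eqVneq => [->|_] /=; last by rewrite mulr0 add0r subrr normr0.
  by rewrite mulr1 opprD addrC subrK normrN (le_lt_trans cv).
have tel : phi (v + a) - phi a = \sum_(j < n) (phi (p j.+1) - phi (p j)).
  by rewrite -(big_mkord xpredT (fun j => phi (p j.+1) - phi (p j))) telescope_sumr// pn p0.
rewrite tel -sumrB mulr_sumr (le_trans (ler_norm_sum _ _ _))//.
by apply: ler_sum => j _; exact: step.
Qed.

Context {X Y : hilbertType R}.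

Definition cyl_diff M n (c : 'I_M -> 'I_n -> R) (w : 'I_n -> X) (y : 'I_M -> Y) (h : X) : Y :=
  \sum_(i < M) (\sum_(j < n) c i j * dot (w j) h) *: y i.

Lemma cyl_diff_linear M n c w y : linear (@cyl_diff M n c w y).
Proof.
move=> a u v; rewrite /cyl_diff scaler_sumr -big_split/=; apply: eq_bigr => i _.
rewrite scalerA -scalerDl mulr_sumr -big_split/=; congr (_ *: _).
by apply: eq_bigr => j _; rewrite dotDr dotZr; ring.
Qed.

HB.instance Definition _ M n c w y :=
  GRing.isLinear.Build R X Y _ (@cyl_diff M n c w y) (cyl_diff_linear c w y).

Lemma cyl_diff_continuous M n c w y : continuous (@cyl_diff M n c w y).
Proof.
move=> h; apply: cvg_big => [|i _]; first exact: add_continuous.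
apply: cvgZr_tmp; apply: cvg_big => [|j _]; first exact: add_continuous.
by apply: cvgM; [exact: cvg_cst|exact: dot_continuous].
Qed.

Lemma diff_cylinder M n (phi : 'I_M -> 'rV[R]_n -> R) (w : 'I_n -> X) (y : 'I_M -> Y) x :
  (forall i z (j : 'I_n), derivable (phi i) z (delta_mx 0 j)) ->
  (forall i (j : 'I_n), continuous (fun z => 'D_(delta_mx 0 j) (phi i) z)) ->
  'd (fun x => \sum_(i < M) phi i (dots w x) *: y i) x =
    cyl_diff (fun i j => 'D_(delta_mx 0 j) (phi i) (dots w x)) w y :> (X -> Y).
Proof.
move=> der cd; apply: diff_of_estimate; first exact: cyl_diff_continuous.
move=> e e0.
pose A := \sum_(i < M) `|y i|; pose B := \sum_(j < n) `|w j|.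
have A0 : 0 <= A by apply: sumr_ge0.
have B0 : 0 <= B by apply: sumr_ge0.
(* The scalar errors e' pass through the [w j] and the [y i], with total factor A B; the + 1 avoids
   a zero denominator. *)
pose e' := e / (A * B + 1).
have AB : 0 < A * B + 1 by rewrite ltr_wpDl// mulr_ge0.
have e'0 : 0 < e' by rewrite divr_gt0.
have /choice [d hd] i : exists d, 0 < d /\ forall v : 'rV[R]_n, (forall j, `|v 0 j| < d) ->
    `|phi i (v + dots w x) - phi i (dots w x) -
      \sum_j v 0 j * 'D_(delta_mx 0 j) (phi i) (dots w x)| <= e' * \sum_j `|v 0 j|.
  by have [d d0 h] := estimate_of_partials (dots w x) (der i) (cd i) e'0; exists d.
have nv : \forall h \near (0 : X), forall i (j : 'I_n), `|dots w h 0 j| < d i.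
  apply: filter_forall => i; apply: filter_forall => j.
  have d0 : 0 < d i by have [] := hd i.
  have /cvgrPdist_lt /(_ _ d0) := @dot_continuous _ _ (w j) 0.
  by apply: filterS => h; rewrite mxE dot0r sub0r normrN.
apply: filterS nv => h hh.
have dD : dots w (h + x) = dots w h + dots w x by apply/rowP => j; rewrite !mxE dotDr.
rewrite /cyl_diff dD -!sumrB.
rewrite (le_trans (ler_norm_sum _ _ _))//.
have bw : \sum_j `|dots w h 0 j| <= B * `|h|.
  by rewrite mulr_suml; apply: ler_sum => j _; rewrite mxE CauchySchwarz.
apply: (@le_trans _ _ (\sum_(i < M) (e' * (B * `|h|)) * `|y i|)).
  apply: ler_sum => i _; rewrite -!scalerBl normrZ ler_wpM2r//.
  have [_ /(_ _ (hh i)) H] := hd i.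
  have -> : \sum_(j < n) 'D_(delta_mx 0 j) (phi i) (dots w x) * dot (w j) h =
    \sum_j dots w h 0 j * 'D_(delta_mx 0 j) (phi i) (dots w x).
    by apply: eq_bigr => j _; rewrite [dots _ _ _ _]mxE mulrC.
  by rewrite (le_trans H)// ler_wpM2l// ltW.
rewrite -mulr_sumr -/A.
have -> : e' * (B * `|h|) * A = (A * B) / (A * B + 1) * (e * `|h|).
  by rewrite /e'; field; rewrite gt_eqF.
by rewrite ler_piMl ?mulr_ge0 ?(ltW e0)// ler_pdivrMr// mul1r lerDl.
Qed.

End CylinderDifferential.

Section SumSquares.
Context {R : realType}.

Lemma sqr_sum_le n (a : 'I_n -> R) : (\sum_i a i) ^+ 2 <= n%:R * \sum_i a i ^+ 2.
Proof.
have -> : n%:R * \sum_i a i ^+ 2 = \sum_i \sum_j (a i ^+ 2 + a j ^+ 2) / 2.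
  under [RHS]eq_bigr do rewrite -mulr_suml big_split/= sumr_const card_ord.
  rewrite -mulr_suml big_split/= sumr_const card_ord sumrMnl.
  by rewrite -mulr_natl; field.
rewrite expr2 mulr_suml; apply: ler_sum => i _; rewrite mulr_sumr; apply: ler_sum => j _.
by have := sqr_ge0 (a i - a j); rewrite sqrrB; lra.
Qed.

Lemma norm_sum_sqr_le (Y : hilbertType R) n (u : 'I_n -> Y) :
  `|\sum_i u i| ^+ 2 <= n%:R * \sum_i `|u i| ^+ 2.
Proof.
apply: le_trans (sqr_sum_le (fun i => `|u i|)).
by rewrite ler_pXn2r ?nnegrE ?sumr_ge0// ler_norm_sum.
Qed.

Lemma integral_sum_sqr_le d (T : measurableType d) (P : probability T R) (I : finType)
    (a : I -> R) (f : I -> T -> R) (e : R) :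
  (forall i, 0 <= a i) -> (forall i, measurable_fun [set: T] (f i)) ->
  (forall i, (sqint P (f i) <= e%:E)%E) ->
  (\int[P]_x (\sum_i a i * f i x ^+ 2)%:E <= ((\sum_i a i) * e)%:E)%E.
Proof.
move=> a0 mf fe.
under eq_integral do rewrite -sumEFin.
rewrite ge0_integral_sum//; last 2 first.
- by move=> i; apply/measurable_EFinP; apply: measurable_funM => //; exact: measurable_funX.
- by move=> i x _; rewrite lee_fin mulr_ge0// sqr_ge0.
rewrite mulr_suml -sumEFin; apply: lee_sum => i _.
under eq_integral do rewrite EFinM.
rewrite ge0_integralZl//.
- rewrite (EFinM (a i) e); apply: lee_wpmul2l; first by rewrite lee_fin.
  exact: fe.
- by apply/measurable_EFinP; exact: measurable_funX.
- by move=> x _; rewrite lee_fin sqr_ge0.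
- by rewrite lee_fin.
Qed.

End SumSquares.

(** * Sobolev approximation by trigonometric polynomials *)

Section CylinderTrig.
Context {R : realType} {X Y : hilbertType R} (C : X -> X)
  (gamma : probability (borel X) R) (v : nat -> X).
Hypotheses (injC : injective C)
  (onb_v : orthonormal_basis (cameron_martin C) (cm_dot C) v).

(** Partial sums of the series of [covariance_sum]. This makes the gradient errors summable over the
    whole basis. *)
Lemma basis_bessel u m : \sum_(0 <= i < m) dot (v i) u ^+ 2 <= dot (C u) u.
Proof.
have h := @covariance_sum _ _ _ _ injC onb_v u u.
rewrite -(cvg_lim _ h)//; apply: limr_ge; first by apply/cvg_ex; eexists; exact: h.
near=> k; rewrite [leRHS](@big_cat_nat _ _ _ m)//=; last first.
  by near: k; exact: nbhs_infty_ge.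
under eq_bigr do rewrite expr2.
by rewrite lerDl sumr_ge0// => i _; rewrite -expr2 sqr_ge0.
Unshelve. all: by end_near. Qed.

Section Lift.
Context n (w : 'I_n -> X).

Lemma dot_dots (b : 'rV[R]_n) x : dot (\sum_j b 0 j *: w j) x = phase b (dots w x).
Proof. by rewrite dot_suml; apply: eq_bigr => j _; rewrite dotZl mxE. Qed.

Lemma trig_pair_lift f c (y : Y) : trig_pair f c ->
  exists s : seq (Y * X * R), forall x,
    trig_poly s x = f (dots w x) *: y /\
    forall h, trig_diff s x h = (\sum_j c j (dots w x) * dot (w j) h) *: y.
Proof.
move=> [s [-> ->]].
exists [seq (k.1.1 *: y, \sum_j (k.1.2 : 'rV[R]_n) 0 j *: w j, k.2) | k <- s] => x.
split=> [|h]; rewrite /trig_poly /trig_diff big_map.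
  rewrite scaler_suml; apply: eq_bigr => k _ /=.
  by rewrite dot_dots scalerA mulrC.
under [in RHS]eq_bigr do rewrite mulr_suml.
rewrite exchange_big/= scaler_suml; apply: eq_bigr => k _.
rewrite dot_dots scalerA; congr (_ *: _).
rewrite dot_suml mulr_sumr mulr_suml; apply: eq_bigr => j _.
by rewrite dotZl; ring.
Qed.

End Lift.

Lemma trig_poly_flatten (I : finType) (S : I -> seq (Y * X * R)) x :
  trig_poly (flatten [seq S i | i <- index_enum I]) x = \sum_i trig_poly (S i) x.
Proof. by rewrite /trig_poly big_flatten big_map. Qed.

Lemma trig_diff_flatten (I : finType) (S : I -> seq (Y * X * R)) x h :
  trig_diff (flatten [seq S i | i <- index_enum I]) x h = \sum_i trig_diff (S i) x h.
Proof. by rewrite /trig_diff big_flatten big_map. Qed.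

(** Along [v k], the errors on the partials carry the weights <v_k, w_j>^2, whose sum over k is at
    most the variance of <w_j, x>. Hence finitely many scalar approximations control the full
    Hilbert-Schmidt error. *)
Lemma smooth_cylindrical_trig (F : X -> Y) (e : R) : smooth_cylindrical F -> 0 < e ->
  exists s : seq (Y * X * R),
  [/\ continuous F, forall h, continuous (fun x => 'd F x h : Y),
     (\int[gamma]_x (`|F x - trig_poly s x| ^+ 2)%:E <= e%:E)%E &
     (\sum_(0 <= i <oo) \int[gamma]_x (`|'d F x (v i) - trig_diff s x (v i)| ^+ 2)%:E
       <= e%:E)%E].
Proof.
move=> [M [n [w [y [phi [hphi FE]]]]]] e0.
have {}FE : F = fun x => \sum_(i < M) phi i (dots w x) *: y i by apply/funext => x; rewrite FE.
have cphi i : continuous (phi i) by have [] := hphi i [::].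
have der i z (j : 'I_n) : derivable (phi i) z (delta_mx 0 j) by have [_ + _] := hphi i [::]; exact.
have cd i (j : 'I_n) : continuous (fun z => 'D_(delta_mx 0 j) (phi i) z).
  by have [] := hphi i [:: j].
have dF x : 'd F x = cyl_diff (fun i j => 'D_(delta_mx 0 j) (phi i) (dots w x)) w y :> (X -> Y).
  by rewrite FE; exact: diff_cylinder.
have cw (f : 'rV[R]_n -> R) : continuous f -> continuous (fun x => f (dots w x)).
  by move=> cf; exact: continuous_compose (@dots_continuous _ _ _ w) cf.
have cF : continuous F.
  rewrite FE => x; apply: cvg_big => [|i _]; first exact: add_continuous.
  by apply: cvgZr_tmp; exact: (cw _ (cphi i)).
have cdF h : continuous (fun x => 'd F x h : Y).
  under eq_fun do rewrite dF.
  move=> x; apply: cvg_big => [|i _]; first exact: add_continuous.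
  apply: cvgZr_tmp; apply: cvg_big => [|j _]; first exact: add_continuous.
  by apply: cvgM; [exact: (cw _ (cd i j))|exact: cvg_cst].
(* B1 and B2 convert a scalar error e' into the errors on the values and on the gradient; M and M n
   come from the Cauchy-Schwarz inequality for finite sums. *)
pose B1 := \sum_(i < M) M%:R * `|y i| ^+ 2.
pose q u := dot (C u) u.
pose B2 := \sum_(p : 'I_M * 'I_n) (M * n)%:R * `|y p.1| ^+ 2 * q (w p.2).
have q0 u : 0 <= q u by have := basis_bessel u 0; rewrite big_nil.
have B10 : 0 <= B1 by apply: sumr_ge0 => i _; rewrite mulr_ge0// sqr_ge0.
have B20 : 0 <= B2 by apply: sumr_ge0 => p _; rewrite mulr_ge0// mulr_ge0// sqr_ge0.
have B0 : 0 < B1 + B2 + 1 by rewrite ltr_wpDl// addr_ge0.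
pose e' := e / (B1 + B2 + 1).
have e'0 : 0 < e' by rewrite divr_gt0.
have Be (B : R) : B <= B1 + B2 + 1 -> B * e' <= e.
  by move=> h; rewrite /e' mulrCA ler_piMr ?(ltW e0)// ler_pdivrMr// mul1r.
have bound i : exists Mi, (forall z, `|phi i z| <= Mi) /\
    forall (j : 'I_n) z, `|'D_(delta_mx 0 j) (phi i) z| <= Mi.
  have [_ _ [M0 hM0]] := hphi i [::].
  have /choice [Mj hMj] (j : 'I_n) : exists Mj, forall z, `|'D_(delta_mx 0 j) (phi i) z| <= Mj.
    by have [_ _ [Mj hMj]] := hphi i [:: j]; exists Mj.
  exists (`|M0| + \sum_j `|Mj j|); split => [z|j z].
    rewrite (le_trans (hM0 z))// (le_trans (ler_norm _))// lerDl.
    by apply: sumr_ge0.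
  rewrite (le_trans (hMj j z))// (le_trans (ler_norm _))// ler_wpDl//.
  by rewrite (bigD1 j)//= lerDl sumr_ge0.
have /choice [S hS] i : exists S : seq (Y * X * R), exists f c, [/\ trig_pair f c,
    (sqint gamma (fun x => phi i (dots w x) - f (dots w x))%R <= e'%:E)%E,
    forall j : 'I_n, (sqint gamma (fun x => 'D_(delta_mx 0 j) (phi i) (dots w x)
      - c j (dots w x))%R <= e'%:E)%E &
    forall x, trig_poly S x = f (dots w x) *: y i /\
    forall h, trig_diff S x h = (\sum_j c j (dots w x) * dot (w j) h) *: y i].
  have [Mi [h1 h2]] := bound i.
  have [_ _ /(_ _ e'0) [f [c [fc f1 c1]]]] :=
    trig_approx_smooth gamma w (cphi i) h1 (der i) (cd i) h2.
  by have [S hS] := trig_pair_lift w (y i) fc; exists S, f, c.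
have /choice [f {}hS] := hS.
have /choice [c {}hS] := hS.
have cf i : continuous (f i) by have [/trig_pair_continuous [] ] := hS i.
have cc i j : continuous (c i j) by have [/trig_pair_continuous [_ +] _ _ _] := hS i; exact.
pose s := flatten [seq S i | i <- index_enum 'I_M]; exists s.
have mdiff (g g' : 'rV[R]_n -> R) : continuous g -> continuous g' ->
   measurable_fun [set: borel X] (fun x : borel X => g (dots w x) - g' (dots w x)).
  by move=> cg cg'; exact: (dots_measurable w (continuous_sub cg cg')).
have mnorm (G : X -> Y) : continuous G ->
    measurable_fun [set: borel X] (fun x : borel X => (`|G x| ^+ 2)%:E).
  move=> cG; apply/measurable_EFinP; apply: measurable_funX.
  apply: continuous_borel_measurable => x; apply: cvg_norm; exact: cG.
have csum (I : finType) (a : I -> R) (g : I -> X -> R) : (forall i, continuous (g i)) ->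
    measurable_fun [set: borel X] (fun x : borel X => (\sum_i a i * g i x ^+ 2)%:E).
  move=> cg; apply/measurable_EFinP; apply: continuous_borel_measurable.
  apply: sum_continuous => i; apply: continuous_mul; first exact: cst_continuous.
  exact: continuous_sqr.
split => //.
- have E x : F x - trig_poly s x = \sum_(i < M) (phi i (dots w x) - f i (dots w x)) *: y i.
    rewrite FE /s trig_poly_flatten -sumrB; apply: eq_bigr => i _.
    by have [_ _ _ /(_ x) [-> _]] := hS i; rewrite scalerBl.
  apply: (@le_trans _ _ (\int[gamma]_x (\sum_(i < M) (M%:R * `|y i| ^+ 2) *
      (phi i (dots w x) - f i (dots w x)) ^+ 2)%:E)%E).
    apply: ge0_le_integral => //.
    + by apply: mnorm => x; apply: cvgB; [exact: cF|exact: trig_poly_continuous].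
    + apply: (csum _ _ (fun i x => phi i (dots w x) - f i (dots w x))) => i.
      exact: (cw (fun z => phi i z - f i z) (continuous_sub (cphi i) (cf i))).
    + move=> x _; rewrite lee_fin E (le_trans (norm_sum_sqr_le _))// mulr_sumr.
      apply: ler_sum => i _; rewrite normrZ exprMn real_normK ?num_real//.
      by rewrite le_eqVlt; apply/orP; left; apply/eqP; ring.
  apply: (@le_trans _ _ (B1 * e')%:E); last first.
    by rewrite lee_fin; apply: Be; rewrite -addrA lerDl addr_ge0.
  apply: (@integral_sum_sqr_le R _ (borel X) gamma 'I_M (fun i => M%:R * `|y i| ^+ 2)
    (fun i x => phi i (dots w x) - f i (dots w x)) e').
  + by move=> i; rewrite mulr_ge0// sqr_ge0.
  + by move=> i; exact: mdiff.
  + by move=> i; have [] := hS i.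
- have E k x : 'd F x (v k) - trig_diff s x (v k) = \sum_(i < M)
      (\sum_(j < n) ('D_(delta_mx 0 j) (phi i) (dots w x) - c i j (dots w x)) * dot (w j) (v k)) *: y i.
    rewrite dF /s trig_diff_flatten /cyl_diff -sumrB; apply: eq_bigr => i _.
    have [_ _ _ /(_ x) [_ ->]] := hS i; rewrite -scalerBl -sumrB.
    by congr (_ *: _); apply: eq_bigr => j _; rewrite mulrBl.
  have step k : (\int[gamma]_x (`|'d F x (v k) - trig_diff s x (v k)| ^+ 2)%:E <=
     ((\sum_(p : 'I_M * 'I_n) (M * n)%:R * `|y p.1| ^+ 2 * dot (v k) (w p.2) ^+ 2) * e')%:E)%E.
    apply: (@le_trans _ _ (\int[gamma]_x (\sum_(p : 'I_M * 'I_n)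
      ((M * n)%:R * `|y p.1| ^+ 2 * dot (v k) (w p.2) ^+ 2) *
      ('D_(delta_mx 0 p.2) (phi p.1) (dots w x) - c p.1 p.2 (dots w x)) ^+ 2)%:E)%E).
      apply: ge0_le_integral => //.
      + apply: mnorm => x; apply: cvgB; first exact: cdF.
        under eq_fun do rewrite trig_diffE.
        by rewrite trig_diffE; exact: trig_poly_continuous.
      + apply: (csum _ _ (fun (p : 'I_M * 'I_n) x => 'D_(delta_mx 0 p.2) (phi p.1) (dots w x)
          - c p.1 p.2 (dots w x))) => p.
        apply: (cw (fun z => 'D_(delta_mx 0 p.2) (phi p.1) z - c p.1 p.2 z)).
        by apply: continuous_sub; [exact: cd|exact: cc].
      + move=> x _; rewrite lee_fin E (le_trans (norm_sum_sqr_le _))// mulr_sumr.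
        rewrite -(pair_bigA _ (fun i j => (M * n)%:R * `|y i| ^+ 2 * dot (v k) (w j) ^+ 2 *
          ('D_(delta_mx 0 j) (phi i) (dots w x) - c i j (dots w x)) ^+ 2))/=.
        apply: ler_sum => i _; rewrite normrZ exprMn real_normK ?num_real//.
        rewrite (le_trans (ler_wpM2l _ (ler_wpM2r _ (sqr_sum_le _))))// ?sqr_ge0//.
        rewrite mulr_sumr mulr_suml mulr_sumr le_eqVlt; apply/orP; left; apply/eqP.
        by apply: eq_bigr => j _; rewrite natrM (dotC (v k)); ring.
    apply: (@integral_sum_sqr_le R _ (borel X) gamma ('I_M * 'I_n)%type
      (fun p => (M * n)%:R * `|y p.1| ^+ 2 * dot (v k) (w p.2) ^+ 2)
      (fun p x => 'D_(delta_mx 0 p.2) (phi p.1) (dots w x) - c p.1 p.2 (dots w x)) e').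
    + by move=> p; rewrite mulr_ge0// ?sqr_ge0// mulr_ge0// sqr_ge0.
    + by move=> p; apply: (mdiff (fun z => 'D_(delta_mx 0 p.2) (phi p.1) z)).
    + by move=> p; have [] := hS p.1.
  apply: lime_le.
    apply: is_cvg_nneseries => k _ _; apply: integral_ge0 => x _.
    by rewrite lee_fin sqr_ge0.
  apply: nearW => m; rewrite (le_trans (lee_sum _ (fun k _ => step k)))//.
  rewrite sumEFin lee_fin -mulr_suml; apply: Be.
  apply: (@le_trans _ _ B2); last by rewrite addrAC lerDr addr_ge0.
  rewrite exchange_big/=; apply: ler_sum => p _; rewrite -mulr_sumr ler_wpM2l//.
  exact: basis_bessel.
Qed.

End CylinderTrig.

(** * Conditional expectation *)

Section Quantize.
Context {R : realType} {Y : hilbertType R} (y : nat -> Y).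

(* The nearest point to u among 0, y_0, ..., y_(m-1). *)
Fixpoint quantize (m : nat) (u : Y) : Y :=
  if m is m'.+1 then
    if `|u - y m'| < `|u - quantize m' u| then y m' else quantize m' u
  else 0.

Lemma quantize_dist m u :
  `|u - quantize m.+1 u| = Num.min `|u - y m| `|u - quantize m u|.
Proof. by rewrite /= [RHS]minElt; case: ifP. Qed.

Lemma quantize_dist_ni m n u : (m <= n)%N -> `|u - quantize n u| <= `|u - quantize m u|.
Proof.
elim: n => [|n IH]; first by rewrite leqn0 => /eqP ->.
rewrite leq_eqVlt => /orP[/eqP ->//|mn].
by rewrite quantize_dist ge_min IH ?orbT.
Qed.

(** Since 0 is a candidate, the distance is at most |u|. This bound provides the domination in
    [condexp_orthogonal]. *)
Lemma quantize_norm m u : `|quantize m u| <= 2 * `|u|.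
Proof.
have /= := quantize_dist_ni u (leq0n m); rewrite subr0 => h.
have -> : quantize m u = u - (u - quantize m u) by rewrite subKr.
by rewrite (le_trans (ler_normB _ _))// mulr2n mulrDl mul1r lerD2l.
Qed.

Lemma quantize_cvg u : (forall e : R, 0 < e -> exists k, `|u - y k| < e) ->
  quantize m u @[m --> \oo] --> u.
Proof.
move=> dy; apply/cvgrPdist_lt => e /dy[k ke]; near=> m.
apply: le_lt_trans ke.
apply: (@le_trans _ _ `|u - quantize k.+1 u|).
  by apply: quantize_dist_ni; near: m; exact: nbhs_infty_gt.
by rewrite quantize_dist ge_min lexx.
Unshelve. all: by end_near. Qed.

(** [quantize] itself jumps, but its distance to u is a minimum of continuous functions; hence its
    cells are Borel. *)
Lemma quantize_dist_continuous m : continuous (fun u => `|u - quantize m u|).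
Proof.
elim: m => [|m IH] /=.
  under eq_fun do rewrite subr0; exact: norm_continuous.
have -> : (fun u => `|u - quantize m.+1 u|) =
    (fun u => Num.min `|u - y m| `|u - quantize m u|).
  by apply/funext => u; exact: quantize_dist.
move=> u; apply: (@continuous_min _ _ (fun u => `|u - y m|) (fun u => `|u - quantize m u|)); last exact: IH.
by apply: cvg_norm; apply: cvgB; [exact: cvg_id|exact: cvg_cst].
Qed.

Lemma quantize_step_open m : open [set u | `|u - y m| < `|u - quantize m u|].
Proof.
have -> : [set u | `|u - y m| < `|u - quantize m u|] =
    (fun u => `|u - y m| - `|u - quantize m u|) @^-1` [set z | z < 0].
  by apply/seteqP; split => u /=; rewrite subr_lt0.
apply: open_comp; last exact: open_lt.
move=> u _; apply: cvgB; last exact: quantize_dist_continuous.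
by apply: cvg_norm; apply: cvgB; [exact: cvg_id|exact: cvg_cst].
Qed.

End Quantize.

Lemma separable_seq (R : realType) (Y : hilbertType R) : separable Y ->
  exists y : nat -> Y, forall u (e : R), 0 < e -> exists k, `|u - y k| < e.
Proof.
move=> [D cD dD].
have dD' (u : Y) (e : R) : 0 < e -> exists2 z, D z & `|u - z| < e.
  move=> e0; have [z [zb Dz]] := dD (ball u e) (ex_intro _ u (ballxx u e0)) (ball_open u e).
  by exists z => //; move: zb; rewrite -ball_normE.
case/pfcard_geP: cD => [D0|[y]].
  by have [z] := dD' 0 1 ltr01; rewrite D0.
exists y => u e /(dD' u) [z Dz ze].
by have [k _ kz] := @surj _ _ _ _ y z Dz; exists k; rewrite kz.
Qed.

(** * Measurability of inner products of vector-valued maps *)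

Section MeasurableDot.
Context d {T : measurableType d} {R : realType} {Y : hilbertType R} (sepY : separable Y).

Lemma measurable_dot_cst (F : T -> borel Y) (y : Y) : measurable_fun [set: T] F ->
  measurable_fun [set: T] (fun x => dot (F x : Y) y).
Proof.
move=> mF; apply: (measurableT_comp (f := fun u : borel Y => dot (u : Y) y)) mF.
apply: continuous_borel_measurable => u.
rewrite (_ : dot^~ y = dot y); first exact: dot_continuous.
by apply/funext => z; rewrite dotC.
Qed.

Lemma measurable_norm_borel (F : T -> borel Y) : measurable_fun [set: T] F ->
  measurable_fun [set: T] (fun x => `|F x : Y|).
Proof.
move=> mF; apply: (measurableT_comp (f := fun u : borel Y => `|u : Y|)) mF.
apply: continuous_borel_measurable; exact: norm_continuous.
Qed.

Lemma measurable_dot_quantize (y : nat -> Y) m (D : T -> Y) (U : T -> borel Y) :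
  (forall z, measurable_fun [set: T] (fun x => dot (D x) z)) -> measurable_fun [set: T] U ->
  measurable_fun [set: T] (fun x => dot (D x) (quantize y m (U x))).
Proof.
move=> mD mU; elim: m => [|m IH] /=.
  exact: mD.
under eq_fun do rewrite [dot _ (if _ then _ else _)]fun_if.
apply: measurable_fun_ifT => //.
apply: (measurable_fun_bool true).
rewrite setTI.
rewrite [X in measurable X](_ : _ = [set: T] `&` U @^-1` [set u | `|u - y m| < `|u - quantize y m u|]).
  by apply: mU => //; apply: sub_sigma_algebra; exact: quantize_step_open.
by rewrite setTI; apply/seteqP; split => x.
Qed.

(** Quantizing U leaves inner products with constant vectors on measurable cells, and these converge
    pointwise because Y is separable. *)
Lemma measurable_dot (F U : T -> borel Y) :
  measurable_fun [set: T] F -> measurable_fun [set: T] U ->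
  measurable_fun [set: T] (fun x => dot (F x : Y) (U x)).
Proof.
move=> mF mU; have [y dy] := separable_seq sepY.
apply: (measurable_fun_cvg (h := fun m x => dot (F x : Y) (quantize y m (U x)))).
- by move=> m; apply: measurable_dot_quantize => // z; exact: measurable_dot_cst.
- move=> x _; apply: (cvg_comp (fun m => quantize y m (U x)) (dot (F x : Y))).
    by apply: quantize_cvg => e; exact: dy.
  exact: dot_continuous.
Qed.

(** Expanding the square reduces the claim to scalar maps, in place of the measurability of the
    difference F - U. *)
Lemma measurable_norm_sub (F U : T -> borel Y) :
  measurable_fun [set: T] F -> measurable_fun [set: T] U ->
  measurable_fun [set: T] (fun x => `|(F x : Y) - U x| ^+ 2).
Proof.
move=> mF mU.
under eq_fun do rewrite normB_sqr.
apply: measurable_funD; last by apply: measurable_funX; exact: measurable_norm_borel.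
apply: measurable_funB; first by apply: measurable_funX; exact: measurable_norm_borel.
by apply: measurable_funM => //; exact: measurable_dot.
Qed.

End MeasurableDot.

Lemma integral_add_null d (T : measurableType d) (R : realType)
    (mu : {measure set T -> \bar R}) (A : set T) (f g : T -> R) (c : R) :
  measurable A -> mu.-integrable A (EFin \o f) -> mu.-integrable A (EFin \o g) ->
  (\int[mu]_(x in A) (g x)%:E = 0)%E ->
  mu.-integrable A (EFin \o (fun x => f x + c * g x)) /\
  (\int[mu]_(x in A) (f x + c * g x)%:E = \int[mu]_(x in A) (f x)%:E)%E.
Proof.
move=> mA intf intg g0.
have intcg : mu.-integrable A (EFin \o (fun x => c * g x)) by exact: (integrableZl mA c intg).
split; first exact: (integrableD mA intf intcg).
under eq_integral do rewrite EFinD.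
rewrite (integralD_EFin mA intf intcg).
suff -> : (\int[mu]_(x in A) (EFin \o (fun x => c * g x)%R) x = 0)%E by rewrite adde0.
by have := integralZl mA intg c; rewrite g0 mule0.
Qed.

Section CondExp.
Context {R : realType} {X Y : hilbertType R} (sepY : separable Y)
  (gamma : probability (borel X) R) (G : set (set X)) (F EF : X -> Y).
Hypotheses (sG : sigma_algebra setT G)
  (mG : forall A, G A -> measurable (A : set (borel X)))
  (mF : measurable_fun [set: borel X] (F : borel X -> borel Y))
  (iF : (\int[gamma]_x (`|F x|)%:E < +oo)%E)
  (condexpF : is_condexp gamma G F EF).

Let GI A B : G A -> G B -> G (A `&` B).
Proof.
have E : <<s G >> = G by exact: sigma_algebra_id.
move=> GA GB; rewrite -E; apply: (@measurableI _ (g_sigma_algebraType G)).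
  by rewrite -E in GA.
by rewrite -E in GB.
Qed.

Let GC A : G A -> G (~` A).
Proof. by case: sG => _ + _ GA => /(_ _ GA); rewrite setTD. Qed.

Let mGfun (U : X -> Y) : (forall B : set (borel Y), measurable B -> G (U @^-1` B)) ->
  measurable_fun [set: borel X] (U : borel X -> borel Y).
Proof. by move=> GU _ B mB; rewrite setTI; apply: mG; exact: GU. Qed.

Let mEF : measurable_fun [set: borel X] (EF : borel X -> borel Y).
Proof. by case: condexpF => GEF _ _; exact: mGfun. Qed.

Let D x := F x - EF x.

Let mD z : measurable_fun [set: borel X] (fun x : borel X => dot (D x) z).
Proof.
under eq_fun do rewrite /D dotBl.
by apply: measurable_funB; exact: measurable_dot_cst.
Qed.

Let iFEF : gamma.-integrable [set: borel X]
  (EFin \o (fun x => `|F x| + `|EF x|)).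
Proof.
apply: (@integrableD _ _ _ gamma setT measurableT (fun x => (`|F x|)%:E) (fun x => (`|EF x|)%:E)).
  apply/integrableP; split.
    by apply/measurable_EFinP; exact: measurable_norm_borel.
  by under eq_integral do rewrite abse_EFin normr_id.
apply/integrableP; split.
  by apply/measurable_EFinP; exact: measurable_norm_borel.
by under eq_integral do rewrite abse_EFin normr_id; case: condexpF.
Qed.

Let dotD_le x z : `|dot (D x) z| <= `|z| * (`|F x| + `|EF x|).
Proof.
rewrite (le_trans (CauchySchwarz _ _))// mulrC ler_wpM2l//.
exact: ler_normB.
Qed.

Let D_cst A z : G A -> (\int[gamma]_(x in A) (dot (D x) z)%:E = 0)%E.
Proof.
move=> GA; have [_ iEF /(_ A GA z) E] := condexpF.
have int (f : X -> Y) : measurable_fun [set: borel X] (f : borel X -> borel Y) ->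
    (\int[gamma]_x (`|f x|)%:E < +oo)%E ->
    gamma.-integrable (A : set (borel X)) (EFin \o (fun x => dot (f x) z)).
  move=> mf fo; apply: (@integrableS _ _ _ gamma setT) => //; first exact: mG.
  apply: (@le_integrable _ (borel X) R gamma setT measurableT _
    (fun x : borel X => (`|z|%:E * (`|f x|)%:E)%E)).
  - by apply/measurable_EFinP; exact: measurable_dot_cst.
  - move=> x _ /=; rewrite lee_fin [leRHS]ger0_norm ?mulr_ge0//.
    by rewrite mulrC CauchySchwarz.
  - apply: integrableZl => //; apply/integrableP; split.
      by apply/measurable_EFinP; exact: measurable_norm_borel.
    by under eq_integral do rewrite abse_EFin normr_id.
under eq_integral do rewrite /D dotBl EFinB.
have iFA := int F mF iF; have iEFA := int EF mEF iEF.
rewrite (integralB_EFin (mG GA) iFA iEFA) E subee//.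
exact: (integrable_fin_num (mG GA) iFA).
Qed.

Section Orthogonal.
Context (U : X -> Y).
Hypothesis GU : forall B : set (borel Y), measurable B -> G (U @^-1` B).

(** The quantized vector is constant on each cell, and the cells belong to G because U is
    G-measurable. Quantifying over all A in G lets the induction cut A along them. *)
Let D_quantize (y : nat -> Y) m A : G A ->
  (\int[gamma]_(x in A) (dot (D x) (quantize y m (U x)))%:E = 0)%E.
Proof.
elim: m A => [|m IH] A GA; first exact: D_cst.
pose S := U @^-1` [set u | `|u - y m| < `|u - quantize y m u|].
have GS : G S by apply: GU; apply: sub_sigma_algebra; exact: quantize_step_open.
have GAS : G (A `&` S) by exact: GI.
have GAD : G (A `\` S) by rewrite setDE; apply: GI => //; exact: GC.
rewrite -(setUIDK A S) integral_setU; first last.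
- by rewrite disj_set2E; apply/eqP; rewrite setDE setIACA setICr setI0.
- apply: (measurable_funS measurableT) => //; apply/measurable_EFinP.
  by apply: measurable_dot_quantize => //; exact: mGfun.
- exact: mG.
- exact: mG.
rewrite (eq_integral (fun x : borel X => (dot (D x) (y m))%:E)); last first.
  by move=> x; rewrite inE /= => -[_]; rewrite /S/= => ->.
rewrite D_cst// add0e -(IH _ GAD); apply: eq_integral => x.
by rewrite inE /= => -[_ /negP/negbTE]; rewrite /S/= => ->.
Qed.

(** Dominated convergence along the quantizations of U. The bound on U is required on A alone, which
    allows U = EF on a set where EF is bounded. *)
Lemma condexp_orthogonal A K : G A -> (forall x, A x -> `|U x| <= K) ->
  gamma.-integrable (A : set (borel X)) (EFin \o (fun x => dot (F x - EF x) (U x))) /\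
  (\int[gamma]_(x in A) (dot (F x - EF x) (U x))%:E = 0)%E.
Proof.
move=> GA UK; have [y dy] := separable_seq sepY.
have mA := mG GA.
have mU := mGfun GU.
have mDq m : measurable_fun (A : set (borel X))
    (fun x => (dot (D x) (quantize y m (U x)))%:E).
  apply: (measurable_funS measurableT) => //; apply/measurable_EFinP.
  exact: measurable_dot_quantize.
have mDU : measurable_fun (A : set (borel X)) (fun x => (dot (D x) (U x))%:E).
  apply: (measurable_funS measurableT) => //; apply/measurable_EFinP.
  under eq_fun do rewrite /D dotBl.
  by apply: measurable_funB; exact: measurable_dot.
have cvgDq : {ae gamma, forall x, A x ->
    (fun m => (dot (D x) (quantize y m (U x)))%:E) @ \oo --> (dot (D x) (U x))%:E}.
  apply: aeW => x _; apply: cvg_EFin; first exact: nearW.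
  apply: (cvg_comp (fun m => quantize y m (U x)) (dot (D x))).
    by apply: quantize_cvg => e; exact: dy.
  exact: dot_continuous.
pose g (x : borel X) := ((2 * K)%:E * (`|F x| + `|EF x|)%:E)%E.
have ig : gamma.-integrable (A : set (borel X)) g.
  by apply: integrableZl => //; exact: (@integrableS _ _ _ gamma setT).
have dom : {ae gamma, forall x m, A x -> (`|(dot (D x) (quantize y m (U x)))%:E| <= g x)%E}.
  apply: aeW => x m Ax; rewrite abse_EFin lee_fin (le_trans (dotD_le _ _))//.
  rewrite ler_wpM2r ?addr_ge0// (le_trans (quantize_norm _ _ _))//.
  by rewrite ler_wpM2l// UK.
have [h1 _ h2] := dominated_convergence mA mDq mDU cvgDq ig dom.
split; first exact: h1.
rewrite -(cvg_lim _ h2)//.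
under [X in lim (X @ _)]eq_fun do rewrite D_quantize//.
exact: lim_cst.
Qed.

End Orthogonal.

(* As EF is not assumed square integrable, the expansion of |F - H|^2 is first
   integrated over the sets |EF| <= k. *)
Lemma condexp_le (H : X -> Y) K :
  (forall B : set (borel Y), measurable B -> G (H @^-1` B)) ->
  (forall x, `|H x| <= K) ->
  (\int[gamma]_x (`|F x - EF x| ^+ 2)%:E <= \int[gamma]_x (`|F x - H x| ^+ 2)%:E)%E.
Proof.
move=> GH HK; have [GEF _ _] := condexpF.
have mH := mGfun GH.
have [->|] := eqVneq (\int[gamma]_x (`|F x - H x| ^+ 2)%:E)%E +oo%E; first exact: leey.
rewrite -ltey => Hoo.
have mn (U : X -> Y) : measurable_fun [set: borel X] (U : borel X -> borel Y) ->
    measurable_fun [set: borel X] (fun x : borel X => (`|F x - U x| ^+ 2)%:E).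
  by move=> mU; apply/measurable_EFinP; exact: measurable_norm_sub.
pose A (k : nat) := [set x | `|EF x| <= k%:R].
have GA k : G (A k).
  apply: (GEF [set u : Y | `|u| <= k%:R]).
  have -> : [set u : Y | `|u| <= k%:R] = (fun u : borel Y => `|u : Y|) @^-1` `]-oo, k%:R].
    by apply/seteqP; split => u /=; rewrite in_itv.
  rewrite -[X in measurable X]setTI.
  by apply: (continuous_borel_measurable (@norm_continuous _ Y)).
have mA k : measurable (A k : set (borel X)) := mG (GA k).
have Ak k : (\int[gamma]_(x in A k) (`|F x - EF x| ^+ 2)%:E <=
    \int[gamma]_x (`|F x - H x| ^+ 2)%:E)%E.
  have [i1 e1] := @condexp_orthogonal EF GEF (A k) k%:R (GA k) (fun x h => h).
  have [i2 e2] := @condexp_orthogonal H GH (A k) K (GA k) (fun x _ => HK x).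
  have i0 : gamma.-integrable (A k : set (borel X)) (EFin \o (fun x => `|F x - H x| ^+ 2)).
    apply: (@integrableS _ _ _ gamma setT) => //; apply/integrableP; split; first exact: mn.
    by under eq_integral do rewrite abse_EFin ger0_norm ?sqr_ge0//.
  (* With D = F - EF, the null terms - 2 <D, EF> and 2 <D, H> cancel the cross term of |F - H|^2 =
     |D + (EF - H)|^2 and leave |D|^2 + |EF - H|^2. *)
  have [j1 f1] := integral_add_null (- 2) (mA k) i0 i1 e1.
  have [j2 f2] := integral_add_null 2 (mA k) j1 i2 e2.
  apply: (@le_trans _ _ (\int[gamma]_(x in A k) (`|F x - H x| ^+ 2)%:E)%E).
    rewrite -f1 -f2; apply: ge0_le_integral => //.
    - by apply: (measurable_funS measurableT) => //; exact: mn.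
    - by have /integrableP[] := j2.
    - move=> x _; rewrite lee_fin.
      have -> : F x - H x = (F x - EF x) + (EF x - H x) by rewrite addrA subrK.
      rewrite (normD_sqr (F x - EF x)) (dotBr (F x - EF x)).
      by have := sqr_ge0 `|EF x - H x|; lra.
  by apply: ge0_subset_integral => //; exact: mn.
have := @ge0_nondecreasing_set_cvg_integral _ (borel X) R A
  (fun x : borel X => (`|F x - EF x| ^+ 2)%:E) gamma.
have -> : \bigcup_k A k = setT.
  apply/seteqP; split => // x _; exists (Num.truncn `|EF x|).+1 => //=.
  exact/ltW/truncnS_gt.
have nA : nondecreasing_seq (A : nat -> set (borel X)).
  by move=> m n mn'; apply/subsetPset => x /= /le_trans; apply; rewrite ler_nat.
move=> /(_ nA mA) h.
have {}h : (\int[gamma]_(x in A k) (`|F x - EF x| ^+ 2)%:E)%E @[k --> \oo] -->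
    (\int[gamma]_x (`|F x - EF x| ^+ 2)%:E)%E.
  apply: h => [k|k x _]; last by rewrite lee_fin sqr_ge0.
  exact: (measurable_funS measurableT (@subsetT _ _) (mn _ mEF)).
rewrite -(cvg_lim _ h)//; apply: lime_le; first by apply/cvg_ex; eexists; exact: h.
exact: nearW.
Qed.

End CondExp.

Lemma cvg_sum_ord (R : realType) (V : normedModType R) n (F : 'I_n -> nat -> V) (l : 'I_n -> V) :
  (forall i, F i J @[J --> \oo] --> l i) ->
  (\sum_(i < n) F i J) @[J --> \oo] --> \sum_(i < n) l i.
Proof. by move=> h; apply: cvg_big => [|i _]; [exact: add_continuous|exact: h]. Qed.

(** * Hilbert-Schmidt norms *)

Section HilbertSchmidtBasis.
Context {R : realType} {X Y : hilbertType R} (A : {linear X -> Y}) (g : nat -> X).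
Hypotheses (cA : continuous A) (onb_g : orthonormal_basis setT dot g).

Lemma onb_expansion b :
  (\sum_(0 <= j < J) dot (g j) b *: A (g j)) @[J --> \oo] --> A b.
Proof.
have [_ gg cg] := onb_g.
have -> : (fun J => \sum_(0 <= j < J) dot (g j) b *: A (g j)) =
    A \o (fun J => \sum_(j < J) dot (g j) b *: g j).
  apply/funext => J /=; rewrite raddf_sum big_mkord.
  by apply: eq_bigr => j _; rewrite [RHS]linearZ.
apply: (cvg_comp (fun J => \sum_(j < J) dot (g j) b *: g j) A); last exact: cA.
apply/cvgrPdist_lt => e e0.
have /cvgrPdist_lt/(_ (e ^+ 2)) := cg b I.
rewrite exprn_gt0// => /(_ isT); apply: filterS => J /=.
rewrite sub0r normrN dotxx ger0_norm ?sqr_ge0//.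
by rewrite ltr_pXn2r ?nnegrE ?normr_ge0// ltW.
Qed.

(* Duality: with w_i = A (f i), the truncated sum of |w_i|^2 is the limit of
   the sums over j of <A (g j), sum_i <g j, f i> w_i>, and the right-hand vectors
   have total squared norm sum_i |w_i|^2 by Parseval. *)
Lemma onb_sum_sqr_le n (f : 'I_n -> X) (B : R) :
  (forall i j, dot (f i) (f j) = (i == j)%:R) ->
  (forall J, \sum_(0 <= j < J) `|A (g j)| ^+ 2 <= B) ->
  \sum_i `|A (f i)| ^+ 2 <= B.
Proof.
move=> ff AB; pose w i := A (f i).
pose P J := \sum_(i < n) dot (w i) (\sum_(0 <= j < J) dot (g j) (f i) *: A (g j)).
pose Q J := \sum_(i < n) \sum_(k < n) dot (w i) (w k) *
  \sum_(0 <= j < J) dot (g j) (f i) * dot (g j) (f k).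
have cP : P J @[J --> \oo] --> \sum_i `|w i| ^+ 2.
  apply: cvg_sum_ord => i; rewrite -dotxx.
  apply: (cvg_comp (fun J => \sum_(0 <= j < J) dot (g j) (f i) *: A (g j)) (dot (w i))).
    exact: onb_expansion.
  exact: dot_continuous.
have cQ : Q J @[J --> \oo] --> \sum_i `|w i| ^+ 2.
  have -> : \sum_i `|w i| ^+ 2 = \sum_(i < n) \sum_(k < n) dot (w i) (w k) * dot (f i) (f k).
    apply: eq_bigr => i _; rewrite (bigD1 i)//= ff eqxx mulr1 dotxx big1 ?addr0// => k ki.
    by rewrite ff eq_sym (negbTE ki) mulr0.
  apply: cvg_sum_ord => i; apply: cvg_sum_ord => k.
  by apply: cvgM; [exact: cvg_cst|exact: parseval_dot].
have PQ J : 2 * P J <= B + Q J.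
  have -> : P J = \sum_(0 <= j < J) dot (A (g j)) (\sum_(i < n) dot (g j) (f i) *: w i).
    rewrite /P; under eq_bigr do rewrite dot_sumr.
    rewrite exchange_big/=; apply: eq_bigr => j _; rewrite dot_sumr.
    by apply: eq_bigr => i _; rewrite !dotZr (dotC (A (g j))).
  have -> : Q J = \sum_(0 <= j < J) `|\sum_(i < n) dot (g j) (f i) *: w i| ^+ 2.
    rewrite /Q; under eq_bigr do under eq_bigr do rewrite mulr_sumr.
    under eq_bigr do rewrite exchange_big/=.
    rewrite exchange_big/=; apply: eq_bigr => j _; rewrite -dotxx dot_suml.
    apply: eq_bigr => i _; rewrite dot_sumr; apply: eq_bigr => k _.
    by rewrite dotZl dotZr; ring.
  rewrite (le_trans _ (lerD (AB J) (lexx _)))// -big_split/= mulr_sumr.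
  by apply: ler_sum => j _; exact: dot_young.
have h : (B + Q J - 2 * P J) @[J --> \oo] -->
    B + (\sum_i `|w i| ^+ 2) - 2 * (\sum_i `|w i| ^+ 2).
  apply: cvgB; first by apply: cvgD => //; exact: cvg_cst.
  by apply: cvgM => //; exact: cvg_cst.
have : 0 <= B + (\sum_i `|w i| ^+ 2) - 2 * (\sum_i `|w i| ^+ 2).
  rewrite -(cvg_lim _ h)//; apply: limr_ge; first by apply/cvg_ex; eexists; exact: h.
  by apply: nearW => J; rewrite subr_ge0.
by rewrite /w; move: (\sum_i _) => s; lra.
Qed.

End HilbertSchmidtBasis.

Section CameronMartinHS.
Context {R : realType} {X Y : hilbertType R} (C : X -> X) (v : nat -> X).
Hypotheses (injC : injective C)
  (onb_v : orthonormal_basis (cameron_martin C) (cm_dot C) v).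
Local Notation S := (sqrt_operator C).
Local Notation CM := (cameron_martin C).
Local Notation e := (cm_basis C).

(** The basis v witnesses that a basis exists, which rules out the default value of [xget]. *)
Lemma cm_basisP : orthonormal_basis CM (cm_dot C) e.
Proof.
by rewrite /cm_basis; case: xgetP => [b //|/(_ v)]; case.
Qed.

(** T is meaningful on the Cameron-Martin space only; composing with the isometry S gives an
    operator on all of X. *)
Lemma cm_linear_comp (T : X -> Y) : cm_linear C T -> linear (T \o S).
Proof.
move=> linT a u w /=; rewrite -linT; [|by exists u|by exists w].
by rewrite (sqrt_operatorD onb_v) (sqrt_operatorZ onb_v).
Qed.

Lemma cm_continuous_comp (T : X -> Y) : cm_linear C T -> cm_bounded C T ->
  continuous (T \o S).
Proof.
move=> linT [M MT].
pose L : {linear X -> Y} := HB.pack (T \o S)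
  (GRing.isLinear.Build _ _ _ _ (T \o S) (cm_linear_comp linT)).
suff : continuous L by [].
apply/bounded_linear_continuous/linear_boundedP.
exists M; split; first exact: num_real.
move=> k /ltW Mk x; have /le_trans -> // := MT (S x) (ex_intro2 _ _ x I erefl).
by rewrite /cm_norm (cm_dotE injC onb_v) dotxx sqrtr_sqr normr_id ler_wpM2r.
Qed.

(** [hs_norm2] refers to one chosen basis. This bound transfers it to any orthonormal family, in
    particular to v. *)
Lemma hs_sum_sqr_le (T : X -> Y) n (f : 'I_n -> X) : linear (T \o S) -> continuous (T \o S) ->
  (forall i, CM (f i)) -> (forall i j, cm_dot C (f i) (f j) = (i == j)%:R) ->
  (\sum_i (`|T (f i)| ^+ 2)%:E <= hs_norm2 C T)%E.
Proof.
move=> linT cT CMf ff.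
have [->|] := eqVneq (hs_norm2 C T) +oo%E; first exact: leey.
have h0 : (0 <= hs_norm2 C T)%E by apply: nneseries_ge0 => i _ _; rewrite lee_fin sqr_ge0.
rewrite -ltey -ge0_fin_numE// => hfin; rewrite -(fineK hfin) sumEFin lee_fin.
pose L : {linear X -> Y} := HB.pack (T \o S) (GRing.isLinear.Build _ _ _ _ (T \o S) linT).
have Sf i : S (inv_operator S (f i)) = f i by apply: range_inv_operatorK; exact: CMf.
have Se i : S (inv_operator S (e i)) = e i by apply: range_inv_operatorK; have [+ _ _] := cm_basisP; exact.
have -> : \sum_i `|T (f i)| ^+ 2 = \sum_i `|L (inv_operator S (f i))| ^+ 2.
  by apply: eq_bigr => i _; rewrite /L/= Sf.
apply: (@onb_sum_sqr_le _ _ _ L _ cT (onb_pullback injC cm_basisP)) => [i j|J].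
  exact: ff.
rewrite -lee_fin (fineK hfin) -sumEFin.
under eq_bigr do rewrite /L/= Se.
by apply: nneseries_lim_ge => i _ _; rewrite lee_fin sqr_ge0.
Qed.

(** The previous bound for the one-vector family h / |h|. *)
Lemma hs_eval_le (T : X -> Y) h : linear (T \o S) -> continuous (T \o S) -> CM h ->
  ((`|T h| ^+ 2)%:E <= hs_norm2 C T * (cm_dot C h h)%:E)%E.
Proof.
move=> linT cT [u _ <-]; rewrite (cm_dotE injC onb_v) dotxx.
pose L : {linear X -> Y} := HB.pack (T \o S) (GRing.isLinear.Build _ _ _ _ (T \o S) linT).
have [->|u0] := eqVneq u 0.
  have -> : T (S 0) = 0 by exact: (linear0 L).
  by rewrite !normr0 expr0n/= mule0.
have nu : 0 < `|u| by rewrite normr_gt0.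
have := @hs_sum_sqr_le T 1 (fun=> S (`|u|^-1 *: u)) linT cT
  (fun=> ex_intro2 _ _ _ I erefl).
rewrite big_ord1 => /(_ _)/le_trans; rewrite -lee_pdivrMr ?exprn_gt0//.
have -> : T (S (`|u|^-1 *: u)) = `|u|^-1 *: T (S u) by exact: (@linearZ_LR _ _ _ _ L).
rewrite normrZ normfV normr_id exprMn exprVn mulrC EFinM; apply; last exact: lexx.
move=> i j; rewrite !ord1 eqxx (cm_dotE injC onb_v) dotZl dotZr dotxx mulrA -invfM -expr2 mulVf//.
by rewrite expf_neq0// lt0r_neq0.
Qed.

Lemma hs_nneseries_le (T : X -> Y) : linear (T \o S) -> continuous (T \o S) ->
  (\sum_(0 <= i <oo) (`|T (v i)| ^+ 2)%:E <= hs_norm2 C T)%E.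
Proof.
move=> linT cT; have [CMv vv _] := onb_v; apply: lime_le.
  by apply: is_cvg_nneseries => i _ _; rewrite lee_fin sqr_ge0.
apply: nearW => n; rewrite big_mkord.
by apply: (@hs_sum_sqr_le T n (fun i => v i)) => // i j; rewrite vv.
Qed.

Hypothesis range_v : forall i, range C (v i).
Variable r : nat.

Lemma encoder_proj_CM u : encoder_proj C v r (S u) =
  S (\sum_(i < r) dot (inv_operator S (v i)) u *: inv_operator S (v i)).
Proof.
rewrite (sqrt_operator_sum onb_v); apply: eq_bigr => i _; rewrite mxE.
rewrite (dot_inv_covariance injC onb_v range_v); last by exists u.
rewrite (sqrt_operatorZ onb_v) (cm_basisK onb_v); congr (_ *: _).
by rewrite -[in LHS](cm_basisK onb_v i) (cm_dotE injC onb_v).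
Qed.

Lemma encoder_proj_basis i : encoder_proj C v r (v i) = if (i < r)%N then v i else 0.
Proof.
rewrite /encoder_proj/decoder.
under eq_bigr do rewrite mxE (dot_inv_covariance_basis injC onb_v range_v).
case: ltnP => ir.
  rewrite (bigD1 (Ordinal ir))//= eqxx scale1r big1 ?addr0// => j ji.
  case: eqP => [E|]; last by rewrite scale0r.
  by move: ji; rewrite -val_eqE/= E eqxx.
rewrite big1// => j _; rewrite (_ : (_ == _) = false) ?scale0r//.
by apply/negbTE; rewrite neq_ltn (leq_trans (ltn_ord j) ir).
Qed.

(** The composite of T with I - Q_r kills [v i] for i < r and agrees with T on the other basis
    vectors, so [hs_nneseries_le] applies to it. *)
Lemma hs_tail_le (T : X -> Y) : linear (T \o S) -> continuous (T \o S) ->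
  (\sum_(r <= i <oo) (`|T (v i)| ^+ 2)%:E
   <= hs_norm2 C (fun h => T (h - encoder_proj C v r h)%R))%E.
Proof.
move=> linT cT.
pose f i := inv_operator S (v i).
pose P u := u - \sum_(i < r) dot (f i) u *: f i.
(* Through S, the map I - Q_r becomes the orthogonal projection P of X, whose linearity and
   continuity are plain. *)
have E : (fun h => T (h - encoder_proj C v r h)) \o S = (T \o S) \o P.
  by apply/funext => u /=; rewrite encoder_proj_CM -(sqrt_operatorB onb_v).
have linP : linear P.
  move=> a u w; rewrite /P scalerBr addrACA -opprD; congr (_ - _).
  rewrite scaler_sumr -big_split/=.
  by apply: eq_bigr => i _; rewrite dotDr dotZr scalerDl scalerA.
have cP : continuous P.
  move=> u; apply: cvgB; first exact: cvg_id.
  apply: cvg_big => [|i _]; first exact: add_continuous.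
  by apply: cvgZr_tmp; exact: dot_continuous.
apply: (le_trans _ (hs_nneseries_le _ _)); first last.
- by rewrite E => u; apply: (cvg_comp P (T \o S)); [exact: cP|exact: cT].
- by rewrite E => a u w; rewrite /= linP; exact: linT.
pose T' i := (`|T (v i - encoder_proj C v r (v i))%R| ^+ 2)%:E.
have T'0 i : (0 <= T' i)%E by rewrite lee_fin sqr_ge0.
rewrite [leRHS](@nneseries_split _ T' 0%N r)//.
apply: (@le_trans _ _ (\sum_(0 + r <= k <oo) T' k)%E); last first.
  by rewrite leeDr// sume_ge0.
rewrite add0n.
rewrite le_eqVlt; apply/orP; left; apply/eqP; apply/congr_lim/funext => n.
apply: eq_big_nat => i /andP[ri _].
by rewrite /T' encoder_proj_basis ltnNge ri subr0.
Qed.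

End CameronMartinHS.

(** * Measurability of directional derivatives *)

Section HSMeasurable.
Context {R : realType} {X Y : hilbertType R} (C : X -> X) (v : nat -> X).
Hypotheses (injC : injective C)
  (onb_v : orthonormal_basis (cameron_martin C) (cm_dot C) v).
Local Notation S := (sqrt_operator C).
Local Notation CM := (cameron_martin C).

Lemma cm_linearB (T T' : X -> Y) : cm_linear C T -> cm_linear C T' ->
  cm_linear C (fun h => T h - T' h).
Proof.
move=> l l' a u w CMu CMw; rewrite l// l'// scalerBr.
by rewrite opprD addrACA.
Qed.

Lemma cm_boundedB (T T' : X -> Y) : cm_bounded C T -> cm_bounded C T' ->
  cm_bounded C (fun h => T h - T' h).
Proof.
move=> [M b] [M' b']; exists (M + M') => u CMu.
by rewrite (le_trans (ler_normB _ _))// mulrDl lerD ?b ?b'.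
Qed.

(** Evaluation at h is continuous for the Hilbert-Schmidt norm by [hs_eval_le], so the operators
    that send h into an open set form an [hs_open] set. *)
Lemma hs_measurable_eval (G : X -> X -> Y) h : hs_measurable C G -> CM h ->
  measurable_fun [set: borel X] ((fun x => G x h) : borel X -> borel Y).
Proof.
move=> [hsG mG] CMh.
apply: (@measurability _ _ (borel X) (borel Y) setT _ (@open Y)) => //.
move=> _ [B oB <-]; rewrite setTI.
apply: (mG [set T | B (T h)]) => T [linT bT _] BT.
have [d /= d0 dB] := (nbhs_ballP _ _).1 (open_nbhs_nbhs (conj oB BT)).
pose q := cm_dot C h h.
have q0 : 0 <= q by case: CMh => u _ Eu; rewrite /q -Eu (cm_dotE injC onb_v) dotxx sqr_ge0.
exists (d / (Num.sqrt q + 1)) => [|T' [linT' bT' _] TT'].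
  by rewrite divr_gt0// ltr_wpDl// sqrtr_ge0.
apply: dB; rewrite -ball_normE/= distrC.
have lB := cm_linearB linT' linT; have bB := cm_boundedB bT' bT.
have := hs_eval_le injC onb_v (cm_linear_comp onb_v lB) (cm_continuous_comp injC onb_v lB bB) CMh.
rewrite -/q => TqT.
have : ((`|T' h - T h| ^+ 2)%:E <= ((d / (Num.sqrt q + 1)) ^+ 2 * q)%:E)%E.
  apply: (le_trans TqT); rewrite EFinM; apply: lee_wpmul2r; first by rewrite lee_fin.
  exact: ltW.
rewrite lee_fin -[X in _ * X](sqr_sqrtr q0) -exprMn.
have sq0 := sqrtr_ge0 q.
have nn : 0 <= d / (Num.sqrt q + 1) * Num.sqrt q.
  by rewrite mulr_ge0// divr_ge0 ?ltW// ltr_wpDl.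
rewrite ler_pXn2r ?nnegrE// => /le_lt_trans; apply.
by rewrite mulrAC ltr_pdivrMr ?ltr_wpDl// ltr_pM2l// ltrDl.
Qed.

End HSMeasurable.

(** The integral of a nonnegative function is a supremum over the simple functions below it, whence
    monotonicity for arbitrary integrands such as those built on [hs_norm2]. *)
Lemma le_integral_nonneg d (T : measurableType d) (R : realType)
    (mu : {measure set T -> \bar R}) (f g : T -> \bar R) :
  (forall x, (0 <= f x)%E) -> (forall x, (f x <= g x)%E) ->
  (\int[mu]_x f x <= \int[mu]_x g x)%E.
Proof.
move=> f0 fg; rewrite !ge0_integralTE//; last by move=> x; exact: le_trans (fg x).
apply: le_ereal_sup => _ [h hf <-]; exists h => //= x.
exact: le_trans (fg x).
Qed.

(** * The inequality in the Sobolev space *)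

Section SquareIntegrals.
Context d {T : measurableType d} {R : realType} {Y : hilbertType R} (P : probability T R).

Lemma integral_norm_mulD (a : R) (U V W : T -> Y) : 0 < a ->
  (forall x, W x = U x + V x) ->
  measurable_fun [set: T] (fun x => `|U x| ^+ 2) ->
  measurable_fun [set: T] (fun x => `|V x| ^+ 2) ->
  (\int[P]_x (`|W x| ^+ 2)%:E <= (1 + a)%:E * \int[P]_x (`|U x| ^+ 2)%:E
     + (1 + a^-1)%:E * \int[P]_x (`|V x| ^+ 2)%:E)%E.
Proof.
move=> a0 WE mU mV.
have a1 : 0 <= 1 + a by rewrite addr_ge0// ltW.
have a2 : 0 <= 1 + a^-1 by rewrite addr_ge0// invr_ge0 ltW.
have int (b : R) (f : T -> R) : 0 <= b -> measurable_fun [set: T] f -> (forall x, 0 <= f x) ->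
    (b%:E * \int[P]_x (f x)%:E = \int[P]_x (b * f x)%:E)%E.
  move=> b0 mf f0; rewrite -ge0_integralZl//.
  - by apply/measurable_EFinP.
  - by move=> x _; rewrite lee_fin.
rewrite !int//; try by move=> x; rewrite sqr_ge0.
rewrite -ge0_integralD//.
- apply: le_integral_nonneg => x; first by rewrite lee_fin sqr_ge0.
  by rewrite lee_fin WE; exact: le_norm_mulD.
- by move=> x _; rewrite lee_fin mulr_ge0// sqr_ge0.
- by apply/measurable_EFinP; exact: measurable_funM.
- by move=> x _; rewrite lee_fin mulr_ge0// sqr_ge0.
- by apply/measurable_EFinP; exact: measurable_funM.
Qed.

Lemma sum_integral_le (N : nat) (f : nat -> T -> R) (g : T -> \bar R) :
  (forall i, measurable_fun [set: T] (f i)) -> (forall i x, 0 <= f i x) ->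
  (forall x, (\sum_(N <= i <oo) (f i x)%:E <= g x)%E) ->
  (\sum_(N <= i <oo) \int[P]_x (f i x)%:E <= \int[P]_x g x)%E.
Proof.
move=> mf f0 fg; apply: lime_le.
  by apply: is_cvg_nneseries => i _ _; apply: integral_ge0 => x _; rewrite lee_fin.
apply: nearW => n; rewrite -ge0_integral_sum//; last 2 first.
- by move=> i; apply/measurable_EFinP.
- by move=> i x _; rewrite lee_fin.
apply: le_integral_nonneg => x; first by rewrite sume_ge0// => i _; rewrite lee_fin.
apply: le_trans (fg x); apply: nneseries_lim_ge => i _ _; rewrite lee_fin; exact: f0.
Qed.

End SquareIntegrals.

Lemma sum_scale_continuous (R : realType) (T : topologicalType) (Y : normedModType R)
    (I : Type) (r : seq I) (f : I -> T -> R) (t : I -> Y) :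
  (forall i, continuous (f i)) -> continuous (fun z => \sum_(i <- r) f i z *: t i).
Proof.
move=> cf z; apply: cvg_big => [|i _]; first exact: add_continuous.
by apply: cvgZr_tmp; exact: cf.
Qed.

(** * Functions of the encoder *)

Section Encoder.
Context {R : realType} {X Y : hilbertType R} (C : X -> X) (v : nat -> X) (r : nat).

Lemma encoder_sigma_algebra : sigma_algebra setT (sigma_encoder C v r).
Proof. by apply: sigma_algebra_preimage; exact: sigma_algebra_measurable. Qed.

Lemma encoder_measurable A : sigma_encoder C v r A -> measurable (A : set (borel X)).
Proof.
move=> [B mB <-].
exact: (continuous_borel_measurable_fun (@dots_continuous _ _ _ (fun i : 'I_r => inv_operator C (v i)))).
Qed.

(** The frequencies are combinations of the C^-1 v_j, so the function is a continuous eta composed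
    with the encoder. *)
Lemma trig_head_encoder (s : seq (Y * X * R)) (B : set (borel Y)) : measurable B ->
  sigma_encoder C v r (trig_poly (trig_head_terms C v r s) @^-1` B).
Proof.
move=> mB.
pose b (u : X) : 'rV[R]_r := \row_(j < r) dot (v j) u.
pose t (k : Y * X * R) := (expR (- (tail_cov C v r k.1.2 k.1.2 / 2)) *: k.1.1 : Y).
pose eta (z : 'rV[R]_r) : Y := \sum_(k <- s) cos (phase (b k.1.2) z + k.2) *: t k.
have ceta : continuous eta.
  have cphase (k : Y * X * R) : continuous (fun z => cos (phase (b k.1.2) z + k.2)).
    apply: (@continuous_compose _ _ _ (fun z => phase (b k.1.2) z + k.2) cos).
      apply: continuous_add; last exact: cst_continuous.
      apply: sum_continuous => j; apply: continuous_mul; first exact: cst_continuous.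
      exact: coord_continuous.
    exact: continuous_cos.
  exact: sum_scale_continuous.
have -> : trig_poly (trig_head_terms C v r s) = eta \o encoder C v r.
  apply/funext => x; rewrite /trig_poly big_map; apply: eq_bigr => k _ /=.
  congr (cos (_ + _) *: _); rewrite /head_part big_mkord.
  rewrite -(dot_dots (fun i : 'I_r => inv_operator C (v i)) (b k.1.2)).
  by congr (dot _ x); apply: eq_bigr => j _; rewrite mxE.
exists (eta @^-1` B); last by rewrite setTI.
rewrite -[X in measurable X]setTI.
exact: (continuous_borel_measurable_fun ceta).
Qed.

End Encoder.

Lemma smooth_cylindrical_diff (R : realType) (X Y : hilbertType R) (F : X -> Y) x :
  smooth_cylindrical F -> continuous ('d F x).
Proof.
move=> [M [n [w [y [phi [hphi FE]]]]]].
have -> : F = fun x => \sum_(i < M) phi i (dots w x) *: y i by apply/funext => z; rewrite FE.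
rewrite diff_cylinder; first exact: cyl_diff_continuous.
  by move=> i z j; have [_ + _] := hphi i [::]; exact.
by move=> i j; have [] := hphi i [:: j].
Qed.

Lemma nneseries_le_lin (R : realType) (N : nat) (a b : R) (f g h : nat -> \bar R) :
  0 <= a -> 0 <= b -> (forall i, 0 <= f i)%E -> (forall i, 0 <= g i)%E ->
  (forall i, 0 <= h i)%E -> (forall i, h i <= a%:E * f i + b%:E * g i)%E ->
  (\sum_(N <= i <oo) h i <= a%:E * (\sum_(N <= i <oo) f i) + b%:E * (\sum_(N <= i <oo) g i))%E.
Proof.
move=> a0 b0 f0 g0 h0 hfg.
rewrite -!nneseriesZl// -nneseriesD; last 2 first.
- by move=> i _ _; rewrite mule_ge0// lee_fin.
- by move=> i _ _; rewrite mule_ge0// lee_fin.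
by apply: lee_nneseries => i // _; exact: hfg.
Qed.

Section Poincare.
Context {R : realType} {X Y : hilbertType R} (sepY : separable Y)
  (C : X -> X) (gamma : probability (borel X) R)
  (gaussian_gamma : centered_gaussian C gamma) (injC : injective C)
  (F : X -> Y) (DF : X -> X -> Y) (H1F : gaussian_H1 C gamma F DF)
  (v : nat -> X)
  (onb_v : orthonormal_basis (cameron_martin C) (cm_dot C) v)
  (range_v : forall i, range C (v i)) (r : nat).

Let mF : measurable_fun [set: borel X] (F : borel X -> borel Y).
Proof. by case: H1F. Qed.

Let mcont (U : X -> Y) : continuous U -> measurable_fun [set: borel X] (U : borel X -> borel Y).
Proof. exact: continuous_borel_measurable_fun. Qed.

Let mdist (U V : X -> Y) : measurable_fun [set: borel X] (U : borel X -> borel Y) ->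
  measurable_fun [set: borel X] (V : borel X -> borel Y) ->
  measurable_fun [set: borel X] (fun x : borel X => `|U x - V x| ^+ 2).
Proof. by move=> mU mV; exact: measurable_norm_sub. Qed.

Let dist (U V : X -> Y) := (\int[gamma]_x (`|U x - V x| ^+ 2)%:E)%E.

Let dist_ge0 U V : (0 <= dist U V)%E.
Proof. by apply: integral_ge0 => x _; rewrite lee_fin sqr_ge0. Qed.

Let dist_tri (a : R) (U V W : X -> Y) : 0 < a ->
  measurable_fun [set: borel X] (U : borel X -> borel Y) ->
  measurable_fun [set: borel X] (V : borel X -> borel Y) ->
  measurable_fun [set: borel X] (W : borel X -> borel Y) ->
  (dist U W <= (1 + a)%:E * dist U V + (1 + a^-1)%:E * dist V W)%E.
Proof.
move=> a0 mU mV mW; apply: (@integral_norm_mulD _ (borel X)) => //.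
- by move=> x; rewrite addrA subrK.
- exact: mdist.
- exact: mdist.
Qed.

Let distC U V : dist U V = dist V U.
Proof. by apply: eq_integral => x _; rewrite distrC. Qed.

Let DFv (i : nat) (x : X) := DF x (v i).

Let mDFv i : measurable_fun [set: borel X] (DFv i : borel X -> borel Y).
Proof.
have [_ hDF _] := H1F; have [CMv _ _] := onb_v.
exact: (hs_measurable_eval injC onb_v).
Qed.

Let cS : continuous (sqrt_operator C).
Proof. by have [[]] := sqrt_operatorP onb_v. Qed.

(** The intermediate function is a smooth cylindrical one within e of F; the triangle inequality of
    weight 1 doubles both errors, hence 4 e. The gradient error, given in [hs_norm2], bounds the sum
    along v by [hs_nneseries_le]. *)
Lemma H1_trig_approx (e : R) : 0 < e -> exists s : seq (Y * X * R),
  (\int[gamma]_x (`|F x - trig_poly s x| ^+ 2)%:E <= (4 * e)%:E)%E /\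
  (\sum_(0 <= i <oo) \int[gamma]_x (`|trig_diff s x (v i) - DF x (v i)| ^+ 2)%:E
    <= (4 * e)%:E)%E.
Proof.
move=> e0; have [_ [hsDF _] [Fn [smFn cF cDF]]] := H1F.
have [n [Fe De]] : exists n,
    (\int[gamma]_x (`|Fn n x - F x| ^+ 2)%:E <= e%:E)%E /\
    (\int[gamma]_x hs_norm2 C (fun h => ('d (Fn n) x h - DF x h)%R) <= e%:E)%E.
  exact: (filter_ex (filterI (cvge0_near_le e0 cF) (cvge0_near_le e0 cDF))).
have [s [cFn cdFn Gs dGs]] := smooth_cylindrical_trig gamma injC onb_v (smFn n) e0.
exists s.
have cdG i : continuous (fun x => trig_diff s x (v i)).
  by under eq_fun do rewrite trig_diffE; exact: trig_poly_continuous.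
have mG i : measurable_fun [set: borel X] ((fun x => trig_diff s x (v i)) : borel X -> borel Y).
  exact: mcont.
have md i : measurable_fun [set: borel X] ((fun x => 'd (Fn n) x (v i)) : borel X -> borel Y).
  exact: mcont.
have le2 (x y : \bar R) : (x <= e%:E -> y <= e%:E ->
    (1 + 1)%:E * x + (1 + 1^-1)%:E * y <= (4 * e)%:E)%E.
  move=> xe ye.
  have -> : ((4 * e)%:E = (1 + 1)%:E * e%:E + (1 + 1^-1)%:E * e%:E)%E.
    by rewrite -!EFinM -EFinD invr1; congr EFin; ring.
  by apply: leeD; apply: lee_wpmul2l; rewrite ?lee_fin.
split.
  apply: (le_trans (@dist_tri 1 F (Fn n) (trig_poly s) ltr01 mF _ _)).
  - exact: mcont.
  - by apply: mcont; exact: trig_poly_continuous.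
  - by apply: le2 => //; rewrite distC.
pose f i := dist (fun x => 'd (Fn n) x (v i)) (DFv i).
pose g i := dist (fun x => 'd (Fn n) x (v i)) (fun x => trig_diff s x (v i)).
have fe : (\sum_(0 <= i <oo) f i <= e%:E)%E.
  apply: le_trans De; apply: sum_integral_le => [i|i x|x].
  - by apply: mdist; [exact: mcont|exact: mDFv].
  - exact: sqr_ge0.
  - have [linT bT _] := hsDF x.
    pose T h := 'd (Fn n) x h - DF x h.
    apply: (hs_nneseries_le injC onb_v (T := T)).
      apply: (cm_linear_comp onb_v); apply: cm_linearB => // a u w _ _.
      exact: linearP.
    move=> u; apply: cvgB; last exact: (cm_continuous_comp injC onb_v linT bT).
    apply: (cvg_comp (sqrt_operator C) ('d (Fn n) x)); first exact: cS.
    exact: smooth_cylindrical_diff.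
apply: le_trans (le2 _ _ dGs fe).
apply: nneseries_le_lin => [||i|i|i|i].
- by rewrite addr_ge0.
- by rewrite addr_ge0// invr_ge0.
- exact: dist_ge0.
- exact: dist_ge0.
- exact: (dist_ge0 (fun x => trig_diff s x (v i)) (DFv i)).
- have := @dist_tri 1 (fun x => trig_diff s x (v i)) (fun x => 'd (Fn n) x (v i)) (DFv i) ltr01
    (mG i) (md i) (@mDFv i).
  by rewrite [dist _ (fun x => 'd (Fn n) x (v i))]distC.
Qed.

Local Notation Eperp :=
  (\int[gamma]_x hs_norm2 C (fun h => DF x (h - encoder_proj C v r h)%R))%E.

(* a weighs the squares in the triangle inequality, e bounds the error of
   approximating F by a trigonometric polynomial in the Sobolev norm. *)
Lemma poincare_approx (e a : R) : 0 < e -> 0 < a ->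
  exists (s : seq (Y * X * R)),
  (\int[gamma]_x (`|F x - trig_poly s x| ^+ 2)%:E <= (4 * e)%:E)%E /\
  (\int[gamma]_x (`|F x - trig_poly (trig_head_terms C v r s) x| ^+ 2)%:E <=
    (1 + a)%:E * ((1 + a)%:E * Eperp + (1 + a^-1)%:E * (4 * e)%:E)
    + (1 + a^-1)%:E * (4 * e)%:E)%E.
Proof.
move=> e0 a0; have [s [Fs dFs]] := H1_trig_approx e0; exists s; split => //.
have [_ [hsDF _] _] := H1F.
have a1 : 0 <= 1 + a by rewrite addr_ge0// ltW.
have a2 : 0 <= 1 + a^-1 by rewrite addr_ge0// invr_ge0 ltW.
pose G := trig_poly s; pose H := trig_poly (trig_head_terms C v r s).
have mG : measurable_fun [set: borel X] (G : borel X -> borel Y).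
  by apply: mcont; exact: trig_poly_continuous.
have mH : measurable_fun [set: borel X] (H : borel X -> borel Y).
  by apply: mcont; exact: trig_poly_continuous.
rewrite -/(dist F H).
(* The weight 1 / a puts the large factor on the error |F - G|^2, and 1 + a on the main term |G -
   H|^2. *)
have := @dist_tri a^-1 F G H; rewrite invr_gt0 invrK => /(_ a0 mF mG mH)/le_trans; apply.
rewrite addeC; apply: leeD; last by apply: lee_wpmul2l; rewrite ?lee_fin.
apply: lee_wpmul2l; first by rewrite lee_fin.
apply: (le_trans (trig_poincare gaussian_gamma injC onb_v range_v r s)).
pose f i := dist (DFv i) (fun=> 0).
pose g i := dist (fun x => trig_diff s x (v i)) (DFv i).
apply: (@le_trans _ _ ((1 + a)%:E * (\sum_(r <= i <oo) f i)
    + (1 + a^-1)%:E * (\sum_(r <= i <oo) g i))%E).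
  apply: nneseries_le_lin => // [i|i|i|i].
  - exact: dist_ge0.
  - exact: dist_ge0.
  - by apply: integral_ge0 => x _; rewrite lee_fin sqr_ge0.
  - have mi : measurable_fun [set: borel X] ((fun x => trig_diff s x (v i)) : borel X -> borel Y).
      by apply: mcont; under eq_fun do rewrite trig_diffE; exact: trig_poly_continuous.
    have := @dist_tri a^-1 (fun x => trig_diff s x (v i)) (DFv i) (fun=> 0).
    rewrite invr_gt0 invrK => /(_ a0 mi (@mDFv i) (measurable_cst _)).
    by rewrite /dist; under eq_integral do rewrite subr0; rewrite addeC.
apply: leeD; apply: lee_wpmul2l; rewrite ?lee_fin//.
- apply: sum_integral_le => [i|i x|x].
  + by apply: mdist => //; exact: measurable_cst.
  + exact: sqr_ge0.
  + have [linT bT _] := hsDF x.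
    under eq_eseriesr do rewrite subr0.
    apply: (hs_tail_le injC onb_v range_v); first exact: (cm_linear_comp onb_v).
    exact: (cm_continuous_comp injC onb_v).
- apply: le_trans dFs; rewrite [leRHS](@nneseries_split _ _ 0%N r).
    by rewrite add0n leeDr// sume_ge0// => i _; exact: dist_ge0.
  by move=> i _; exact: dist_ge0.
Qed.

End Poincare.

(** |F| <= |F - G| + M and t <= t^2 + 1. *)
Lemma integral_norm_lty (R : realType) (X Y : hilbertType R) (sepY : separable Y)
    (gamma : probability (borel X) R) (F G : X -> Y) (M : R) :
  measurable_fun [set: borel X] (F : borel X -> borel Y) ->
  measurable_fun [set: borel X] (G : borel X -> borel Y) ->
  (forall x, `|G x| <= M) -> (\int[gamma]_x (`|F x - G x| ^+ 2)%:E < +oo)%E ->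
  (\int[gamma]_x (`|F x|)%:E < +oo)%E.
Proof.
move=> mF mG GM FG.
have M0 : 0 <= M by exact: le_trans (GM point).
apply: (@le_lt_trans _ _ (\int[gamma]_x ((`|F x - G x| ^+ 2)%:E + (1 + M)%:E))%E).
  apply: le_integral_nonneg => x; first by rewrite lee_fin.
  rewrite -EFinD lee_fin.
  have := ler_normD (F x - G x) (G x); rewrite subrK.
  have := GM x; have := sqr_ge0 (`|F x - G x| - 1).
  rewrite sqrrB; move: (`|F x - G x|) (`|F x|) (`|G x|) => a b c.
  by move=> h1 h2 h3; nra.
rewrite ge0_integralD//.
- apply: lte_add_pinfty => //; rewrite integral_cst//.
  by rewrite lte_mul_pinfty ?lee_fin ?addr_ge0// -ge0_fin_numE// fin_num_measure.
- by apply/measurable_EFinP; exact: measurable_norm_sub.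
- by move=> x _; rewrite lee_fin addr_ge0.
Qed.

Lemma le_of_approx (R : realType) (l k : \bar R) : (0 <= k)%E ->
  (forall e a : R, (0 < e)%R -> (0 < a)%R -> l <= (1 + a)%:E * ((1 + a)%:E * k + (1 + a^-1)%:E * (4 * e)%:E)
       + (1 + a^-1)%:E * (4 * e)%:E)%E ->
  (l <= k)%E.
Proof.
move=> k0 h; case: k k0 h => [k| |] k0 h; [|exact: leey|by []].
rewrite lee_fin in k0; apply/lee_addgt0Pr => d d0.
(* For a <= 1, (1 + a)^2 k <= k + 3 a k. With e = a^2 / 24 the terms in 1 / a add up to a (a + 1) (a
   + 2) / 6 <= a. The total excess a (3 k + 1) is at most d. *)
pose a := Num.min 1 (d / (3 * k + 1)).
have kp : 0 < 3 * k + 1 by rewrite ltr_wpDl// mulr_ge0.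
have a0 : 0 < a by rewrite lt_min ltr01 divr_gt0.
have a1 : a <= 1 by rewrite ge_min lexx.
have ak : a * (3 * k + 1) <= d by rewrite -ler_pdivlMr// ge_min lexx orbT.
have e0 : 0 < a ^+ 2 / 24 by rewrite divr_gt0// exprn_gt0.
apply: (le_trans (h _ _ e0 a0)).
set b := 4 * _.
rewrite -(EFinM (1 + a) k) -(EFinM (1 + a^-1) b) -EFinD.
rewrite -EFinD lee_fin /b.
apply: le_trans (lerD (lexx k) ak).
have -> : (1 + a) * ((1 + a) * k + (1 + a^-1) * (4 * (a ^+ 2 / 24))) +
    (1 + a^-1) * (4 * (a ^+ 2 / 24)) = (1 + a) ^+ 2 * k + (a + 1) * a * (2 + a) / 6.
  by field; exact: lt0r_neq0.
have h2 : a ^+ 2 <= a by rewrite expr2 ler_piMr// ltW.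
have h3 : a ^+ 3 <= a by rewrite exprS ler_piMr ?(le_trans h2)// ltW.
have : a ^+ 2 * k <= a * k by rewrite ler_wpM2r.
by nra.
Qed.

Theorem theorem24 (R : realType) (X Y : hilbertType R)
    (sepX : separable X) (sepY : separable Y)
    (infX : infinite_dim X) (infY : infinite_dim Y)
    (C : X -> X) (gamma : probability (borel X) R)
    (gaussian_gamma : centered_gaussian C gamma)
    (nondegenerate_gamma : injective C)
    (F : X -> Y) (DF : X -> X -> Y)
    (H1F : gaussian_H1 C gamma F DF)
    (v : nat -> X)
    (onb_v : orthonormal_basis (cameron_martin C) (cm_dot C) v)
    (range_v : forall i, range C (v i))
    (r : nat) (EF : X -> Y)
    (condexp_EF : is_condexp gamma (sigma_encoder C v r) F EF) :
  (\int[gamma]_x (`|F x - EF x| ^+ 2)%:E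
   <= \int[gamma]_x hs_norm2 C (fun h => DF x (h - encoder_proj C v r h)%R))%E.
Proof.
have [mF _ _] := H1F.
apply: le_of_approx => [|e a e0 a0].
  apply: integral_ge0 => x _; apply: nneseries_ge0 => i _ _.
  by rewrite lee_fin sqr_ge0.
have [s [Fs Fh]] := poincare_approx sepY gaussian_gamma nondegenerate_gamma H1F
  onb_v range_v r e0 a0.
have [M sM] := trig_poly_bounded s.
have [K hK] := trig_poly_bounded (trig_head_terms C v r s).
apply: le_trans Fh.
apply: (condexp_le sepY _ _ mF _ condexp_EF _ hK).
- exact: encoder_sigma_algebra.
- exact: encoder_measurable.
(* F is integrable since it lies at finite square distance from a bounded trigonometric
   polynomial. *)
- apply: (integral_norm_lty sepY mF _ sM).
    by apply: continuous_borel_measurable_fun; exact: trig_poly_continuous.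
  by apply: le_lt_trans Fs _; exact: ltry.
- exact: trig_head_encoder.
Qed.
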